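(* Let $L$ be an algebraic number field with ring of integers $\mathcal{O}_L$, and let $p \in \mathcal{O}_L[x_1,\dots,x_d]$ be an intersective polynomial. For any action $T$ of the additive group of $\mathcal{O}_L$ on a probability space $(X,\mathscr{B},\mu)$ and any $B \in \mathscr{B}$, the set $$\{ u \in \mathcal{O}_L^d : \mu(B \cap T^{p(u)} B) > \mu(B)^2 - \varepsilon \}$$ is an $\mathrm{AIP}^*_+$ subset of the additive group $\mathcal{O}_L^d$ for any $\varepsilon > 0$.
   Context: Actions are by measurable, measure-preserving transformations $T^g$. A polynomial $p \in R[x_1,\dots,x_d]$ over a commutative ring $R$ with identity is intersective if for any finite index subgroup $\Lambda$ of (the additive group of) $R$ there is $\zeta \in R^d$ with $p(\zeta) \in \Lambda$. Let $G$ be an abelian group. An IP set in $G$ is any subset of $G$ containing a set of the form $\{ \sum_{n \in \alpha} x_n : \emptyset \ne \alpha \subset \mathbb{N}, |\alpha| < \infty \}$ for some sequence $(x_n)_{n\in\mathbb{N}}$ in $G$. A subset of $G$ is $\mathrm{IP}^*$ if its intersection with every IP set in $G$ is non-empty. A Følner sequence in $G$ is a sequence $N \mapsto \Phi_N$ of finite non-empty subsets of $G$ with $\lim_{N\to\infty} |(g+\Phi_N)\cap\Phi_N|/|\Phi_N| = 1$ for all $g \in G$. The upper Banach density of $S \subset G$ is $\mathrm{d}^*(S) = \sup_\Phi \limsup_{N\to\infty} |S\cap\Phi_N|/|\Phi_N|$, the supremum being over all Følner sequences $\Phi$ in $G$. A subset of $G$ is $\mathrm{AIP}^*$ if it is of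 the form $A\setminus B$ where $A$ is $\mathrm{IP}^*$ and $\mathrm{d}^*(B)=0$, and $\mathrm{AIP}^*_+$ if it is a shift (translate) of an $\mathrm{AIP}^*$ set. *)

(* Defs.v *)
From HB Require Import structures.
From mathcomp Require Import all_boot all_order all_algebra all_field.
From mathcomp Require Import finmap.
From mathcomp Require Import all_classical all_reals all_analysis.
(* Not imported: the notations of mpoly clash with those of analysis. *)
From mathcomp Require mpoly.

Set Implicit Arguments.
Unset Strict Implicit.
Unset Printing Implicit Defensive.

Import Order.TTheory GRing.Theory Num.Theory.
Import numFieldNormedType.Exports.

Local Open Scope classical_set_scope.
Local Open Scope ring_scope.

(* A number field is a fieldExtType rat: a finite-dimensional field extension
   of the rationals. *)

Definition integral_elements (L : fieldExtType rat) : {pred L} :=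
  fun x => `[< integralOver (intr : int -> L) x >].
Arguments integral_elements : clear implicits.

Lemma integral_elements_subring (L : fieldExtType rat) :
  subring_closed (integral_elements L).
Proof.
split; first by apply/asboolP; exact: integral1.
- by move=> x y /asboolP ix /asboolP iy; apply/asboolP; exact: integral_sub.
- by move=> x y /asboolP ix /asboolP iy; apply/asboolP; exact: integral_mul.
Qed.

HB.instance Definition _ (L : fieldExtType rat) :=
  GRing.isSubringClosed.Build L (integral_elements L)
    (@integral_elements_subring L).

Record ring_of_integers (L : fieldExtType rat) := RingOfIntegers {
  integer_val :> L;
  integer_valP : integer_val \in integral_elements L }.

HB.instance Definition _ (L : fieldExtType rat) :=
  [isSub for @integer_val L].
HB.instance Definition _ (L : fieldExtType rat) :=
  [Choice of ring_of_integers L by <:].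
HB.instance Definition _ (L : fieldExtType rat) :=
  [SubChoice_isSubComNzRing of ring_of_integers L by <:].

Definition finite_index (G : zmodType) (H : set G) : Prop :=
  finite_set [set [set g + h | h in H] | g in [set: G]].

Definition intersective (A : comNzRingType) (n : nat) (p : mpoly.mpoly n A) :
    Prop :=
  forall H : zmodClosed A, finite_index [set` H] ->
    exists zeta : {ffun 'I_n -> A}, mpoly.meval zeta p \in H.

Section AdditiveCombinatorics.
Variables (R : realType) (G : zmodType).
Implicit Types (S A B : set G) (Phi : nat -> {fset G}).

Definition IP_set S : Prop :=
  exists x : nat -> G,
    [set \sum_(n <- enum_fset a) x n | a in [set a : {fset nat} | a != fset0]]
      `<=` S.

Definition IP_star S : Prop :=
  forall I, IP_set I -> S `&` I !=set0.

Definition folner Phi : Prop :=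
  (forall N, Phi N != fset0) /\
  (forall g : G,
    (#|` ([fset (g + x)%R | x in Phi N] `&` Phi N)%fset|%:R
      / #|` Phi N|%:R : R) @[N --> \oo] --> (1 : R)).

Definition upper_density_along Phi S : \bar R :=
  limn_esup (fun N =>
    (#|` [fset x in Phi N | `[< S x >]]%fset|%:R / #|` Phi N|%:R)%:E).

(* No Folner sequence exists when G is uncountable; the supremum is then
   -oo. *)
Definition upper_banach_density S : \bar R :=
  ereal_sup [set upper_density_along Phi S | Phi in [set Phi | folner Phi]].

Definition AIP_star S : Prop :=
  exists A B, [/\ IP_star A, upper_banach_density B = 0%E & S = A `\` B].

Definition AIP_star_plus S : Prop :=
  exists g A, AIP_star A /\ S = [set g + a | a in A].

End AdditiveCombinatorics.

Definition measure_preserving_action (R : realType) (G : zmodType)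
    (dX : measure_display) (X : measurableType dX)
    (mu : {measure set X -> \bar R}) (T : G -> X -> X) : Prop :=
  [/\ forall x, T 0 x = x,
      forall g h x, T (g + h) x = T g (T h x),
      forall g, measurable_fun [set: X] (T g) &
      forall g (B : set X), measurable B -> mu (T g @^-1` B) = mu B].

(* Main.v *)
Require Import Defs.
From HB Require Import structures.
From mathcomp Require Import all_boot all_order all_algebra all_field.
From mathcomp Require Import finmap.
From mathcomp Require Import all_classical all_reals all_analysis.
From mathcomp Require Import measurable_realfun.
From mathcomp Require mpoly.
From mathcomp Require Import freeg.
From mathcomp Require Import ring lra zify.

Import Order.TTheory GRing.Theory Num.Theory.
Import numFieldNormedType.Exports.

Local Open Scope classical_set_scope.
Local Open Scope ring_scope.
Set Implicit Arguments.
Unset Strict Implicit.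
Unset Printing Implicit Defensive.

(** Only one feature of the dynamical system matters: the correlation
phi(g) = mu(B cap T^g B) - mu(B)^2 is a positive definite function on the
additive group of A = O_L, because a double sum of its values is the integral
of the square of a combination of the functions 1_{T^g B} - mu(B).  So it
suffices to show that {u | -eps < phi(p(u))} is AIP*_+ for every positive
definite phi (large_returns).

Write phi(g) = <U^g f, f> for isometries U^g of a Hilbert space and project f
on the closed subspace of the vectors with totally bounded orbit: f = c + w,
and phi(g) = <U^g c, c> + <U^g w, w> since the cross terms vanish.

The second term is negligible.  If w is orthogonal to all vectors with totally
bounded orbit, the averages of <U^g w, w>^2 along every nonzero ideal a A can
be made small (weak_mixing): otherwise the mean ergodic theorem in the tensor
square gives an invariant Hilbert-Schmidt operator that sends w to a vector
with totally bounded orbit not orthogonal to w.  Weyl differencing turns this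
into the smallness of averages along polynomials (weyl), for one finite weight
that serves all polynomials of given degree and leading coefficient.  After a
substitution of powers of one variable t (kronecker) it bounds averages over t
of the values at p(u + s(t)), uniformly in u, so averages along any Folner
sequence are small as well and {u | |<U^p(u) w, w>| >= eps/2} has upper Banach
density zero (zero_density).

The first term is controlled by the totally bounded pseudo-norm
rho(g) = ||U^g c - c||, as <U^g c, c> >= - rho(g)^2 / 2.  The intersective
hypothesis gives one point zeta with rho(p(zeta)) small (bohr_recurrence), and
then {u | rho(p(zeta + u) - p(zeta)) < delta} is IP* because the polynomial
map p(zeta + u) - p(zeta) vanishes at 0 (ip_recurrence: descent on the degree
and the pigeonhole principle).  The shift in AIP*_+ is this zeta.

To find zeta, note that psi(g) = <U^g c, c> / ||c||^2 is close to 1 where rho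
is small, so that F = ((1 + psi) / 2)^k is a positive definite function
concentrated there, whose mean exceeds the size of F elsewhere once k is
large.  A positive definite function with mean at least m takes values almost
as large as m on an intersective polynomial (posdef_recurrence): its vector
splits into a limit of vectors fixed by nonzero ideals, which sees only
p(zeta) modulo an ideal b A of finite index, and a remainder to which weyl
applies.

The arithmetic input is that A is a domain of characteristic zero, that 2 is
not invertible in A (which disposes of constant polynomials), and that nonzero
ideals have finite index.  The last fact needs no integral basis: for every
subgroup P of a rational vector space of finite dimension, P / N P is finite,
by induction on the dimension (coords_cover). *)

(** * Isometric actions on semi-inner product spaces *)
(** The form is only positive semi-definite: a vector of norm zero need not
be zero.  This spares a quotient in the constructions below; equalities of
vectors are expressed through [nm] or through the form. *)
Record isorep (R : realType) (G : zmodType) := IsoRep {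
  rep_space :> lmodType R;
  ip : rep_space -> rep_space -> R;
  act : G -> rep_space -> rep_space;
  ipC : forall x y, ip x y = ip y x;
  ipPl : forall a x y z, ip (a *: x + y) z = a * ip x z + ip y z;
  ip_ge0 : forall x, 0 <= ip x x;
  actP : forall g a x y, act g (a *: x + y) = a *: act g x + act g y;
  act_iso : forall g x y, ip (act g x) (act g y) = ip x y;
  act0 : forall x, act 0 x = x;
  actD : forall g h x, act (g + h) x = act g (act h x) }.

Section IsoRep.
Variables (R : realType) (G : zmodType) (H : isorep R G).
Implicit Types (x y z : H) (g h : G) (a b : R).

Lemma ip0l y : ip 0 y = 0.
Proof.
have := ipPl 1 (0 : H) 0 y; rewrite scaler0 addr0 mul1r => e.
by apply: (addrI (ip (0 : H) y)); rewrite -e addr0.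
Qed.
Lemma ipDl x y z : ip (x + y) z = ip x z + ip y z.
Proof. by have := ipPl 1 x y z; rewrite scale1r mul1r. Qed.
Lemma ipZl a x z : ip (a *: x) z = a * ip x z.
Proof. by have := ipPl a x 0 z; rewrite ip0l !addr0. Qed.
Lemma ipNl x z : ip (- x) z = - ip x z.
Proof. by rewrite -scaleN1r ipZl mulN1r. Qed.
Lemma ipBl x y z : ip (x - y) z = ip x z - ip y z.
Proof. by rewrite ipDl ipNl. Qed.
Lemma ipDr x y z : ip x (y + z) = ip x y + ip x z.
Proof. by rewrite ipC ipDl !(ipC x). Qed.
Lemma ipZr a x z : ip x (a *: z) = a * ip x z.
Proof. by rewrite ipC ipZl (ipC x). Qed.
Lemma ipNr x z : ip x (- z) = - ip x z.
Proof. by rewrite ipC ipNl (ipC x). Qed.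
Lemma ipBr x y z : ip x (y - z) = ip x y - ip x z.
Proof. by rewrite ipDr ipNr. Qed.
Lemma ip_suml (I : Type) (r : seq I) (P : pred I) (F : I -> H) y :
  ip (\sum_(i <- r | P i) F i) y = \sum_(i <- r | P i) ip (F i) y.
Proof. by elim/big_rec2: _ => [|i u v _ <-]; rewrite ?ip0l ?ipDl. Qed.
Lemma ip_sumr (I : Type) (r : seq I) (P : pred I) (F : I -> H) y :
  ip y (\sum_(i <- r | P i) F i) = \sum_(i <- r | P i) ip y (F i).
Proof. by rewrite ipC ip_suml; apply: eq_bigr => i _; rewrite ipC. Qed.

Lemma act_add g x y : act g (x + y) = act g x + act g y.
Proof. by have := actP g 1 x y; rewrite !scale1r. Qed.
Lemma act_0 g : act g 0 = 0 :> H.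
Proof. by apply: (addrI (act g 0)); rewrite -act_add !addr0. Qed.
Lemma act_scale g a x : act g (a *: x) = a *: act g x.
Proof. by have := actP g a x 0; rewrite act_0 !addr0. Qed.
Lemma act_opp g x : act g (- x) = - act g x.
Proof. by rewrite -scaleN1r act_scale scaleN1r. Qed.
Lemma act_sub g x y : act g (x - y) = act g x - act g y.
Proof. by rewrite act_add act_opp. Qed.
Lemma act_sum (I : Type) (r : seq I) (P : pred I) (F : I -> H) g :
  act g (\sum_(i <- r | P i) F i) = \sum_(i <- r | P i) act g (F i).
Proof. by elim/big_rec2: _ => [|i u v _ <-]; rewrite ?act_0 ?act_add. Qed.
Lemma actK g x : act (- g) (act g x) = x.
Proof. by rewrite -actD addNr act0. Qed.
Lemma actNK g x : act g (act (- g) x) = x.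
Proof. by rewrite -actD subrr act0. Qed.
Lemma act_adj g x y : ip (act g x) y = ip x (act (- g) y).
Proof. by rewrite -(act_iso (- g)) actK. Qed.
Lemma ip_act2 g h x y : ip (act g x) (act h y) = ip (act (g - h) x) y.
Proof. by rewrite [g - h]addrC actD [RHS]act_adj opprK. Qed.

Definition nm x : R := Num.sqrt (ip x x).

Lemma nm_ge0 x : 0 <= nm x. Proof. exact: sqrtr_ge0. Qed.
Lemma nm2 x : nm x ^+ 2 = ip x x. Proof. by rewrite sqr_sqrtr ?ip_ge0. Qed.
Lemma nm0 : nm 0 = 0. Proof. by rewrite /nm ip0l sqrtr0. Qed.
Lemma nmZ a x : nm (a *: x) = `|a| * nm x.
Proof. by rewrite /nm ipZl ipZr mulrA -expr2 sqrtrM ?sqr_ge0 // sqrtr_sqr. Qed.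
Lemma nmN x : nm (- x) = nm x. Proof. by rewrite -scaleN1r nmZ normrN1 mul1r. Qed.
Lemma nmBC x y : nm (x - y) = nm (y - x). Proof. by rewrite -nmN opprB. Qed.
Lemma nm_act g x : nm (act g x) = nm x. Proof. by rewrite /nm act_iso. Qed.

(** Expand ip z z >= 0 at z = x - (ip x y / ip y y) y.  When ip y y = 0 a
nonzero ip x y would make ip z z negative for a large multiple of y. *)
Lemma cauchy_schwarz_sqr x y : ip x y ^+ 2 <= ip x x * ip y y.
Proof.
have [yy0|yyn0] := eqVneq (ip y y) 0.
  have [->|n0] := eqVneq (ip x y) 0; first by rewrite yy0 expr0n /= mulr0.
  have := ip_ge0 (x - ((ip x x + 1) / ip x y) *: y).
  rewrite ipBl !ipBr !ipZl !ipZr yy0 (ipC y x) !mulr0 subr0 divfK //.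
  by have := ip_ge0 x; lra.
have yy : 0 < ip y y by rewrite lt_def yyn0 ip_ge0.
have := ip_ge0 (x - (ip x y / ip y y) *: y).
rewrite ipBl !ipBr !ipZl !ipZr (ipC y x).
have -> : ip x x - ip x y / ip y y * ip x y -
  (ip x y / ip y y * ip x y - ip x y / ip y y * (ip x y / ip y y * ip y y)) =
  (ip x x * ip y y - ip x y ^+ 2) / ip y y by field.
by rewrite pmulr_lge0 ?invr_gt0 // subr_ge0.
Qed.

Lemma cauchy_schwarz x y : `|ip x y| <= nm x * nm y.
Proof.
rewrite -ler_sqr ?nnegrE ?mulr_ge0 ?nm_ge0 // exprMn !nm2 real_normK ?num_real //.
exact: cauchy_schwarz_sqr.
Qed.
Lemma cauchy_schwarz_le x y : ip x y <= nm x * nm y.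
Proof. exact: le_trans (ler_norm _) (cauchy_schwarz _ _). Qed.

Lemma nmD x y : nm (x + y) <= nm x + nm y.
Proof.
rewrite -ler_sqr ?nnegrE ?addr_ge0 ?nm_ge0 // nm2 sqrrD !nm2.
rewrite ipDl !ipDr (ipC y x); have := cauchy_schwarz_le x y; lra.
Qed.
Lemma nmB x y : nm (x - y) <= nm x + nm y.
Proof. by rewrite (le_trans (nmD _ _)) ?nmN. Qed.
Lemma nm_tri y x z : nm (x - z) <= nm (x - y) + nm (y - z).
Proof. by rewrite (le_trans _ (nmD _ _)) // subrKA. Qed.
Lemma nm_sum (I : Type) (r : seq I) (F : I -> H) :
  nm (\sum_(i <- r) F i) <= \sum_(i <- r) nm (F i).
Proof.
elim/big_rec2: _ => [|i u v _ h]; first by rewrite nm0.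
by rewrite (le_trans (nmD _ _)) // lerD.
Qed.
Lemma nm_ltD x y e : nm x < e / 2 -> nm y < e / 2 -> nm (x + y) < e.
Proof. by have := nmD x y; lra. Qed.

Lemma parallelogram x y :
  nm (x - y) ^+ 2 = 2 * nm x ^+ 2 + 2 * nm y ^+ 2
                    - 4 * nm ((1/2) *: x + (1/2) *: y) ^+ 2.
Proof.
rewrite !nm2 !(ipDl, ipDr, ipNl, ipNr, ipZl, ipZr) (ipC y x).
by field.
Qed.

Definition seq_cvg (u : nat -> H) l :=
  forall e : R, 0 < e -> exists N, forall n, (N <= n)%N -> nm (u n - l) < e.
Definition seq_cauchy (u : nat -> H) :=
  forall e : R, 0 < e -> exists N, forall m n, (N <= m)%N -> (N <= n)%N ->
    nm (u m - u n) < e.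
Definition rep_complete := forall u, seq_cauchy u -> exists l, seq_cvg u l.

End IsoRep.
Arguments ip {R G _}.

(** * The Gelfand-Naimark-Segal construction *)
Section Free.
Variables (R : realType) (I : choiceType).
Definition free_space : lmodType R := freeg.FreegDefs.type_of (Phant R) (Phant I).
Definition free_gen (i : I) : free_space := freeg.Freeg [:: (1, i)].
Section Lift.
Variables (M : lmodType R) (f : I -> M).
Definition free_lift (x : free_space) : M := freeg.fglift f x.
Lemma free_liftD x y : free_lift (x + y) = free_lift x + free_lift y.
Proof.
have a := @freeg.lift_is_additive R I M f.
have h0 u v : free_lift (u - v) = free_lift u - free_lift v by exact: a.
have h00 : free_lift 0 = 0 by rewrite -(subrr (0 : free_space)) h0 subrr.
by rewrite -[in LHS](opprK y) h0 -(sub0r y) h0 h00 sub0r opprK.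
Qed.
Lemma free_lift0 : free_lift 0 = 0.
Proof. by apply: (addrI (free_lift 0)); rewrite -free_liftD !addr0. Qed.
Lemma free_lift_sum (J : Type) (r : seq J) (P : pred J) (F : J -> free_space) :
  free_lift (\sum_(i <- r | P i) F i) = \sum_(i <- r | P i) free_lift (F i).
Proof. by elim/big_rec2: _ => [|i u v _ <-]; rewrite ?free_lift0 ?free_liftD. Qed.
Lemma free_liftE x :
  free_lift x = \sum_(i <- freeg.dom x) freeg.coeff i x *: f i.
Proof.
rewrite -[in LHS](freeg.freeg_sumE x) free_lift_sum.
by apply: eq_bigr => i _; rewrite /free_lift freeg.liftU.
Qed.
Lemma free_liftZ c x : free_lift (c *: x) = c *: free_lift x.
Proof.
rewrite [c *: x]/(freeg.fgscale c x) free_lift_sum (free_liftE x) scaler_sumr.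
by apply: eq_bigr => i _; rewrite /free_lift freeg.liftU scalerA.
Qed.
Lemma free_lift_gen i : free_lift (free_gen i) = f i.
Proof. by rewrite /free_lift freeg.liftU scale1r. Qed.
End Lift.

Lemma eq_free_lift (M : lmodType R) (f g : I -> M) x :
  f =1 g -> free_lift f x = free_lift g x.
Proof. by move=> e; rewrite !free_liftE; apply: eq_bigr => i _; rewrite e. Qed.

End Free.

Definition psd_kernel (R : realType) (I : Type) (K : I -> I -> R) :=
  forall n (c : 'I_n -> R) (x : 'I_n -> I),
    0 <= \sum_(i < n) \sum_(j < n) c i * c j * K (x i) (x j).

Section GNS.
Variables (R : realType) (G : zmodType) (I : choiceType) (K : I -> I -> R).
Variables (a : G -> I -> I).
Hypothesis KC : forall i j, K i j = K j i.
Hypothesis Kpsd : psd_kernel K.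
Hypothesis Ka : forall g i j, K (a g i) (a g j) = K i j.
Hypothesis a0 : forall i, a 0 i = i.
Hypothesis aD : forall g h i, a (g + h) i = a g (a h i).

Definition gns_ip (x y : free_space R I) : R :=
  free_lift (fun i => (free_lift (fun j => K i j : R^o) y : R^o)) x.
Definition gns_act g (x : free_space R I) : free_space R I :=
  free_lift (fun i => free_gen R (a g i)) x.

Lemma gns_ipE x y : gns_ip x y =
  \sum_(i <- dom x) \sum_(j <- dom y) coeff i x * coeff j y * K i j.
Proof.
rewrite /gns_ip free_liftE; apply: eq_bigr => i _.
rewrite free_liftE scaler_sumr; apply: eq_bigr => j _.
by rewrite scalerA.
Qed.

Lemma gns_ipC x y : gns_ip x y = gns_ip y x.
Proof.
rewrite !gns_ipE exchange_big; apply: eq_bigr => i _; apply: eq_bigr => j _.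
by rewrite KC (mulrC (coeff j x)).
Qed.
Lemma gns_ipPl c x y z : gns_ip (c *: x + y) z = c * gns_ip x z + gns_ip y z.
Proof. by rewrite /gns_ip free_liftD free_liftZ. Qed.
Lemma gns_ip_ge0 x : 0 <= gns_ip x x.
Proof.
rewrite gns_ipE.
have := @Kpsd (size (dom x)) (fun i => coeff (tnth (in_tuple (dom x)) i) x)
  (fun i => tnth (in_tuple (dom x)) i).
rewrite -(big_tuple _ _ _ xpredT (fun i => \sum_(j < _) coeff i x *
  coeff (tnth (in_tuple (dom x)) j) x * K i (tnth (in_tuple (dom x)) j))) /=.
congr (_ <= _); apply: eq_bigr => i _.
by rewrite -(big_tuple _ _ _ xpredT (fun j => coeff i x * coeff j x * K i j)).
Qed.
Lemma gns_actP g c x y :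
  gns_act g (c *: x + y) = c *: gns_act g x + gns_act g y.
Proof. by rewrite /gns_act free_liftD free_liftZ. Qed.
Lemma gns_act_iso g x y : gns_ip (gns_act g x) (gns_act g y) = gns_ip x y.
Proof.
have actl f z : free_lift (f : I -> R^o) (gns_act g z) = free_lift (f \o a g) z.
  rewrite /gns_act free_liftE [in LHS](free_liftE _ z) -free_liftE.
  rewrite free_lift_sum free_liftE; apply: eq_bigr => i _.
  by rewrite free_liftZ free_lift_gen.
rewrite /gns_ip actl; apply: eq_free_lift => i /=; rewrite actl.
by apply: eq_free_lift => j /=; rewrite Ka.
Qed.
Lemma gns_act_gen g i : gns_act g (free_gen R i) = free_gen R (a g i).
Proof. exact: free_lift_gen. Qed.
(** Linear maps out of the free space, in particular the two sides of the
action laws, are compared on generators through this decomposition. *)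
Lemma free_gen_sum (x : free_space R I) : x = \sum_(i <- dom x) coeff i x *: free_gen R i.
Proof.
rewrite -[LHS](freeg_sumE x); apply: eq_bigr => i _.
apply/eqP/freeg_eqP => j; rewrite coeffZ !coeffU; ring.
Qed.
Lemma gns_act0 x : gns_act 0 x = x.
Proof.
rewrite [RHS]free_gen_sum /gns_act free_liftE.
by apply: eq_bigr => i _; rewrite a0.
Qed.
Lemma gns_actD g h x : gns_act (g + h) x = gns_act g (gns_act h x).
Proof.
rewrite (free_liftE _ x : gns_act h x = _) [LHS]free_liftE [RHS]free_lift_sum.
by apply: eq_bigr => i _; rewrite free_liftZ free_lift_gen aD.
Qed.

(** Formal combinations of the indices, with the form prescribed by the kernel
on generators and the action permuting the generators. *)
Definition gns_rep : isorep R G := IsoRep gns_ipC gns_ipPl gns_ip_ge0 gns_actP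
  gns_act_iso gns_act0 gns_actD.

Lemma gns_ip_gen i j : gns_ip (free_gen R i) (free_gen R j) = K i j.
Proof. by rewrite /gns_ip !free_lift_gen. Qed.

End GNS.

(** * Completion *)
Lemma cvg_real_epsN (R : realType) (u : nat -> R) (l : R) :
  (u @ \oo --> l) <->
  (forall e : R, 0 < e -> exists N, forall n, (N <= n)%N -> `|u n - l| < e).
Proof.
split=> [/cvgrPdist_lt h e e0|h].
  have [N _ hN] := h e e0.
  by exists N => n Nn; rewrite distrC; exact: hN.
apply/cvgrPdist_lt => e e0; have [N hN] := h e e0.
by exists N => // n Nn; rewrite distrC; exact: hN.
Qed.

Lemma real_cauchy_cvg (R : realType) (u : nat -> R) :
  (forall e : R, 0 < e -> exists N, forall m n, (N <= m)%N -> (N <= n)%N ->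
     `|u m - u n| < e) -> cvgn u.
Proof.
move=> h; apply/cauchy_cvgP/cauchy_ballP => e e0.
have [N hN] := h e e0.
pose S := [set x | exists2 n, (N <= n)%N & x = u n].
have S1 : \forall n \near \oo, S (u n) by exists N => // n Nn; exists n.
exists (S, S); first by split.
by move=> -[_ _] [/= [m hm ->] [n hn ->]]; exact: hN.
Qed.

Lemma harmonic_lt (R : realType) (e : R) : 0 < e ->
  exists N, forall n, (N <= n)%N -> n.+1%:R^-1 < e.
Proof.
move=> e0; have := cvg_harmonic (R := R).
move/cvg_real_epsN => /(_ e e0) [N hN]; exists N => n /hN.
by rewrite subr0 /harmonic /= ger0_norm.
Qed.

Section CauchyBasics.
Variables (R : realType) (G : zmodType) (H : isorep R G).
Implicit Types (u v : nat -> H).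

Lemma cauchy_bounded u : seq_cauchy u -> exists2 M, 0 < M & forall n, nm (u n) <= M.
Proof.
move=> /(_ 1 ltr01) [N hN].
exists (\sum_(i < N.+1) nm (u i) + 1) => [|n].
  by rewrite ltr_wpDl // sumr_ge0 // => i _; exact: nm_ge0.
have le k : (k <= N)%N -> nm (u k) <= \sum_(i < N.+1) nm (u i).
  rewrite -ltnS => kN; rewrite (bigD1 (Ordinal kN)) //= lerDl.
  by rewrite sumr_ge0 // => i _; exact: nm_ge0.
have [/le h|/ltnW Nn] := leqP n N; first by rewrite (le_trans h) // lerDl.
have := hN _ _ Nn (leqnn N); have := le _ (leqnn N).
have := nmD (u n - u N) (u N); rewrite subrK; lra.
Qed.

Lemma cauchy_ip u v : seq_cauchy u -> seq_cauchy v -> cvgn (fun n => ip (u n) (v n)).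
Proof.
move=> cu cv; have [M M0 hM] := cauchy_bounded cu.
have [M' M'0 hM'] := cauchy_bounded cv.
apply: real_cauchy_cvg => e e0.
have [|N1 h1] := cu (e / (2 * M')); first by rewrite divr_gt0 // mulr_gt0.
have [|N2 h2] := cv (e / (2 * M)); first by rewrite divr_gt0 // mulr_gt0.
exists (maxn N1 N2) => m n; rewrite !geq_max => /andP[m1 m2] /andP[n1 n2].
have -> : ip (u m) (v m) - ip (u n) (v n) =
   ip (u m - u n) (v m) + ip (u n) (v m - v n).
  by rewrite ipBl ipBr; ring.
rewrite (le_lt_trans (ler_normD _ _)) //.
have -> : e = e / (2 * M') * M' + M * (e / (2 * M)) by field; rewrite !gt_eqF.
apply: ltr_leD.
  rewrite (le_lt_trans (cauchy_schwarz _ _)) // (le_lt_trans (y := nm (u m - u n) * M')) //.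
    by rewrite ler_wpM2l // nm_ge0.
  by rewrite ltr_pM2r // h1.
by rewrite (le_trans (cauchy_schwarz _ _)) // ler_pM ?nm_ge0 // ltW // h2.
Qed.

Lemma cauchy_cst x : seq_cauchy (fun=> x : H).
Proof. by move=> e e0; exists 0%N => m n _ _; rewrite subrr nm0. Qed.

Lemma cauchy_linear c u v : seq_cauchy u -> seq_cauchy v -> seq_cauchy (c *: u + v).
Proof.
move=> cu cv e e0.
have cp : 0 < `|c| + 1 by rewrite ltr_wpDl.
have [|N1 h1] := cu (e / 2 / (`|c| + 1)); first by rewrite !divr_gt0.
have [|N2 h2] := cv (e / 2); first by rewrite divr_gt0.
exists (maxn N1 N2) => m n; rewrite !geq_max => /andP[m1 m2] /andP[n1 n2].
have -> : (c *: u + v) m - (c *: u + v) n = c *: (u m - u n) + (v m - v n).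
  by rewrite scalerBr [in LHS]/GRing.add /= opprD addrACA.
apply: nm_ltD; last exact: h2.
have := h1 _ _ m1 n1; rewrite nmZ ltr_pdivlMr // => h.
by rewrite (le_lt_trans _ h) // mulrC ler_wpM2l ?nm_ge0 // lerDl.
Qed.

Lemma cauchy_act g u : seq_cauchy u -> seq_cauchy (fun n => act g (u n)).
Proof.
move=> cu e /cu [N h]; exists N => m n hm hn.
by rewrite -act_sub nm_act; exact: h.
Qed.

Lemma seq_cvg_ip u x y : seq_cvg u x -> (fun n => ip (u n) y) @ \oo --> ip x y.
Proof.
move=> cu; apply/cvg_real_epsN => e e0.
have yp : 0 < nm y + 1 by rewrite ltr_wpDl // nm_ge0.
have [|N h] := cu (e / (nm y + 1)); first by rewrite divr_gt0.
exists N => n /h; rewrite ltr_pdivlMr // => hn.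
rewrite -ipBl (le_lt_trans (cauchy_schwarz _ _)) // (le_lt_trans _ hn) //.
by rewrite ler_wpM2l ?nm_ge0 // lerDl.
Qed.

End CauchyBasics.

Section Completion.
Variables (R : realType) (G : zmodType) (H : isorep R G).

Definition cauchy_pred : {pred (nat -> H)} := fun u => `[< seq_cauchy u >].
Lemma cauchy_pred_submod : submod_closed cauchy_pred.
Proof.
split; first by apply/asboolP; exact: cauchy_cst.
by move=> c u v /asboolP cu /asboolP cv; apply/asboolP; exact: cauchy_linear.
Qed.
HB.instance Definition _ :=
  GRing.isSubmodClosed.Build R (nat -> H) cauchy_pred cauchy_pred_submod.

Record cauchy_space := CauchySpace { cval :> nat -> H; cvalP : cval \in cauchy_pred }.
HB.instance Definition _ := [isSub for cval].
HB.instance Definition _ := [Choice of cauchy_space by <:].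
HB.instance Definition _ := [SubChoice_isSubLmodule of cauchy_space by <:].

Lemma cauchy_spaceP (x : cauchy_space) : seq_cauchy x.
Proof. by have /asboolP := cvalP x. Qed.

Definition mk_cauchy u (h : seq_cauchy u) : cauchy_space := CauchySpace (asboolT h : u \in cauchy_pred).

Definition cip (x y : cauchy_space) : R := limn (fun n => ip (x n) (y n)).
Definition cact g (x : cauchy_space) : cauchy_space := mk_cauchy (cauchy_act g (cauchy_spaceP x)).

Lemma cip_cvg (x y : cauchy_space) : (fun n => ip (x n) (y n)) @ \oo --> cip x y.
Proof. exact: (cauchy_ip (cauchy_spaceP x) (cauchy_spaceP y)). Qed.

Lemma cipC x y : cip x y = cip y x.
Proof. by rewrite /cip; under eq_fun do rewrite ipC. Qed.

Lemma cipPl c x y z : cip (c *: x + y) z = c * cip x z + cip y z.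
Proof.
apply/cvg_lim => //.
have -> : (fun n => ip ((c *: x + y) n) (z n)) =
          (fun n => c * ip (x n) (z n) + ip (y n) (z n)).
  apply/funext => n.
  by rewrite -ipPl.
apply: (@cvgD R R^o _ \oo _ (fun n => c * ip (x n) (z n))); last exact: cip_cvg.
by apply: (@cvgM R _ \oo _ (fun=> c)); [exact: cvg_cst|exact: cip_cvg].
Qed.

Lemma cip_ge0 x : 0 <= cip x x.
Proof.
apply: limr_ge; first exact: (cauchy_ip (cauchy_spaceP x) (cauchy_spaceP x)).
by apply: nearW => n; exact: ip_ge0.
Qed.

Lemma cauchy_space_eq (x y : cauchy_space) : (forall n, x n = y n) -> x = y.
Proof. by move=> h; apply: val_inj; apply/funext. Qed.

Lemma cactP g c x y : cact g (c *: x + y) = c *: cact g x + cact g y.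
Proof. by apply: cauchy_space_eq => n; exact: actP. Qed.
Lemma cact_iso g x y : cip (cact g x) (cact g y) = cip x y.
Proof. by rewrite /cip /=; under eq_fun do rewrite act_iso. Qed.
Lemma cact0 x : cact 0 x = x.
Proof. by apply: cauchy_space_eq => n; exact: act0. Qed.
Lemma cactD g h x : cact (g + h) x = cact g (cact h x).
Proof. by apply: cauchy_space_eq => n; exact: actD. Qed.

Definition completion : isorep R G :=
  IsoRep cipC cipPl cip_ge0 cactP cact_iso cact0 cactD.

Definition cembed (x : H) : completion := mk_cauchy (cauchy_cst x).

Lemma ip_cembed x y : ip (cembed x) (cembed y) = ip x y.
Proof. by rewrite /= /cip /=; apply: (@lim_cst R). Qed.
Lemma act_cembed g x : act g (cembed x) = cembed (act g x).
Proof. exact: cauchy_space_eq. Qed.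

Lemma nm_completion_le (x : completion) e N :
  (forall n, (N <= n)%N -> nm (cval x n) <= e) -> nm x <= e.
Proof.
move=> h; have e0 : 0 <= e by exact: le_trans (nm_ge0 _) (h N (leqnn _)).
rewrite -ler_sqr ?nnegrE ?nm_ge0 // nm2.
apply: limr_le; first exact: (cauchy_ip (cauchy_spaceP x) (cauchy_spaceP x)).
exists N => // n /h hn.
by rewrite /= -nm2 ler_sqr ?nnegrE ?nm_ge0.
Qed.

Lemma cembed_dense (x : completion) e : 0 < e ->
  exists N, forall n, (N <= n)%N -> nm (x - cembed (cval x n)) < e.
Proof.
move=> e0; have [|N h] := @cauchy_spaceP x (e / 2); first by rewrite divr_gt0.
exists N => n Nn; rewrite (@le_lt_trans _ _ (e / 2)) //; last by lra.
apply: (@nm_completion_le _ _ N) => k Nk.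
by rewrite ltW //; exact: h.
Qed.

(** Diagonal argument: the n-th term of the limit is a term of the n-th
sequence that approximates it up to 1/(n+1). *)
Lemma completion_complete : rep_complete completion.
Proof.
move=> u cu.
have /choice [k hk] (n : nat) : exists k, nm (u n - cembed (cval (u n) k)) < n.+1%:R^-1.
  have [//|N h] := @cembed_dense (u n) n.+1%:R^-1.
  by exists N; exact: h.
pose v n := cval (u n) (k n).
have nme (x y : H) : nm (cembed x - cembed y) = nm (x - y).
  have -> : cembed x - cembed y = cembed (x - y) by exact: cauchy_space_eq.
  by rewrite /nm ip_cembed.
have cv : seq_cauchy v.
  move=> e e0; have e3 : 0 < e / 3 by rewrite divr_gt0.
  have [N1 h1] := cu _ e3.
  have [N2 h2] := harmonic_lt e3.
  exists (maxn N1 N2) => m n; rewrite !geq_max => /andP[m1 m2] /andP[n1 n2].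
  rewrite -nme.
  have km : nm (cembed (v m) - u m) < e / 3.
    by rewrite nmBC; exact: lt_trans (hk m) (h2 _ m2).
  have kn : nm (u n - cembed (v n)) < e / 3.
    exact: lt_trans (hk n) (h2 _ n2).
  have -> : e = e / 3 + (e / 3 + e / 3) by field.
  apply: (le_lt_trans (nm_tri (u m) _ _)); apply: ltrD => //.
  by apply: (le_lt_trans (nm_tri (u n) _ _)); apply: ltrD => //; exact: h1.
exists (mk_cauchy cv) => e e0; have e2 : 0 < e / 2 by rewrite divr_gt0.
have [N1 h1] := harmonic_lt e2.
have [N2 h2] := @cembed_dense (mk_cauchy cv) _ e2.
exists (maxn N1 N2) => n; rewrite !geq_max => /andP[n1 n2].
apply: (le_lt_trans (nm_tri (cembed (v n)) _ _)).
have -> : e = e / 2 + e / 2 by field.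
apply: ltrD; first exact: lt_trans (hk n) (h1 _ n1).
by rewrite nmBC; exact: h2.
Qed.

End Completion.

(** * Schur products and positive definite functions *)
Section Schur.
Variables (R : realType) (G : zmodType) (H H' : isorep R G).

Lemma ip_null (x y : H) : ip x x = 0 -> ip x y = 0.
Proof.
move=> x0; apply/eqP; rewrite -sqrf_eq0 eq_le sqr_ge0 andbT.
by rewrite (le_trans (cauchy_schwarz_sqr _ _)) // x0 mul0r.
Qed.

Lemma gram_ge0 n (c : 'I_n -> R) (v : 'I_n -> H) :
  0 <= \sum_i \sum_j c i * c j * ip (v i) (v j).
Proof.
rewrite (_ : \sum_i _ = ip (\sum_i c i *: v i) (\sum_i c i *: v i)) ?ip_ge0 //.
rewrite ip_suml; apply: eq_bigr => i _; rewrite ip_sumr.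
by apply: eq_bigr => j _; rewrite ipZl ipZr; ring.
Qed.
End Schur.

(** Induction on the number k of vectors u i of nonzero norm.  Projecting all
of them orthogonally to one of them, u o, kills u o and changes the Gram matrix
of u by a matrix b i * b j of rank one; multiplied by the Gram matrix of v this
becomes again a Gram matrix. *)
Lemma schur (R : realType) (G : zmodType) (H H' : isorep R G) n (c : 'I_n -> R)
    (u : 'I_n -> H) (v : 'I_n -> H') :
  0 <= \sum_i \sum_j c i * c j * (ip (u i) (u j) * ip (v i) (v j)).
Proof.
(* Only the first k vectors may have nonzero norm. *)
suff: forall k (u : 'I_n -> H), (forall i : 'I_n, (k <= i)%N -> ip (u i) (u i) = 0) ->
    0 <= \sum_i \sum_j c i * c j * (ip (u i) (u j) * ip (v i) (v j)).
  by move/(_ n u); apply=> i; rewrite leqNgt ltn_ord.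
elim=> {u} [|k IHk] u u0.
  rewrite sumr_ge0 // => i _; rewrite sumr_ge0 // => j _.
  by rewrite ip_null ?u0 // mul0r mulr0.
have [kn|kn] := ltnP k n; last first.
  by apply: IHk => i ki; have := ltn_ord i; rewrite ltnNge (leq_trans kn ki).
pose o := Ordinal kn; have [uo|uo] := eqVneq (ip (u o) (u o)) 0.
  apply: IHk => i; rewrite leq_eqVlt => /orP[/eqP ki|]; last exact: u0.
  by have -> : i = o by apply: val_inj.
pose p := ip (u o) (u o).
pose b i := ip (u i) (u o) / p.
pose u' i := u i - b i *: u o.
have eu' i j : ip (u' i) (u' j) = ip (u i) (u j) - b i * b j * p.
  rewrite ipBl !ipBr !(ipZl, ipZr) -/p (ipC (u o)) /b; field; exact: uo.
have -> : \sum_i \sum_j c i * c j * (ip (u i) (u j) * ip (v i) (v j)) =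
   (\sum_i \sum_j c i * c j * (ip (u' i) (u' j) * ip (v i) (v j))) +
   p * (\sum_i \sum_j (c i * b i) * (c j * b j) * ip (v i) (v j)).
  rewrite mulr_sumr -big_split; apply: eq_bigr => i _ /=.
  rewrite mulr_sumr -big_split; apply: eq_bigr => j _ /=.
  by rewrite eu'; ring.
rewrite addr_ge0 //; last by rewrite mulr_ge0 ?ip_ge0 // gram_ge0.
apply: IHk => i; rewrite leq_eqVlt => /orP[/eqP ki|ki].
  have -> : i = o by apply: val_inj.
  by rewrite eu' /b divff // !mul1r subrr.
have z := u0 _ ki.
by rewrite eu' z /b ip_null // !mul0r subr0.
Qed.

Section PD.
Variables (R : realType) (G : zmodType).

Definition posdef (f : G -> R) :=
  (forall g, f (- g) = f g) /\ psd_kernel (fun g h => f (g - h)).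

Lemma gns_exists (I : choiceType) (K : I -> I -> R) (a : G -> I -> I) :
    (forall i j, K i j = K j i) -> psd_kernel K ->
    (forall g i j, K (a g i) (a g j) = K i j) ->
    (forall i, a 0 i = i) -> (forall g h i, a (g + h) i = a g (a h i)) ->
  exists (H : isorep R G) (d : I -> H), [/\ rep_complete H,
    forall i j, ip (d i) (d j) = K i j & forall g i, act g (d i) = d (a g i)].
Proof.
move=> KC Kp Ka a0 aD.
exists (completion (gns_rep KC Kp Ka a0 aD)).
exists (fun i => cembed (free_gen R i : gns_rep KC Kp Ka a0 aD)); split.
- exact: completion_complete.
- by move=> i j; rewrite ip_cembed; exact: gns_ip_gen.
- by move=> g i; rewrite act_cembed; congr cembed; exact: gns_act_gen.
Qed.

Lemma posdef_rep f : posdef f -> exists (H : isorep R G) (w : H),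
  rep_complete H /\ forall g, ip (act g w) w = f g.
Proof.
move=> [fN fp].
have [||||| H [d [cH dip dact]]] :=
    @gns_exists G (fun g h => f (g - h)) (fun g h => g + h).
- by move=> i j; rewrite -fN opprB.
- by [].
- by move=> g i j; rewrite opprD addrACA subrr add0r.
- exact: add0r.
- by move=> g h i; rewrite addrA.
by exists H, (d 0); split=> // g; rewrite dact dip addr0 subr0.
Qed.

Lemma rep_posdef (H : isorep R G) (w : H) : posdef (fun g => ip (act g w) w).
Proof.
split=> [g|n c x]; first by rewrite act_adj opprK ipC.
have := gram_ge0 c (fun i => act (x i) w).
by congr (_ <= _); apply: eq_bigr => i _; apply: eq_bigr => j _; rewrite ip_act2.
Qed.

Lemma posdefM f f' : posdef f -> posdef f' -> posdef (fun g => f g * f' g).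
Proof.
move=> pf pf'; split=> [g|n c x]; first by rewrite pf.1 pf'.1.
have [H [w [_ hw]]] := posdef_rep pf; have [H' [w' [_ hw']]] := posdef_rep pf'.
have := schur c (fun i => act (x i) w) (fun i => act (x i) w').
congr (_ <= _); apply: eq_bigr => i _; apply: eq_bigr => j _.
by rewrite !ip_act2 hw hw'.
Qed.

Lemma posdef_cst (a : R) : 0 <= a -> posdef (fun=> a).
Proof.
move=> a0; split=> // n c x.
have -> : \sum_i \sum_j c i * c j * a = a * (\sum_i c i) ^+ 2.
  rewrite expr2 mulr_suml mulr_sumr; apply: eq_bigr => i _.
  by rewrite !mulr_sumr; apply: eq_bigr => j _; ring.
by rewrite mulr_ge0 // sqr_ge0.
Qed.

Lemma posdefD f f' : posdef f -> posdef f' -> posdef (fun g => f g + f' g).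
Proof.
move=> [fN fp] [fN' fp']; split=> [g|n c x]; first by rewrite fN fN'.
have := addr_ge0 (fp n c x) (fp' n c x).
congr (_ <= _); rewrite -big_split; apply: eq_bigr => i _ /=.
by rewrite -big_split; apply: eq_bigr => j _ /=; ring.
Qed.

Lemma posdefX f k : posdef f -> posdef (fun g => f g ^+ k).
Proof.
move=> pf; elim: k => [|k IHk]; first exact: (@posdef_cst 1).
by under [X in posdef X]funext do rewrite exprS; exact: posdefM.
Qed.

(** The tensor square is the space generated by the pairs (x, y) with the
product kernel, which is positive semi-definite by Schur's theorem. *)
Lemma tensor_exists (H : isorep R G) : exists (T : isorep R G) (t : H -> H -> T),
  [/\ rep_complete T,
      forall x y x' y', ip (t x y) (t x' y') = ip x x' * ip y y' &
      forall g x y, act g (t x y) = t (act g x) (act g y)].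
Proof.
have [||||| T [d [cT dip dact]]] := @gns_exists (H * H)%type
    (fun p q => ip p.1 q.1 * ip p.2 q.2) (fun g p => (act g p.1, act g p.2)).
- by move=> i j; rewrite ipC (ipC i.2).
- by move=> n c x; exact: schur.
- by move=> g i j /=; rewrite !act_iso.
- by move=> [x y] /=; rewrite !act0.
- by move=> g h [x y] /=; rewrite !actD.
by exists T, (fun x y => d (x, y)); split=> // *; rewrite ?dip ?dact.
Qed.

End PD.

(** * Vectors of minimal norm and orthogonal projections *)
Section MinNorm.
Variables (R : realType) (G : zmodType) (H : isorep R G).
Hypothesis cH : rep_complete H.
Implicit Types (x y z v : H).

Definition adherent (C : set H) v :=
  forall e : R, 0 < e -> exists2 y, C y & nm (y - v) < e.

Lemma nm_dist x y : nm x <= nm y + nm (x - y).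
Proof. by have := nmD y (x - y); rewrite addrC subrK. Qed.

Lemma le_eps (a b : R) : (forall e, 0 < e -> a <= b + e) -> a <= b.
Proof. by move=> h; apply/ler_addgt0Pr. Qed.

Lemma adherent_ge (C : set H) d v :
  (forall y, C y -> d <= nm y) -> adherent C v -> d <= nm v.
Proof.
move=> dC aC; apply: le_eps => e /aC [y /dC dy yv].
by rewrite (le_trans dy) // (le_trans (nm_dist y v)) // lerD2l ltW.
Qed.

(** A minimizing sequence in a convex set is Cauchy by the parallelogram law.
The second clause measures how far any point of the set is from the minimizer
in terms of its excess of norm only; it makes the minimizer invariant under
every isometry that preserves the set. *)
Lemma minimal_norm (C : set H) : C !=set0 ->
  (forall x y, C x -> C y -> C ((1/2) *: x + (1/2) *: y)) ->
  exists2 v, adherent C v &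
    forall y, C y -> nm (y - v) ^+ 2 <= 2 * (nm y ^+ 2 - nm v ^+ 2).
Proof.
move=> [y0 Cy0] mC; pose D := [set nm y | y in C].
have D0 : has_inf D.
  by split; [exists (nm y0), y0|exists 0 => _ [y _ <-]; exact: nm_ge0].
pose d := inf D.
have d0 : 0 <= d by apply: (lb_le_inf D0.1) => _ [y _ <-]; exact: nm_ge0.
have dC y : C y -> d <= nm y by move=> Cy; apply: (ge_inf D0.2); exists y.
have /choice [y hy] (n : nat) : exists y, C y /\ nm y < d + n.+1%:R^-1.
  have [|_ [y Cy <-] h] := inf_adherent (eps := n.+1%:R^-1) _ D0; first by [].
  by exists y.
have Cy n := (hy n).1; have yd n := (hy n).2.
have cy : seq_cauchy y.
  move=> e e0.
  (* If both norms are below d + del, the parallelogram law bounds the squared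
   distance by 4 ((d + del)^2 - d^2) <= 4 del (2 d + 1) <= e^2. *)
pose del := Num.min 1 (e ^+ 2 / (4 * (2 * d + 2))).
  have del0 : 0 < del.
    by rewrite lt_min ltr01 divr_gt0 ?exprn_gt0 // mulr_gt0 //; lra.
  have [N hN] := harmonic_lt del0.
  exists N => m n /hN hm /hN hn.
  rewrite -ltr_sqr ?nnegrE ?nm_ge0 ?ltW // parallelogram.
  have hmid := dC _ (mC _ _ (Cy m) (Cy n)).
  have b k : k.+1%:R^-1 < del -> nm (y k) ^+ 2 < (d + del) ^+ 2.
    move=> hk; rewrite ltr_sqr ?nnegrE ?nm_ge0 ?addr_ge0 // 1?ltW //.
    by rewrite (lt_trans (yd k)) // ltrD2l.
  have h1 := b m hm; have h2 := b n hn.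
  have h3 : d ^+ 2 <= nm ((1/2) *: y m + (1/2) *: y n) ^+ 2.
    by rewrite ler_sqr ?nnegrE ?nm_ge0.
  have h4 : del <= 1 by rewrite ge_min lexx.
  have h5 : del * (4 * (2 * d + 2)) <= e ^+ 2.
    rewrite -ler_pdivlMr ?ge_min ?lexx ?orbT // mulr_gt0 //; lra.
  have h6 : del * del <= del * 1 by rewrite ler_wpM2l // ltW.
  by move: h1 h2 h3 h5; rewrite !expr2 !mulrDl !mulrDr; lra.
have [v yv] := cH cy.
have aC : adherent C v.
  by move=> e /yv [N hN]; exists (y N) => //; exact: hN.
have dv : d <= nm v by exact: adherent_ge dC aC.
have vd : nm v <= d.
  apply: le_eps => e e0; have e2 : 0 < e / 2 by rewrite divr_gt0.
  have [N1 h1] := yv _ e2; have [N2 h2] := harmonic_lt e2.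
  have k1 := h1 _ (leq_maxl N1 N2); have k2 := h2 _ (leq_maxr N1 N2).
  have k3 := nm_dist v (y (maxn N1 N2)); have k4 := yd (maxn N1 N2).
  have k5 : nm (y (maxn N1 N2)) < d + e / 2.
    by apply: (lt_trans k4); rewrite ltrD2l.
  rewrite nmBC in k3; move: k1 k3 k5; clear; lra.
have nvd : nm v = d by apply/eqP; rewrite eq_le vd dv.
exists v => // z Cz; rewrite parallelogram nvd.
suff : d ^+ 2 <= nm ((1/2) *: z + (1/2) *: v) ^+ 2 by lra.
rewrite ler_sqr ?nnegrE ?nm_ge0 //.
apply: (@adherent_ge C) => // e /aC [y' Cy' h].
exists ((1/2) *: z + (1/2) *: y'); first exact: mC.
rewrite opprD addrACA subrr add0r -scalerBr nmZ.
have := nm_ge0 (y' - v).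
rewrite ger0_norm; lra.
Qed.

Definition subspace (M : set H) :=
  M 0 /\ forall a x y, M x -> M y -> M (a *: x + y).
Definition limit_closed (M : set H) := forall v, adherent M v -> M v.

(** The difference f - c is the vector of minimal norm of the affine
subspace f - M. *)
Lemma projection (M : set H) f : subspace M -> limit_closed M ->
  exists2 c, M c & forall m, M m -> ip (f - c) m = 0.
Proof.
move=> [M0 MP] Mcl; pose C := [set f - m | m in M].
have [||w aw mw] := @minimal_norm C.
- by exists (f - 0), 0.
- move=> _ _ [x Mx <-] [y My <-]; exists ((1/2) *: x + (1/2) *: y).
    by apply: (MP) => //; rewrite -[_ *: y]addr0; exact: (MP).
  by rewrite !scalerBr addrACA -opprD -scalerDl -mulrDl -[X in X *: f]/((1 + 1) / 2) divff ?scale1r.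
exists (f - w).
  apply: Mcl => e /aw [_ [m Mm <-] h]; exists m => //.
  by rewrite nmBC addrAC.
have dC y : C y -> nm w ^+ 2 <= nm y ^+ 2.
  by move=> /mw h; rewrite -subr_ge0 -(pmulr_rge0 _ (ltr0Sn _ 1)) (le_trans _ h) ?sqr_ge0.
move=> m Mm; rewrite subKr.
have hmin t : nm w <= nm (w - t *: m).
  apply: (@adherent_ge C) => [y /dC|e /aw [_ [x Mx <-] h]].
    by rewrite ler_sqr ?nnegrE ?nm_ge0.
  exists (f - (t *: m + x)); first by exists (t *: m + x) => //; exact: (MP).
  rewrite [X in nm X](_ : _ = f - x - w) //.
  by rewrite opprB opprD !addrA [f - t *: m - x + _]addrAC subrK.
have q t : 2 * t * ip w m <= t ^+ 2 * ip m m.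
  have := hmin t; rewrite -ler_sqr ?nnegrE ?nm_ge0 // !nm2.
  rewrite ipBl !ipBr !(ipZl, ipZr) (ipC m w); lra.
apply/eqP; rewrite eq_le; apply/andP; split.
  apply: contraT; rewrite -ltNge => p.
  have := q (ip w m / (ip m m + 1)); have := ip_ge0 m => mm.
  have mm1 : 0 < ip m m + 1 by lra.
  set t := _ / _; have t0 : 0 < t by rewrite divr_gt0.
  have -> : ip w m = t * (ip m m + 1) by rewrite /t; field; lra.
  by nra.
apply: contraT; rewrite -ltNge => p.
have := q (ip w m / (ip m m + 1)); have := ip_ge0 m => mm.
have mm1 : 0 < ip m m + 1 by lra.
set t := _ / _; have t0 : 0 < - t by rewrite -mulNr divr_gt0 // oppr_gt0.
have -> : ip w m = t * (ip m m + 1) by rewrite /t; field; lra.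
by nra.
Qed.

End MinNorm.

(** * Finitely supported averages and the mean ergodic theorem *)
Section Weights.
Variables (R : realType) (T : Type).
Implicit Types (s : seq (R * T)) (F : T -> R).

(** A list of pairs (weight, point) stands for a finitely supported
probability measure; [wavg] integrates against it.  Averaging with such
measures takes the place of Folner averages in the group of values: convolving
two of them is exact, without boundary terms to estimate. *)
Definition is_weight s := all (fun p => 0 <= p.1) s /\ \sum_(p <- s) p.1 = 1.
Definition wavg s F : R := \sum_(p <- s) p.1 * F p.2.

Lemma wavg_le s F F' : is_weight s -> (forall x, F x <= F' x) -> wavg s F <= wavg s F'.
Proof.
move=> [+ _] h; rewrite /wavg; elim: s => [|p s IHs] /=; first by rewrite !big_nil.
by move=> /andP[p0 /IHs hs]; rewrite !big_cons lerD // ler_wpM2l.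
Qed.
Lemma eq_wavg s F F' : F =1 F' -> wavg s F = wavg s F'.
Proof. by move=> e; apply: eq_bigr => p _; rewrite e. Qed.
Lemma wavg_cst s a : is_weight s -> wavg s (fun=> a) = a.
Proof. by move=> [_ s1]; rewrite /wavg -mulr_suml s1 mul1r. Qed.
Lemma wavgD s F F' : wavg s (fun x => F x + F' x) = wavg s F + wavg s F'.
Proof. by rewrite /wavg -big_split; apply: eq_bigr => p _; rewrite mulrDr. Qed.
Lemma wavgZ s a F : wavg s (fun x => a * F x) = a * wavg s F.
Proof. by rewrite /wavg mulr_sumr; apply: eq_bigr => p _; rewrite mulrCA. Qed.
Lemma wavg_ge0 s F : is_weight s -> (forall x, 0 <= F x) -> 0 <= wavg s F.
Proof. by move=> ps h; rewrite -(wavg_cst 0 ps); exact: wavg_le. Qed.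
Lemma wavg_norm s F : is_weight s -> `|wavg s F| <= wavg s (fun x => `|F x|).
Proof.
move=> ps; rewrite ler_norml; apply/andP; split.
  rewrite -mulN1r -wavgZ; apply: wavg_le => // x.
  by rewrite mulN1r lerNl -normrN ler_norm.
by apply: wavg_le => // x; exact: ler_norm.
Qed.
Lemma wavg_bound s F a : is_weight s -> (forall x, F x <= a) -> wavg s F <= a.
Proof. by move=> ps h; rewrite -[leRHS](wavg_cst a ps); exact: wavg_le. Qed.
Lemma wavg_gt s F a : is_weight s -> a < wavg s F -> exists y, a < F y.
Proof.
move=> ps; apply: contraPP => /forallNP n; apply/negP; rewrite -leNgt.
by apply: wavg_bound => // x; rewrite leNgt; exact/negP.
Qed.
End Weights.

Section Weights2.
Variables (R : realType).

Lemma wavg_exchange (T T' : Type) (s : seq (R * T)) (s' : seq (R * T')) F :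
  wavg s (fun x => wavg s' (fun y => F x y)) = wavg s' (fun y => wavg s (fun x => F x y)).
Proof.
rewrite /wavg; under eq_bigr do rewrite mulr_sumr.
rewrite exchange_big; apply: eq_bigr => q _.
by rewrite mulr_sumr; apply: eq_bigr => p _; rewrite mulrCA.
Qed.

Definition wmap (T T' : Type) (f : T -> T') (s : seq (R * T)) :=
  [seq (p.1, f p.2) | p <- s].
Lemma wmap_weight (T T' : Type) (f : T -> T') s : is_weight s -> is_weight (wmap f s).
Proof. by move=> [s0 s1]; split; [rewrite all_map|rewrite big_map]. Qed.
Lemma wavg_map (T T' : Type) (f : T -> T') s F : wavg (wmap f s) F = wavg s (F \o f).
Proof. by rewrite /wavg big_map. Qed.

Definition wprod (T T' : Type) (s : seq (R * T)) (s' : seq (R * T')) :=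
  [seq (p.1 * q.1, (p.2, q.2)) | p <- s, q <- s'].
Lemma wavg_prod (T T' : Type) (s : seq (R * T)) (s' : seq (R * T')) F :
  wavg (wprod s s') F = wavg s (fun x => wavg s' (fun y => F (x, y))).
Proof.
rewrite /wavg big_allpairs_dep; apply: eq_bigr => p _.
by rewrite mulr_sumr; apply: eq_bigr => q _ /=; rewrite mulrA.
Qed.
Lemma wprod_weight (T T' : Type) (s : seq (R * T)) (s' : seq (R * T')) :
  is_weight s -> is_weight s' -> is_weight (wprod s s').
Proof.
move=> ps ps'; split; last first.
  have <- : wavg (wprod s s') (fun=> 1) = 1.
    by rewrite wavg_prod (eq_wavg _ (fun x => wavg_cst 1 ps')) wavg_cst.
  by rewrite /wavg; apply: eq_bigr => p _; rewrite mulr1.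
have := ps'.1; have := ps.1; elim: s {ps} => //= p s IH /andP[p0 /IH hs] h'.
rewrite all_cat hs // andbT all_map; apply: sub_all h' => q /= q0.
exact: mulr_ge0.
Qed.

Definition wdirac (T : Type) (x : T) : seq (R * T) := [:: (1, x)].
Lemma wdirac_weight (T : Type) (x : T) : is_weight (wdirac x).
Proof. by split; rewrite /= ?ler01 // big_seq1. Qed.
Lemma wavg_dirac (T : Type) (x : T) F : wavg (wdirac x) F = F x.
Proof. by rewrite /wavg big_seq1 mul1r. Qed.

Definition wmid (T : Type) (s s' : seq (R * T)) :=
  [seq (1 / 2 * p.1, p.2) | p <- s ++ s'].
Lemma wmid_weight (T : Type) (s s' : seq (R * T)) :
  is_weight s -> is_weight s' -> is_weight (wmid s s').
Proof.
move=> [s0 s1] [s0' s1']; split.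
  rewrite all_map all_cat; apply/andP.
  by split; [apply: sub_all s0|apply: sub_all s0'] => p /= p0; rewrite mulr_ge0.
by rewrite big_map -mulr_sumr big_cat /= s1 s1'; field.
Qed.

Definition wunif (n : nat) : seq (R * nat) := [seq (n%:R^-1, i) | i <- iota 0 n].
Lemma wunif_weight n : (0 < n)%N -> is_weight (wunif n).
Proof.
move=> n0; split; first by apply/allP => p /mapP[i _ ->] /=; rewrite invr_ge0.
rewrite big_map big_const_seq count_predT size_iota iter_addr_0.
by rewrite -[_ *+ n]mulr_natr mulVf // pnatr_eq0 -lt0n.
Qed.

End Weights2.

Section Subgroups.
Variables (G : zmodType).
Implicit Types (P : set G) (a b : G).

Definition subgroup_set P := [/\ P 0, forall a b, P a -> P b -> P (a + b) &
  forall a, P a -> P (- a)].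

Lemma subgroup_setMz P a (z : int) : subgroup_set P -> P a -> P (a *~ z).
Proof.
move=> [P0 PD PN] Pa; have Mn n : P (a *+ n).
  by elim: n => [|n IH] //; rewrite mulrS; exact: PD.
by case: z => n; rewrite ?NegzE ?mulrNz; [exact: Mn|apply: PN; exact: Mn].
Qed.
End Subgroups.

Section Averages.
Variables (R : realType) (G : zmodType) (H : isorep R G).
Implicit Types (x y z v : H) (s : seq (R * G)) (D : set G).

Definition act_avg s x : H := \sum_(p <- s) p.1 *: act p.2 x.

Lemma ip_act_avg s x y : ip (act_avg s x) y = wavg s (fun g => ip (act g x) y).
Proof. by rewrite ip_suml; apply: eq_bigr => p _; rewrite ipZl. Qed.

Lemma ip_act_avg2 s x : ip (act_avg s x) (act_avg s x) =
  wavg s (fun h => wavg s (fun h' => ip (act (h - h') x) x)).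
Proof.
rewrite ip_act_avg; apply: eq_wavg => g; rewrite ipC ip_act_avg; apply: eq_wavg => h.
by rewrite ip_act2 act_adj opprB ipC.
Qed.

Lemma act_act_avg g s x : act g (act_avg s x) = act_avg (wmap (+%R g) s) x.
Proof.
rewrite act_sum /act_avg big_map; apply: eq_bigr => p _ /=.
by rewrite act_scale actD.
Qed.

Definition weights_in s D := forall p, List.In p s -> D p.2.
(** Invariance up to vectors of norm zero, since the form may be
degenerate. *)
Definition fixed_by D v := forall g, D g -> nm (act g v - v) = 0.

Lemma fixed_by_ip D v g y : fixed_by D v -> D g -> ip (act g v) y = ip v y.
Proof.
move=> iv /iv h; apply/eqP; rewrite -subr_eq0 -ipBl ip_null //.
by rewrite -nm2 h expr0n.
Qed.

Lemma wavg_weights_in s D (F F' : G -> R) : weights_in s D -> (forall g, D g -> F g = F' g) ->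
  wavg s F = wavg s F'.
Proof.
move=> sD h; rewrite /wavg; elim: s sD => [|p s IH] sD; first by rewrite !big_nil.
rewrite !big_cons h ?IH //; first by move=> q hq; apply: sD; right.
by apply: sD; left.
Qed.

Lemma fixed_by_avg D v s y : is_weight s -> weights_in s D -> fixed_by D v ->
  ip v (act_avg s y) = ip v y.
Proof.
move=> ps sD iv; rewrite ipC ip_act_avg.
have DN g : D g -> ip (act g y) v = ip v y.
  move=> Dg; rewrite act_adj ipC.
  apply/eqP; rewrite -subr_eq0 -ipBl ip_null //.
  by rewrite -nm2 -(nm_act g) act_sub actNK -nmN opprB iv // expr0n.
by rewrite (wavg_weights_in sD DN) wavg_cst.
Qed.

(** The vector of minimal norm in the closed convex hull of the D-orbit of x
is fixed by D, because the hull is D-invariant and the minimizer is unique up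
to norm zero. *)
Lemma invariant_limit D x : rep_complete H -> subgroup_set D ->
  exists2 v, fixed_by D v &
    forall e, 0 < e -> exists s, [/\ is_weight s, weights_in s D & nm (act_avg s x - v) < e].
Proof.
move=> cH [D0 DD DN].
pose C := [set act_avg s x | s in [set s | is_weight s /\ weights_in s D]].
have [||v aC mC] := @minimal_norm _ _ _ cH C.
- exists (act_avg (wdirac R 0) x), (wdirac R 0) => //.
  by split; [exact: wdirac_weight|move=> p [<-|[]]].
- move=> _ _ [s [ps sD] <-] [s' [ps' sD'] <-]; exists (wmid s s').
    split; first exact: wmid_weight.
    move=> p; rewrite /wmid => /List.in_map_iff [q [<- /List.in_app_iff]] /=.
    by case=> hq; [exact: sD|exact: sD'].
  rewrite /act_avg /wmid big_map big_cat /= !scaler_sumr.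
  by congr (_ + _); apply: eq_bigr => p _; rewrite scalerA.
exists v; last first.
  by move=> e /aC [_ [s [ps sD] <-] h]; exists s.
move=> g Dg; apply/eqP; rewrite eq_le nm_ge0 andbT; apply: le_eps => e e0.
have Cg y : C y -> C (act g y).
  move=> [s [ps sD] <-]; exists (wmap (+%R g) s); last by rewrite act_act_avg.
  split; first exact: wmap_weight.
  by move=> p /List.in_map_iff [q [<- /sD]] /=; exact: DD.
have e4 : 0 < e ^+ 2 / 4 by rewrite divr_gt0 // exprn_gt0.
(* The excess 2 (|y|^2 - |v|^2) of a point y with | |y| - |v| | <= del <= 1 is
   at most del * K. *)
pose K := 2 * (2 * nm v + 1).
have K0 : 0 < K by rewrite mulr_gt0 // ltr_wpDl // mulr_ge0 // nm_ge0.
pose del := Num.min 1 (Num.min (e / 2) (e ^+ 2 / 4 / K)).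
have del0 : 0 < del by rewrite !lt_min ltr01 !divr_gt0 // exprn_gt0.
have [d1 d2 d3] : [/\ del <= 1, del <= e / 2 & del * K <= e ^+ 2 / 4].
  rewrite -ler_pdivlMr // /del; split; rewrite !ge_min lexx ?orbT //.
have [y Cy yv] := aC _ del0.
have h1 : nm (act g y - v) ^+ 2 <= (e / 2) ^+ 2.
  rewrite (le_trans (mC _ (Cg _ Cy))) // nm_act.
  have := nm_dist y v; have := nm_ge0 y; have := nm_ge0 v => v0 y0 hy.
  have hy' : nm y <= nm v + del by rewrite (le_trans hy) // lerD2l ltW.
  have : nm y ^+ 2 <= (nm v + del) ^+ 2.
    by rewrite ler_sqr ?nnegrE // addr_ge0 // ltW.
  move: d3; rewrite /K => d3.
  have : del * del <= del * 1 by rewrite ler_wpM2l // ltW.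
  move: d3; rewrite !expr2 !mulrDl !mulrDr; clear; clearbody del; lra.
have e2 : 0 < e / 2 by rewrite divr_gt0.
rewrite add0r (le_trans (nm_tri (act g y) _ _)) //.
have -> : e = e / 2 + e / 2 by field.
apply: lerD; last by rewrite -ler_sqr ?nnegrE ?nm_ge0 // ltW.
by rewrite -act_sub nm_act nmBC (le_trans (ltW yv)).
Qed.

(** The mean ergodic theorem, without any averaging sequence: the limit v is
the orthogonal projection of x on the D-fixed vectors, whence ip v v = ip v x. *)
Lemma ergodic D x : rep_complete H -> subgroup_set D ->
  exists v, [/\ fixed_by D v, ip v v = ip v x & forall e, 0 < e ->
    exists s, [/\ is_weight s, weights_in s D & nm (act_avg s x - v) < e]].
Proof.
move=> cH sD; have [v iv hv] := invariant_limit x cH sD; exists v; split=> //.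
apply/eqP; rewrite -subr_eq0 -normr_eq0 eq_le normr_ge0 andbT.
apply: le_eps => e e0; have v1 : 0 < nm v + 1 by rewrite ltr_wpDl // nm_ge0.
have [|s [ps ss]] := hv (e / (nm v + 1)); first by rewrite divr_gt0.
rewrite ltr_pdivlMr // => h; rewrite -(fixed_by_avg x ps ss iv) -ipBr add0r.
rewrite (le_trans (cauchy_schwarz _ _)) // mulrC nmBC (le_trans _ (ltW h)) //.
by rewrite ler_wpM2l ?nm_ge0 // lerDl.
Qed.

(** If x is orthogonal to the fixed vectors, the limit of its averages is
zero, and the double average is the squared norm of such an average. *)
Lemma ergodic_perp D x : rep_complete H -> subgroup_set D ->
  (forall v, fixed_by D v -> ip x v = 0) -> forall e, 0 < e ->
  exists s, [/\ is_weight s, weights_in s D &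
    wavg s (fun h => wavg s (fun h' => ip (act (h - h') x) x)) < e].
Proof.
move=> cH sD xv e e0; have [v [iv vx hv]] := ergodic x cH sD.
have v0 : nm v = 0 by rewrite /nm vx ipC xv // sqrtr0.
have [|s [ps ss h]] := hv (Num.sqrt e); first by rewrite sqrtr_gt0.
exists s; split=> //; rewrite -ip_act_avg2 -nm2.
have h3 : nm (act_avg s x) < Num.sqrt e.
  by apply: le_lt_trans h; rewrite (le_trans (nm_dist _ v)) // v0 add0r.
by rewrite -[ltRHS](sqr_sqrtr (ltW e0)) ltr_sqr ?nnegrE ?nm_ge0 ?sqrtr_ge0.
Qed.

End Averages.

(** * Total boundedness and weak mixing *)
Lemma mem_In (T : eqType) (x : T) (s : seq T) : x \in s -> List.In x s.
Proof.
elim: s => //= y s IH; rewrite inE => /orP[/eqP ->|/IH]; first by left.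
by right.
Qed.

Section TotallyBounded.
Variables (R : realType) (X : Type).
Implicit Types (D : set X) (d : X -> X -> R).

Definition pseudo_dist d := (forall x y, d x y = d y x) /\
  (forall x y z, d x z <= d x y + d y z).
(** The net is required inside D, so that distances between a point of D and
the net only involve points of D. *)
Definition totally_bdd D d := forall e : R, 0 < e -> exists r : seq X,
  (forall x, List.In x r -> D x) /\
  forall x, D x -> exists2 y, List.In y r & d x y < e.

(** A point is chosen in each nonempty member of the cover. *)
Lemma totally_bdd_cover D d (I : Type) (l : seq I) (C : I -> set X) (e : R) :
  (forall x, D x -> exists2 i, List.In i l & C i x) ->
  (forall i x y, D x -> D y -> C i x -> C i y -> d x y < e) ->
  exists r : seq X, (forall x, List.In x r -> D x) /\
    forall x, D x -> exists2 y, List.In y r & d x y < e.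
Proof.
move=> cov small.
have [r [rD rl]] : exists r : seq X, (forall x, List.In x r -> D x) /\
   forall i, List.In i l -> forall x, D x -> C i x -> exists2 y, List.In y r & C i y.
  elim: l {cov} => [|i l [r [rD rl]]]; first by exists [::].
  have [[x0 [Dx0 Cx0]]|no] := pselect (exists x, D x /\ C i x).
    exists (x0 :: r); split=> [x [<-//|/rD//]|j [<-|jl] x Dx Cx].
      by exists x0 => //; left.
    by have [y yr Cy] := rl j jl x Dx Cx; exists y => //; right.
  exists r; split=> // j [<-|jl] x Dx Cx; first by case: no; exists x.
  exact: rl Cx.
exists r; split=> // x Dx; have [i il Ci] := cov x Dx.
have [y yr Cy] := rl i il x Dx Ci; exists y => //.
by apply: small Ci Cy => //; exact: rD.
Qed.

Lemma totally_bdd_le D d d' : (forall x y, d x y <= d' x y) -> totally_bdd D d' -> totally_bdd D d.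
Proof.
move=> le h e /h [r [rD rh]]; exists r; split=> // x /rh [y yr hy].
by exists y => //; exact: le_lt_trans hy.
Qed.

Lemma totally_bdd_approx D d : (forall del, 0 < del -> exists2 d', totally_bdd D d' &
  forall x y, D x -> D y -> d x y <= d' x y + del) -> totally_bdd D d.
Proof.
move=> h e e0; have e2 : 0 < e / 2 by rewrite divr_gt0.
have [d' td le] := h _ e2; have [r [rD rh]] := td _ e2.
exists r; split=> // x Dx; have [y yr hy] := rh x Dx; exists y => //.
by rewrite (le_lt_trans (le _ _ Dx (rD _ yr))) //; lra.
Qed.

Lemma totally_bdd0 D : totally_bdd D (fun _ _ => 0).
Proof.
move=> e e0; apply: (@totally_bdd_cover _ _ unit [:: tt] (fun _ => setT)) => //.
by move=> x _; exists tt => //; left.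
Qed.

Lemma totally_bdd_add D d d' : pseudo_dist d -> pseudo_dist d' -> totally_bdd D d -> totally_bdd D d' ->
  totally_bdd D (fun x y => d x y + d' x y).
Proof.
move=> [dC dt] [dC' dt'] h h' e e0.
have e4 : 0 < e / 4 by rewrite divr_gt0.
have [r [_ rh]] := h _ e4; have [r' [_ rh']] := h' _ e4.
apply: (@totally_bdd_cover _ _ _ (List.list_prod r r')
   (fun p => [set x | d x p.1 < e / 4 /\ d' x p.2 < e / 4])) => [x Dx|].
  have [y yr hy] := rh x Dx; have [y' yr' hy'] := rh' x Dx.
  by exists (y, y') => //; exact: List.in_prod.
move=> [i i'] x y _ _ /= [h1 h2] [h3 h4].
have := dt x i y; have := dt' x i' y; rewrite (dC i) (dC' i'); lra.
Qed.

Lemma totally_bdd_scale D d (a : R) : 0 <= a -> totally_bdd D d -> totally_bdd D (fun x y => a * d x y).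
Proof.
move=> a0 h e e0; have a1 : 0 < a + 1 by lra.
have [|r [rD rh]] := h (e / (a + 1)); first by rewrite divr_gt0.
exists r; split=> // x /rh [y yr]; rewrite ltr_pdivlMr // => hy.
exists y => //; have [d0|d0] := leP 0 (d x y).
  by rewrite (le_lt_trans _ hy) // mulrC ler_wpM2l // lerDl.
by rewrite (le_lt_trans _ e0) // mulr_ge0_le0 // ltW.
Qed.

Lemma totally_bdd_fun D (c : X -> R) M : (forall x, D x -> `|c x| <= M) ->
  totally_bdd D (fun x y => `|c x - c y|).
Proof.
move=> cM e e0.
pose N := (Num.trunc (2 * M / e)).+1.
apply: (@totally_bdd_cover _ _ _ (iota 0 N)
   (fun k => [set x | Num.trunc ((c x + M) / e) = k])) => [x Dx|].
  exists (Num.trunc ((c x + M) / e)) => //; apply: mem_In; rewrite mem_iota /= add0n /N ltnS.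
  have := cM x Dx; rewrite ler_norml => /andP[_ h].
  by apply: le_truncn; rewrite ler_pM2r ?invr_gt0 //; lra.
move=> k x y Dx Dy /= kx ky.
have pos z : D z -> 0 <= (c z + M) / e.
  move=> /cM; rewrite ler_norml => /andP[h _].
  by rewrite divr_ge0 ?(ltW e0) //; lra.
have := truncn_itv (pos x Dx); have := truncn_itv (pos y Dy).
rewrite kx ky !ler_pdivlMr // !ltr_pdivrMr // => /andP[h1 h2] /andP[h3 h4].
move: h1 h2 h3 h4; rewrite -natr1 mulrDl mul1r ltr_norml; lra.
Qed.

(** Total boundedness in the form used by the pigeonhole principle. *)
Lemma totally_bdd_color d (e : R) (x0 : X) :
  pseudo_dist d -> totally_bdd setT d -> 0 < e ->
  exists N (idx : X -> 'I_N.+1), forall x y, idx x = idx y -> d x y < e.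
Proof.
move=> [s t] td e0; have [|r [_ rh]] := td (e / 2); first by rewrite divr_gt0.
exists (size r).
have /choice [i hi] : forall x, exists i : 'I_(size r).+1, d x (nth x0 r i) < e / 2.
  move=> h; have [y yr hy] := rh h I.
  have [j [jr yj]] : exists j, (j < size r)%N /\ y = nth x0 r j.
    elim: r yr {rh} => //= a r IH [->|/IH [j [jr ->]]]; first by exists 0%N.
    by exists j.+1.
  by exists (inord j); rewrite inordK -?yj // ltnS ltnW.
exists i => h h' e'.
have := t h (nth x0 r (i h)) h'; have := hi h; have := hi h'.
by rewrite -e' (s h'); lra.
Qed.

End TotallyBounded.

Section Compact.
Variables (R : realType) (G : zmodType) (H : isorep R G).
Hypothesis cH : rep_complete H.
Implicit Types (x y : H) (g h : G) (D : set G).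

Definition orbit_dist x g h := nm (act g x - act h x).
Lemma orbit_dist_pseudo x : pseudo_dist (orbit_dist x).
Proof.
by rewrite /orbit_dist; split=> [g h|g h k]; [rewrite nmBC|apply: nm_tri].
Qed.
Lemma orbit_distE x g h : orbit_dist x g h = nm (act (g - h) x - x).
Proof. by rewrite /orbit_dist -(nm_act (- h)) act_sub actK -actD [- h + g]addrC. Qed.

(** The vectors with relatively compact orbit; they span the discrete part of
the spectrum. *)
Definition compact_vec : set H := [set x | totally_bdd setT (orbit_dist x)].

Lemma compact_vec_subspace : subspace compact_vec.
Proof.
split.
  apply: totally_bdd_le (@totally_bdd0 _ _ _) => g h.
  by rewrite /orbit_dist !act_0 subrr nm0.
move=> a x y cx cy; apply: (@totally_bdd_le _ _ _ _ (fun g h => `|a| * orbit_dist x g h + orbit_dist y g h)).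
  move=> g h; rewrite /orbit_dist !actP opprD addrACA -scalerBr.
  by rewrite (le_trans (nmD _ _)) // nmZ.
apply: totally_bdd_add => //; [|exact: orbit_dist_pseudo|exact: totally_bdd_scale].
have [s t] := orbit_dist_pseudo x; split=> [g h|g h k]; first by rewrite s.
by rewrite -mulrDr ler_wpM2l.
Qed.

Lemma compact_vec_closed : limit_closed compact_vec.
Proof.
move=> v adh; apply: totally_bdd_approx => del d0.
have [|y cy yv] := adh (del / 2); first by rewrite divr_gt0.
exists (orbit_dist y) => // g h _ _.
have := nm_tri (act g y) (act g v) (act h v).
have := nm_tri (act h y) (act g y) (act h v).
rewrite -!act_sub !nm_act (nmBC v) -!/(orbit_dist _ _ _).
by rewrite /orbit_dist; lra.
Qed.

Variable (w : H).
Hypothesis wc : forall c, compact_vec c -> ip w c = 0.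

(** Let v be the D-fixed part of W = t w w in the tensor square, a limit of
averages of t (U^g w) (U^g w).  A tensor acts as an
operator on the first factor: let c be the image of w under v, defined by
ip c y = ip v (t w y).  Since v is D-fixed, the D-orbit of c is the image of
the D-orbit of w under v; as v is a limit of operators of finite rank in the
Hilbert-Schmidt norm, this image is totally bounded under D, hence under the
whole group because D has finite index.  Therefore w is orthogonal to c, that
is 0 = ip v W = ip v v, and the averages of W tend to 0. *)
Lemma weak_mixing D : subgroup_set D ->
  (exists r : seq G, forall g, exists2 h, List.In h r & D (g - h)) ->
  forall e, 0 < e -> exists s, [/\ is_weight s, weights_in s D &
   wavg s (fun h => wavg s (fun h' => ip (act (h - h') w) w ^+ 2)) < e].
Proof.
move=> sD [r0 fD] e e0.
have [T [t [cT ipt actt]]] := tensor_exists H.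
have [v [iv vW hv]] := ergodic (t w w) cT sD.
have nmt x y : nm (t x y) = nm x * nm y.
  by rewrite /nm ipt sqrtrM ?ip_ge0.
(* The operator of finite rank attached to the tensor act_avg s (t w w). *)
pose A (s : seq (R * G)) x : H := \sum_(p <- s) (p.1 * ip (act p.2 w) x) *: act p.2 w.
have ipA s x y : ip (A s x) y = ip (act_avg s (t w w)) (t x y).
  rewrite ip_suml ip_act_avg; apply: eq_bigr => p _.
  by rewrite ipZl actt ipt; ring.
(* Applied with z a difference of images, this bounds the operator norm by the
   Hilbert-Schmidt norm, the norm of the tensor square. *)
have nm_le (z : H) a : 0 <= a -> nm z ^+ 2 <= a * nm z -> nm z <= a.
  move=> a0 h; have := nm_ge0 z; rewrite le_eqVlt => /orP[/eqP <- //|z0].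
  by rewrite -(ler_pM2r z0) -expr2.
have nmA s s' x : nm (A s x - A s' x) <= nm (act_avg s (t w w) - act_avg s' (t w w)) * nm x.
  apply: nm_le; first by rewrite mulr_ge0 ?nm_ge0.
  rewrite nm2 ipBl !ipA -ipBl (le_trans (cauchy_schwarz_le _ _)) //.
  by rewrite nmt mulrA.
have /choice [s hs] (n : nat) : exists s, [/\ is_weight s, weights_in s D &
  nm (act_avg s (t w w) - v) < n.+1%:R^-1] by apply: hv; rewrite invr_gt0.
have sv e' : 0 < e' -> exists N, forall n, (N <= n)%N -> nm (act_avg (s n) (t w w) - v) < e'.
  move=> /harmonic_lt [N hN]; exists N => n /hN; apply: lt_trans.
  by have [] := hs n.
have w1 : 0 < nm w + 1 by rewrite ltr_wpDl // nm_ge0.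
have cA : seq_cauchy (fun n => A (s n) w).
  move=> e' e0'; have [|N hN] := sv (e' / 2 / (nm w + 1)).
    by rewrite !divr_gt0.
  exists N => m n mN nN; rewrite (le_lt_trans (nmA _ _ _)) //.
  have h : nm (act_avg (s m) (t w w) - act_avg (s n) (t w w)) < e' / (nm w + 1).
    rewrite (le_lt_trans (nm_tri v _ _)) // (nmBC v).
    have -> : e' / (nm w + 1) = e' / 2 / (nm w + 1) + e' / 2 / (nm w + 1).
      by field; rewrite gt_eqF.
    by rewrite ltrD ?hN.
  rewrite ltr_pdivlMr // in h; apply: le_lt_trans h.
  by rewrite ler_wpM2l ?nm_ge0 // lerDl.
have [c cc] := cH cA.
have ipc y : ip c y = ip v (t w y).
  have h1 := @seq_cvg_ip _ _ _ _ _ y cc.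
  have h2 : (fun n => ip (A (s n) w) y) @ \oo --> ip v (t w y).
    under eq_fun do rewrite ipA; apply: seq_cvg_ip => e' /sv [N hN].
    by exists N.
  exact: (cvg_unique _ h1 h2).
have ip_actc g y : D g -> ip (act g c) y = ip v (t (act g w) y).
  move=> Dg; rewrite act_adj ipc -[in RHS](fixed_by_ip _ iv Dg).
  by rewrite [in RHS]act_adj actt actK.
have nm_actc n g : D g ->
    nm (act g c - A (s n) (act g w)) <= nm (act_avg (s n) (t w w) - v) * nm w.
  move=> Dg; apply: nm_le; first by rewrite mulr_ge0 ?nm_ge0.
  rewrite nm2 ipBl ip_actc // ipA -ipBl (le_trans (cauchy_schwarz_le _ _)) //.
  by rewrite nmt nm_act mulrA nmBC.
have AB (s' : seq (R * G)) x y : A s' x - A s' y =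
    \sum_(p <- s') (p.1 * (ip (act p.2 w) x - ip (act p.2 w) y)) *: act p.2 w.
  rewrite /A -sumrB; apply: eq_bigr => p _.
  by rewrite -scalerBl -mulrBr.
(* The value A (s n) x depends only on finitely many bounded scalars ip _ x. *)
have tbA n : totally_bdd D (fun g h => nm (A (s n) (act g w) - A (s n) (act h w))).
  pose d0 p g h := p.1 * nm w * `|ip (act p.2 w) (act g w) - ip (act p.2 w) (act h w)|.
  have [ps _ _] := hs n.
  suff: pseudo_dist (fun g h => \sum_(p <- s n) d0 p g h) /\
        totally_bdd D (fun g h => \sum_(p <- s n) d0 p g h).
    move=> [_]; apply: totally_bdd_le => g h; rewrite AB (le_trans (nm_sum _ _)) //.
    have := ps.1; elim: (s n) => [|p l IH] /=; first by rewrite !big_nil.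
    move=> /andP[p0 /IH h']; rewrite !big_cons lerD // nmZ nm_act normrM.
    by rewrite /d0 (ger0_norm p0) mulrAC.
  have := ps.1; elim: (s n) => [|p l IH] /=.
    move=> _; split; last by apply: totally_bdd_le (@totally_bdd0 _ _ _) => g h; rewrite big_nil.
    by split=> *; rewrite !big_nil ?addr0.
  move=> /andP[p0 /IH [pl tl]].
  have pw : 0 <= p.1 * nm w by rewrite mulr_ge0 // nm_ge0.
  have pd : pseudo_dist (d0 p).
    split=> [g h|g h k]; rewrite /d0; first by rewrite distrC.
    by rewrite -mulrDr ler_wpM2l // ler_distD.
  have td : totally_bdd D (d0 p).
    apply: totally_bdd_scale => //; apply: (@totally_bdd_fun _ _ _ _ (nm w * nm w)) => g _.
    by rewrite (le_trans (cauchy_schwarz _ _)) // !nm_act.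
  split; last first.
    by apply: totally_bdd_le (totally_bdd_add pd pl td tl) => g h; rewrite big_cons.
  have [s1 t1] := pd; have [s2 t2] := pl.
  split=> [g h|g h k]; rewrite !big_cons; first by rewrite s1 s2.
  by rewrite addrACA lerD.
have tbD : totally_bdd D (orbit_dist c).
  apply: totally_bdd_approx => del d0.
  have [|N hN] := sv (del / 2 / (nm w + 1)); first by rewrite !divr_gt0.
  exists (fun g h => nm (A (s N) (act g w) - A (s N) (act h w))); first exact: tbA.
  move=> g h Dg Dh.
  have b k : D k -> nm (act k c - A (s N) (act k w)) <= del / 2.
    move=> Dk; rewrite (le_trans (nm_actc N k Dk)) //.
    have := hN N (leqnn _); rewrite ltr_pdivlMr // => /ltW; apply: le_trans.
    by rewrite ler_wpM2l ?nm_ge0 // lerDl.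
  have := nm_tri (A (s N) (act g w)) (act g c) (act h c).
  have := nm_tri (A (s N) (act h w)) (A (s N) (act g w)) (act h c).
  have := b g Dg; have := b h Dh; rewrite nmBC /orbit_dist; lra.
have cpt : compact_vec c.
  move=> e' e0'; have [r [rD rh]] := tbD _ e0'.
  exists (List.map (fun p => p.1 + p.2) (List.list_prod r0 r)); split=> // g _.
  have [h0 h0r Dh0] := fD g; have [h hr hh] := rh _ Dh0.
  exists (h0 + h).
    by apply/List.in_map_iff; exists (h0, h); split=> //; exact: List.in_prod.
  by move: hh; rewrite !orbit_distE opprD addrA.
have v0 : ip v v = 0 by rewrite vW -ipc ipC wc.
have [|s' [ps sDn h]] := hv (Num.sqrt e); first by rewrite sqrtr_gt0.
exists s'; split=> //.
have <- : nm (act_avg s' (t w w)) ^+ 2 =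
  wavg s' (fun h => wavg s' (fun h' => ip (act (h - h') w) w ^+ 2)).
  rewrite nm2 ip_act_avg2; apply: eq_wavg => g; apply: eq_wavg => k.
  by rewrite actt ipt.
have h3 : nm (act_avg s' (t w w)) < Num.sqrt e.
  by apply: le_lt_trans h; rewrite (le_trans (nm_dist _ v)) // /nm v0 sqrtr0 add0r.
by rewrite -[ltRHS](sqr_sqrtr (ltW e0)) ltr_sqr ?nnegrE ?nm_ge0 ?sqrtr_ge0.
Qed.

End Compact.

(** * Weyl differencing *)
Lemma coef_XaddCX (A : comNzRingType) (h : A) i j :
  (('X + h%:P) ^+ i)`_j = h ^+ (i - j) *+ 'C(i, j).
Proof.
rewrite exprDn coef_sum.
under eq_bigr => k _ do rewrite coefMn -rmorphXn /= coefMC coefXn.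
have [ji|ij] := leqP j i; last first.
  rewrite bin_small // mulr0n big1 // => k _.
  by rewrite gtn_eqF ?mul0r ?mul0rn // (leq_ltn_trans (leq_subr _ _)).
have kP : (i - j < i.+1)%N by rewrite ltnS leq_subr.
rewrite (bigD1 (Ordinal kP)) //= subKn // eqxx mul1r bin_sub //.
rewrite big1 ?addr0 // => k kn.
rewrite (_ : (j == i - k)%N = false) ?mul0r ?mul0rn //.
apply: contra_neqF kn => /eqP e; apply: val_inj => /=.
by rewrite e subKn // -ltnS ltn_ord.
Qed.

Lemma coef_shift (A : comNzRingType) (q : {poly A}) (h : A) j :
  (q \Po ('X + h%:P))`_j = \sum_(i < size q) q`_i * (h ^+ (i - j) *+ 'C(i, j)).
Proof.
rewrite comp_polyE coef_sum; apply: eq_bigr => i _.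
by rewrite coefZ coef_XaddCX.
Qed.

Lemma coef_shift_le (A : comNzRingType) (q : {poly A}) (h : A) n j :
  (size q <= n)%N ->
  (q \Po ('X + h%:P))`_j = \sum_(i < n) q`_i * (h ^+ (i - j) *+ 'C(i, j)).
Proof.
move=> qn; rewrite coef_shift (big_ord_widen n (fun i => q`_i * (h ^+ (i - j) *+ 'C(i, j)))) //.
rewrite [RHS](bigID (fun i : 'I_n => (i < size q)%N)) /=.
by rewrite [X in _ = _ + X]big1 ?addr0 // => i; rewrite -leqNgt => iq; rewrite nth_default ?mul0r.
Qed.

Lemma shift_size_lead (A : comNzRingType) (q : {poly A}) (h : A) n :
  (size q <= n.+1)%N ->
  (size (q \Po ('X + h%:P)) <= n.+1)%N /\ (q \Po ('X + h%:P))`_n = q`_n.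
Proof.
move=> qn; split.
  apply/leq_sizeP => j nj; rewrite (coef_shift_le _ _ qn) big1 // => i _.
  by rewrite bin_small ?mulr0n ?mulr0 // (leq_trans (ltn_ord i)).
rewrite (coef_shift_le _ _ qn) big_ord_recr /= subnn expr0 binn mulr1.
rewrite big1 ?add0r // => i _.
by rewrite bin_small ?mulr0n ?mulr0.
Qed.

(** Differencing lowers the degree, and the new leading coefficient depends
only on the leading coefficient and on h - h'. *)
Lemma shift_diff (A : comNzRingType) (q : {poly A}) (h h' : A) n :
  (size q <= n.+2)%N ->
  let d := (q \Po ('X + h%:P)) - (q \Po ('X + h'%:P)) in
  (size d <= n.+1)%N /\ d`_n = q`_n.+1 * (n.+1)%:R * (h - h').
Proof.
move=> qn /=; split.
  apply/leq_sizeP => j; rewrite leq_eqVlt. rewrite coefB => /orP[/eqP <-|nj].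
    by rewrite !(shift_size_lead _ qn).2 subrr.
  by rewrite !nth_default ?subrr // (leq_trans (shift_size_lead _ qn).1).
rewrite coefB !(coef_shift_le _ _ qn) !big_ord_recr /= subnn subSnn binn binSn.
rewrite !expr0 !expr1 !big1 => [|i _|i _]; first last.
- by rewrite bin_small ?mulr0n ?mulr0.
- by rewrite bin_small ?mulr0n ?mulr0.
by rewrite !add0r opprD addrACA subrr add0r -mulrBr -mulrnBl -mulrA mulr_natl.
Qed.

Section Weyl.
Variables (R : realType) (A : comNzRingType).
Hypothesis dom : forall a b : A, a * b = 0 -> a = 0 \/ b = 0.
Hypothesis char0 : forall n, n.+1%:R != 0 :> A.
Variables (H : isorep R A) (w : H).
Let kap (g : A) : R := ip (act g w) w.

(** For f(g) = <U^g w, w> this says that w has no component fixed by a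
nonzero ideal c A: the double average is the squared norm of an average of w
along the ideal. *)
Definition zero_mean (f : A -> R) := forall (c : A) (e : R), c != 0 -> 0 < e ->
  exists s : seq (R * A), is_weight s /\
    wavg s (fun h => wavg s (fun h' => f (c * h - c * h'))) < e.
Hypothesis zm : zero_mean kap.

(** The average on the left is <V, w> for V the average of the U^(y t) w, and
the double average is the squared norm of V. *)
Lemma van_der_corput (T : Type) (s : seq (R * T)) (y : T -> A) :
  wavg s (fun t => kap (y t)) ^+ 2 <=
  ip w w * wavg s (fun h => wavg s (fun h' => kap (y h - y h'))).
Proof.
have -> : wavg s (fun t => kap (y t)) = ip (act_avg (wmap y s) w) w.
  by rewrite ip_act_avg wavg_map.
rewrite (le_trans (cauchy_schwarz_sqr _ _)) // mulrC; apply: ler_wpM2l; first exact: ip_ge0.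
by rewrite ip_act_avg2 wavg_map le_eqVlt; apply/orP; left; apply/eqP; apply: eq_wavg => g; rewrite /= wavg_map.
Qed.

Lemma kap_bound g : `|kap g| <= ip w w.
Proof. by rewrite (le_trans (cauchy_schwarz _ _)) // nm_act -expr2 nm2. Qed.

(** One weight S for all polynomials with leading term a X^(D+1), whatever
the lower terms.  This uniformity makes the property stable under translation
of the variable, hence under convolution of S with any weight. *)
Definition weyl_small D (a : A) (e : R) (S : seq (R * A)) := forall q : {poly A},
  (size q <= D.+2)%N -> q`_D.+1 = a -> `|wavg S (fun t => kap q.[t])| <= e.

Definition wconv (S S' : seq (R * A)) := wmap (fun p => p.1 + p.2) (wprod S S').
Lemma wconv_weight S S' : is_weight S -> is_weight S' -> is_weight (wconv S S').
Proof. by move=> pS pS'; apply/wmap_weight/wprod_weight. Qed.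
Lemma wavg_conv S S' F : wavg (wconv S S') F = wavg S (fun t => wavg S' (fun u => F (t + u))).
Proof. by rewrite wavg_map wavg_prod. Qed.

Lemma weyl_small_conv D a e S S' : is_weight S' -> weyl_small D a e S -> weyl_small D a e (wconv S S').
Proof.
move=> pS' gS q qD qa; rewrite wavg_conv wavg_exchange.
rewrite (le_trans (wavg_norm _ pS')) //; apply: wavg_bound => // u.
have [h1 h2] := shift_size_lead u qD.
have := gS (q \Po ('X + u%:P)) h1; rewrite h2 => /(_ qa).
congr (`|_| <= _); apply: eq_wavg => t.
by rewrite horner_comp !hornerE.
Qed.
Lemma wavg_convC S S' F : wavg (wconv S S') F = wavg (wconv S' S) F.
Proof.
rewrite !wavg_conv wavg_exchange; apply: eq_wavg => t; apply: eq_wavg => u.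
by rewrite addrC.
Qed.

(** Convolving weights that serve the single coefficients gives one that
serves all of them. *)
Lemma weyl_small_all D e (l : seq A) :
  (forall a, a \in l -> exists2 S, is_weight S & weyl_small D a e S) ->
  exists2 S, is_weight S & forall a, a \in l -> weyl_small D a e S.
Proof.
elim: l => [_|a l IH h]; first by exists (wdirac R 0) => //; exact: wdirac_weight.
have [|S pS hS] := IH; first by move=> b bl; apply: h; rewrite inE bl orbT.
have [S' pS' hS'] := h a (mem_head _ _).
exists (wconv S S'); first exact: wconv_weight.
move=> b; rewrite inE => /orP[/eqP ->|/hS gb]; last exact: weyl_small_conv.
by move=> q qD qa; rewrite wavg_convC; exact: (weyl_small_conv pS hS').
Qed.

Lemma natr_inj_char0 i j : i%:R = j%:R :> A -> i = j.
Proof.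
wlog ij : i j / (i <= j)%N.
  move=> h e; have [/h|/ltnW /h ->//] := leqP i j; first exact.
move=> e; apply/eqP; rewrite eqn_leq ij /= leqNgt; apply/negP => ltij.
have := char0 (j - i).-1; rewrite prednK ?subn_gt0 // natrB // e subrr.
by rewrite eqxx.
Qed.

Lemma wavg_sqr (T : Type) (s : seq (R * T)) F : is_weight s ->
  wavg s F ^+ 2 <= wavg s (fun x => F x ^+ 2).
Proof.
move=> ps; set m := wavg s F.
have : 0 <= wavg s (fun x => (F x - m) ^+ 2) by apply: wavg_ge0 => // x; exact: sqr_ge0.
have -> : wavg s (fun x => (F x - m) ^+ 2) =
  wavg s (fun x => F x ^+ 2) + - 2 * m * wavg s F + m ^+ 2.
  rewrite -wavgZ -wavgD -[X in _ + X](wavg_cst (m ^+ 2) ps) -wavgD.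
  by apply: eq_wavg => x; ring.
by rewrite -/m; lra.
Qed.

Lemma wavg_unif_diag n (K e : R) (F : nat -> nat -> R) : (0 < n)%N -> 0 <= e ->
  (forall i, F i i <= K) ->
  (forall i j, (i < n)%N -> (j < n)%N -> i != j -> F i j <= e) ->
  wavg (wunif R n) (fun i => wavg (wunif R n) (fun j => F i j)) <= K / n%:R + e.
Proof.
move=> n0 e0 FK Fe.
have le G G' : (forall i, (i < n)%N -> G i <= G' i) ->
    wavg (wunif R n) G <= wavg (wunif R n) G'.
  move=> h; rewrite /wavg !big_map !big_seq; apply: ler_sum => i.
  by rewrite mem_iota /= => /h hi; rewrite ler_wpM2l ?invr_ge0.
have pn := wunif_weight R n0.
rewrite -[leRHS](wavg_cst (K / n%:R + e) pn); apply: (le) => i iN.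
have -> : K / n%:R + e = wavg (wunif R n) (fun j => K * (i == j)%:R + e).
  rewrite wavgD (wavg_cst _ pn) wavgZ; congr (_ * _ + _).
  rewrite /wavg big_map (bigD1_seq i) ?iota_uniq ?mem_iota //=.
  by rewrite eqxx mulr1 big1 ?addr0 // => j ji; rewrite eq_sym (negbTE ji) mulr0.
apply: (le) => j jn; have [<-|ij] := eqVneq i j.
  by rewrite mulr1 (le_trans (FK i)) // lerDl.
by rewrite mulr0 add0r Fe.
Qed.

(** Induction on the degree.  For degree one, differencing leaves the constant
a (h - h') and zero_mean applies.  Otherwise convolve a weight S, given by the
induction hypothesis for the finitely many leading coefficients of the
differences q(t + i) - q(t + j) with i, j < n distinct, with the uniform weight
on 0, ..., n - 1: van der Corput's inequality bounds the square of the average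
by the averages of these differences plus a diagonal term of order 1/n. *)
Lemma weyl D a e : a != 0 -> 0 < e -> exists2 S, is_weight S & weyl_small D a e S.
Proof.
elim: D a e => [|D IH] a e a0 e0.
  set K := ip w w; have K0 : 0 <= K by exact: ip_ge0.
  have [|s [ps hs]] := zm (e := e ^+ 2 / (K + 1)) a0.
    by rewrite divr_gt0 ?exprn_gt0 // ltr_wpDl.
  exists s => // q q2 qa.
  rewrite -ler_sqr ?nnegrE ?(ltW e0) // real_normK ?num_real //.
  rewrite (le_trans (van_der_corput _ _)) //.
  have -> : wavg s (fun h => wavg s (fun h' => kap (q.[h] - q.[h']))) =
     wavg s (fun h => wavg s (fun h' => kap (a * h - a * h'))).
    apply: eq_wavg => h; apply: eq_wavg => h'; congr kap.
    have ev t : q.[t] = q`_0 + a * t.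
      by rewrite (horner_coef_wide _ q2) !big_ord_recl big_ord0 /= qa; ring.
    by rewrite !ev; ring.
  rewrite -/K; move/ltW: hs; rewrite ler_pdivlMr ?ltr_wpDl //.
  set E := wavg _ _ => hs; have [E0|E0] := leP 0 E.
    by rewrite (le_trans _ hs) // mulrDr mulr1 mulrC lerDl.
  by rewrite (le_trans _ (sqr_ge0 e)) // mulr_ge0_le0 // ltW.
set K := ip w w; have K0 : 0 <= K by exact: ip_ge0.
have K1 : 0 < K + 1 by lra.
pose d := e ^+ 2 / 2 / (K + 1).
have d0 : 0 < d by rewrite !divr_gt0 // exprn_gt0.
have [N hN] := harmonic_lt (divr_gt0 d0 K1).
pose n := N.+1.
(* The leading coefficient of q(t + i) - q(t + j). *)
pose b (i j : nat) : A := a * D.+2%:R * (i%:R - j%:R).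
pose l := [seq b p.1 p.2 | p <- [seq (i, j) | i <- iota 0 n, j <- iota 0 n] & p.1 != p.2].
have [|S pS hS] := @weyl_small_all D d l.
  move=> b0 /mapP[[i j]]; rewrite mem_filter /= => /andP[ij _] ->.
  apply: IH => //; apply/eqP => /dom [/dom [h|h]|/eqP].
  - by move: a0; rewrite h eqxx.
  - by have := char0 D.+1; rewrite h eqxx.
  - by rewrite subr_eq0 => /eqP /natr_inj_char0 h; move: ij; rewrite h eqxx.
pose U := wmap (fun i : nat => i%:R : A) (wunif R n).
have pU : is_weight U by apply: wmap_weight; exact: wunif_weight.
exists (wconv S U) => [|q qD qa]; first exact: wconv_weight.
rewrite -ler_sqr ?nnegrE ?(ltW e0) // real_normK ?num_real //.
rewrite wavg_conv (le_trans (wavg_sqr _ pS)) //.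
have h1 : wavg S (fun t => wavg U (fun u => kap q.[t + u]) ^+ 2) <=
   wavg S (fun t => K * wavg U (fun h => wavg U (fun h' => kap (q.[t + h] - q.[t + h'])))).
  by apply: wavg_le => // t; exact: van_der_corput.
rewrite (le_trans h1) // wavgZ wavg_exchange.
have -> : wavg U (fun h => wavg S (fun t => wavg U (fun h' => kap (q.[t + h] - q.[t + h'])))) =
   wavg (wunif R n) (fun i => wavg (wunif R n) (fun j =>
     wavg S (fun t => kap (q.[t + i%:R] - q.[t + j%:R])))).
  rewrite wavg_map; apply: eq_wavg => i /=.
  by rewrite wavg_exchange wavg_map.
have h2 : wavg (wunif R n) (fun i => wavg (wunif R n) (fun j =>
     wavg S (fun t => kap (q.[t + i%:R] - q.[t + j%:R])))) <= K / n%:R + d.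
  apply: wavg_unif_diag => // [|i|i j iN jN ij]; first exact: ltW.
    by apply: wavg_bound => // t; rewrite (le_trans (ler_norm _)) // kap_bound.
  rewrite (le_trans (ler_norm _)) //.
  have [h3 h4] := shift_diff i%:R j%:R qD.
  have bl : b i j \in l.
    apply/mapP; exists (i, j) => //; rewrite mem_filter [_.1 != _]ij andTb.
    by apply/allpairsPdep; exists i, j; rewrite !mem_iota.
  have := hS _ bl _ h3; rewrite h4 qa => /(_ erefl).
  congr (`|_| <= _); apply: eq_wavg => t.
  by rewrite hornerD hornerN !horner_comp !hornerE.
have h5 : K / n%:R <= d.
  have := hN N (leqnn _) => /ltW; rewrite -/n ler_pdivlMr // mulrC => h.
  by rewrite (le_trans _ h) // ler_wpM2r ?invr_ge0 // lerDl.
have h6 : K * (K / n%:R + d) <= (K + 1) * (d + d).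
  have Kn : 0 <= K / n%:R by rewrite divr_ge0.
  by apply: ler_pM; rewrite ?lerDl ?lerD2r // addr_ge0 // ltW.
rewrite (le_trans (ler_wpM2l K0 h2)) // (le_trans h6) //.
by rewrite /d le_eqVlt; apply/orP; left; apply/eqP; field; lra.
Qed.

End Weyl.

(** * Polynomials along curves of powers *)
Section PolyData.
Variables (A : comNzRingType) (n : nat).
Local Notation expo := {ffun 'I_n -> nat}.

(** A polynomial as the list of its coefficients and exponents. *)
Lemma mpoly_data (p : mpoly.mpoly n A) : exists l : seq (A * expo),
  [/\ uniq (map snd l), forall q, q \in l -> q.1 != 0 &
  forall u : {ffun 'I_n -> A},
    mpoly.meval u p = \sum_(q <- l) q.1 * \prod_i u i ^+ q.2 i].
Proof.
pose ex m : expo := [ffun i => mpoly.fun_of_multinom m i].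
exists [seq (mpoly.mcoeff m p, ex m) | m <- mpoly.msupp p]; split.
- rewrite -map_comp (@map_inj_uniq (mpoly.mpoly_multinom__canonical__eqtype_Equality n)).
    exact: mpoly.msupp_uniq.
  by move=> m m' /ffunP e; apply/mpoly.mnmP => i; have := e i; rewrite !ffunE.
- move=> q /(@mapP (mpoly.mpoly_multinom__canonical__eqtype_Equality n)) [m hm ->] /=.
  by rewrite -mpoly.mcoeff_msupp.
move=> u; rewrite mpoly.mevalE [RHS]big_map; apply: eq_bigr => m _ /=.
by congr (_ * _); apply: eq_bigr => i _; rewrite ffunE.
Qed.

Lemma seq_argmax (T : eqType) (f : T -> nat) (l : seq T) x : x \in l ->
  exists2 y, y \in l & forall z, z \in l -> (f z <= f y)%N.
Proof.
elim: l x => // a l IH x _; case: l IH => [|b l] IH.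
  by exists a => [|z]; rewrite inE // => /eqP ->.
have [y yl hy] := IH b (mem_head _ _).
have [ay|ya] := leqP (f a) (f y).
  by exists y => [|z]; rewrite inE ?yl ?orbT // => /orP[/eqP ->|/hy].
exists a => [|z]; first exact: mem_head.
by rewrite inE => /orP[/eqP ->//|/hy h]; rewrite (leq_trans h) // ltnW.
Qed.

Definition monic_size (f : {poly A}) w := f \is monic /\ size f = w.+1.
Lemma monic_size1 : monic_size 1 0. Proof. by rewrite /monic_size monic1 size_poly1. Qed.
Lemma monic_sizeM f g w v : monic_size f w -> monic_size g v -> monic_size (f * g) (w + v).
Proof.
move=> [fm fs] [gm gs]; split; first by rewrite monicMl.
by rewrite size_Mmonic ?monic_neq0 // fs gs addSn addnS.
Qed.
Lemma monic_sizeX f w m : monic_size f w -> monic_size (f ^+ m) (m * w).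
Proof.
move=> h; elim: m => [|m IH]; first exact: monic_size1.
by rewrite exprS mulSn; exact: monic_sizeM.
Qed.

Definition sparse_eval (l : seq (A * expo)) (u : 'I_n -> A) :=
  \sum_(q <- l) q.1 * \prod_i u i ^+ q.2 i.

Definition digit_weight k (m : expo) : nat := (\sum_i m i * k ^ i)%N.

Lemma digits_inj k d (a b : 'I_d -> nat) : (forall i, a i < k)%N ->
  (forall i, b i < k)%N -> (\sum_i a i * k ^ i)%N = (\sum_i b i * k ^ i)%N ->
  forall i, a i = b i.
Proof.
elim: d a b => [|d IH] a b ak bk; first by move=> _ [].
have k0 : (0 < k)%N by exact: leq_trans (ak ord0).
have ss (f : 'I_d.+1 -> nat) : (\sum_i f i * k ^ i)%N =
    ((\sum_(i < d) f (fintype.lift ord0 i) * k ^ i) * k + f ord0)%N.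
  rewrite big_ord_recl /= expn0 muln1 addnC; congr (_ + _)%N.
  by rewrite big_distrl; apply: eq_bigr => i _; rewrite /= expnSr mulnA.
rewrite !ss => e.
have e0 : a ord0 = b ord0.
  by have := congr1 (modn^~ k) e; rewrite /= !modnMDl !modn_small.
have e1 := congr1 (divn^~ k) e; rewrite /= !divnMDl // !divn_small // !addn0 in e1.
move=> i; have [j ->|->//] := unliftP ord0 i.
by apply: (IH (fun i => a (fintype.lift ord0 i)) (fun i => b (fintype.lift ord0 i))).
Qed.

Definition kronecker_shift k (t : A) : {ffun 'I_n -> A} := [ffun i : 'I_n => t ^+ (k ^ i)].

(** With k larger than all exponents, t |-> (t^(k^i))_i separates the
monomials by their degree in t.  Each monomial in u + (t^(k^i))_i is monic in t
of degree sum_i m_i k^i, and these degrees are distinct, so the leading term in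
t comes from a single monomial and does not depend on u. *)
Lemma kronecker (l : seq (A * expo)) :
  uniq (map snd l) -> (forall q, q \in l -> q.1 != 0) ->
  (exists2 q, q \in l & q.2 != [ffun=> 0%N]) ->
  exists k D a, [/\ (0 < k)%N, a != 0 & forall u : {ffun 'I_n -> A}, exists q : {poly A},
    [/\ (size q <= D.+2)%N, q`_D.+1 = a &
      forall t, q.[t] = sparse_eval l (u + kronecker_shift k t)]].
Proof.
move=> ul cl [q0 q0l q0n].
pose k := (\sum_(q <- l) \sum_i q.2 i).+1.
have kl q i : q \in l -> (q.2 i < k)%N.
  move=> ql; rewrite /k ltnS (big_rem _ ql) /= (bigD1 i) //= -!addnA.
  exact: leq_addr.
have winj q q' : q \in l -> q' \in l -> digit_weight k q.2 = digit_weight k q'.2 -> q = q'.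
  move=> ql ql' e.
  have e2 : q.2 = q'.2.
    apply/ffunP; apply: digits_inj e => i; exact: kl.
  have [i il ei] := nthP q0 ql; have [i' il' ei'] := nthP q0 ql'.
  have : nth q0.2 (map snd l) i = nth q0.2 (map snd l) i'.
    by rewrite !(nth_map q0) // ei ei'.
  move/eqP; rewrite nth_uniq ?size_map // => /eqP ii'.
  by rewrite -ei -ei' ii'.
have [qs qsl qmax] : exists2 qs, qs \in l & forall q, q \in l -> (digit_weight k q.2 <= digit_weight k qs.2)%N.
  exact: seq_argmax (fun q => digit_weight k q.2) l q0 q0l.
have : (0 < digit_weight k qs.2)%N.
  apply: leq_trans (qmax _ q0l); rewrite lt0n; apply: contra q0n => /eqP e.
  apply/eqP/ffunP => i; rewrite ffunE; apply/eqP; rewrite -leqn0 -e /digit_weight.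
  by rewrite (bigD1 i) //= (leq_trans _ (leq_addr _ _)) // leq_pmulr // expn_gt0.
case eD : (digit_weight k qs.2) => [//|D] _.
exists k, D, qs.1; split=> //; first exact: cl.
move=> u; pose B i : {poly A} := (u i)%:P + 'X^(k ^ i).
have Bm i : monic_size (B i) (k ^ i).
  have s1 : (size ((u i)%:P : {poly A}) < size ('X^(k ^ i) : {poly A}))%N.
    by rewrite size_polyXn ltnS (leq_trans (size_polyC_leq1 _)) // expn_gt0.
  rewrite /B addrC; split; last by rewrite size_polyDl // size_polyXn.
  by rewrite monicE lead_coefDl // lead_coefXn.
have pm (m : expo) : monic_size (\prod_i B i ^+ m i) (digit_weight k m).
  rewrite /digit_weight; elim/big_rec2: _ => [|i w f _ h]; first exact: monic_size1.
  by apply: monic_sizeM h; apply: monic_sizeX.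
pose q := \sum_(x <- l) x.1 *: \prod_i B i ^+ x.2 i.
have cq x j : x \in l -> (digit_weight k x.2 < j)%N -> (\prod_i B i ^+ x.2 i)`_j = 0.
  by move=> xl h; rewrite nth_default // (pm x.2).2.
exists q; split.
- apply/leq_sizeP => j Dj; rewrite coef_sum big_seq big1 // => x xl.
  by rewrite coefZ cq ?mulr0 // (leq_ltn_trans (qmax x xl)) // eD.
- rewrite coef_sum (big_rem _ qsl) /= coefZ.
  have [/monicP lc sz] := pm qs.2.
  have -> : (\prod_i B i ^+ qs.2 i)`_D.+1 = 1 by rewrite -lc lead_coefE sz eD.
  rewrite mulr1 big_seq big1 ?addr0 // => x xl.
  have lu : uniq l by exact: map_uniq ul.
  move: xl; rewrite mem_rem_uniq // inE => /andP[xq xl].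
  rewrite coefZ cq ?mulr0 // -eD ltn_neqAle qmax // andbT.
  by apply: contra_neq xq; exact: winj.
move=> t; rewrite horner_sum /sparse_eval; apply: eq_bigr => x _.
rewrite hornerZ horner_prod; congr (_ * _); apply: eq_bigr => i _.
by rewrite horner_exp !hornerE !ffunE.
Qed.
End PolyData.

(** * Recurrence of positive definite functions *)
Section Zeta.
Variables (R : realType) (A : comNzRingType).
Hypothesis dom : forall a b : A, a * b = 0 -> a = 0 \/ b = 0.
Hypothesis char0 : forall n, n.+1%:R != 0 :> A.

Definition multiples (c : A) : set A := [set g | exists b, g = c * b].
Lemma multiples_subgroup c : subgroup_set (multiples c).
Proof.
split; first by exists 0; rewrite mulr0.
  by move=> _ _ [b ->] [b' ->]; exists (b + b'); rewrite mulrDr.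
by move=> _ [b ->]; exists (- b); rewrite mulrN.
Qed.

Lemma weights_in_multiples c (s : seq (R * A)) : is_weight s -> weights_in s (multiples c) ->
  exists2 s', is_weight s' & forall F, wavg s F = wavg s' (fun h => F (c * h)).
Proof.
move=> ps ss; have /choice [f hf] : forall g, exists b, multiples c g -> g = c * b.
  move=> g; have [[b hb]|n] := pselect (multiples c g); first by exists b.
  by exists 0.
exists (wmap f s) => [|F]; first exact: wmap_weight.
by rewrite wavg_map; apply: (wavg_weights_in ss) => g /hf /= <-.
Qed.

Section Rational.
Variables (H : isorep R A).

Definition periodic_vec : set H := [set v | exists2 c : A, c != 0 & fixed_by (multiples c) v].
(** Limits of vectors fixed by some nonzero ideal: the part of the
spectrum carried by characters of finite order. *)
Definition rational_vec : set H := [set v | adherent periodic_vec v].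

Lemma periodic_vec_subspace : subspace periodic_vec.
Proof.
split; first by exists 1; [exact: oner_neq0|move=> g _; rewrite act_0 subrr nm0].
move=> a x y [c c0 ix] [d d0 iy]; exists (c * d).
  by apply/eqP => /dom [h|h]; [move: c0|move: d0]; rewrite h eqxx.
move=> g [b ->]; rewrite actP opprD addrACA -scalerBr.
apply/eqP; rewrite eq_le nm_ge0 andbT (le_trans (nmD _ _)) // nmZ.
rewrite ix ?iy ?mulr0 ?addr0 //; first by exists (c * b); rewrite mulrCA mulrA.
by exists (d * b); rewrite mulrA.
Qed.

Lemma rational_vec_subspace : subspace rational_vec.
Proof.
split; first by move=> e e0; exists 0; [exact: periodic_vec_subspace.1|rewrite subrr nm0].
move=> a x y ax ay e e0; have a1 : 0 < `|a| + 1 by rewrite ltr_wpDl.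
have [|x' rx hx] := ax (e / 2 / (`|a| + 1)); first by rewrite !divr_gt0.
have [|y' ry hy] := ay (e / 2); first by rewrite !divr_gt0.
exists (a *: x' + y'); first exact: periodic_vec_subspace.2.
rewrite opprD addrACA -scalerBr; apply: nm_ltD => //.
rewrite nmZ; move: hx; rewrite ltr_pdivlMr // => h.
by rewrite (le_lt_trans _ h) // mulrC ler_wpM2l ?nm_ge0 // lerDl.
Qed.

Lemma rational_vec_closed : limit_closed rational_vec.
Proof.
move=> v adh e e0; have e2 : 0 < e / 2 by rewrite divr_gt0.
have [y ry hy] := adh _ e2; have [z rz hz] := ry _ e2.
exists z => //; rewrite (le_lt_trans (nm_tri y _ _)) //; lra.
Qed.

Lemma rational_vec_act g v : rational_vec v -> rational_vec (act g v).
Proof.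
move=> rv e /rv [y [c c0 iy] hy]; exists (act g y); last by rewrite -act_sub nm_act.
exists c => // h hc; rewrite -actD [h + g]addrC actD -act_sub nm_act; exact: iy.
Qed.
End Rational.

Variable n : nat.
Local Notation pt := {ffun 'I_n -> A}.

Lemma sparse_eval_cong (l : seq (A * {ffun 'I_n -> nat})) (c : A) (u v : pt) :
  (forall i, multiples c (u i - v i)) -> multiples c (sparse_eval l u - sparse_eval l v).
Proof.
move=> uv; have [D0 DD DN] := multiples_subgroup c.
have DM (x y a : A) : multiples c (x - y) -> multiples c (a * x - a * y).
  by move=> [b hb]; exists (a * b); rewrite -mulrBr hb mulrCA.
have DMM (x y x' y' : A) : multiples c (x - y) -> multiples c (x' - y') ->
    multiples c (x * x' - y * y').
  move=> h h'; have -> : x * x' - y * y' = (x * x' - x * y') + (y' * x - y' * y) by ring.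
  by apply: DD; exact: DM.
rewrite /sparse_eval -sumrB; apply: big_ind => // q _; apply: DM.
elim/big_rec2: _ => [|i x y _ h]; first by rewrite subrr.
apply: (DMM) => //; elim: (q.2 i) => [|m IH]; first by rewrite !expr0 subrr.
by rewrite !exprS; apply: (DMM).
Qed.

Variables (l : seq (A * {ffun 'I_n -> nat})).
Hypothesis lu : uniq (map snd l).
Hypothesis ln0 : forall q, q \in l -> q.1 != 0.
Hypothesis lnc : exists2 q, q \in l & q.2 != [ffun=> 0%N].
Hypothesis lint : forall c : A, c != 0 -> exists u : pt, multiples c (sparse_eval l u).

(** Split the vector W representing F as Wr + W' with Wr rational and W'
orthogonal to the rational vectors.  The mean of F is at most ||Wr||^2, since
the vectors fixed by the whole ring are rational.  Up to a small error Wr is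
fixed by an ideal c A, and the hypothesis provides u0 with p(u0) in c A; then
p(u0 + s(c t)) stays in c A for all t, so that <U^g Wr, Wr> is close to
||Wr||^2 at all these values, while the contribution of W' averages out over t
by Weyl's theorem. *)
Lemma posdef_recurrence (F : A -> R) (m eta : R) : posdef F -> 0 < m ->
  (forall s, is_weight s -> m <= wavg s (fun h => wavg s (fun h' => F (h - h')))) ->
  0 < eta -> exists u : pt, m - eta < F (sparse_eval l u).
Proof.
move=> pF m0 mF eta0; have [H [W [cH FE]]] := posdef_rep pF.
have [Wr rWr perp] := projection cH W (rational_vec_subspace H) (@rational_vec_closed H).
pose W' := W - Wr; have eW : W = W' + Wr by rewrite subrK.
have perp' v : rational_vec v -> ip v W = ip v Wr.
  move=> rv; apply/eqP; rewrite -subr_eq0 -ipBr ipC; apply/eqP; exact: perp.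
rewrite -/W' in perp; clearbody W'.
have fixed_by_rational c v : c != 0 -> fixed_by (multiples c) v -> rational_vec v.
  by move=> c0 iv e e0; exists v; [exists c|rewrite subrr nm0].
have mWr : m <= ip Wr Wr.
  have [v [iv vW hv]] := ergodic W cH (multiples_subgroup 1).
  have rv : rational_vec v by exact: fixed_by_rational (oner_neq0 _) iv.
  have mv : m <= ip v v.
    rewrite -nm2 -[leLHS](sqr_sqrtr (ltW m0)) ler_sqr ?nnegrE ?nm_ge0 ?sqrtr_ge0 //.
    apply: le_eps => e /hv [s [ps ss h]].
    have := nm_dist (act_avg s W) v.
    have : Num.sqrt m <= nm (act_avg s W).
      rewrite /nm ler_sqrt ?ip_ge0 // ip_act_avg2 (le_trans (mF s ps)) //.
      by rewrite le_eqVlt; apply/orP; left; apply/eqP; apply: eq_wavg => g; apply: eq_wavg => g'.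
    by move: h; lra.
  have vWr : ip v v ^+ 2 <= ip v v * ip Wr Wr by rewrite {1}vW perp' // cauchy_schwarz_sqr.
  have vv0 : 0 < ip v v by exact: lt_le_trans mv.
  by rewrite (le_trans mv) // -(ler_pM2l vv0) -expr2.
have [e2 e20 he2] : exists2 e2, 0 < e2 & 2 * e2 * nm Wr <= eta / 2.
  exists (eta / 4 / (nm Wr + 1)).
    by rewrite !divr_gt0 // ltr_wpDl // nm_ge0.
  have w1 : 0 < nm Wr + 1 by rewrite ltr_wpDl // nm_ge0.
  have -> : 2 * (eta / 4 / (nm Wr + 1)) * nm Wr = eta / 2 * (nm Wr / (nm Wr + 1)).
    by field; rewrite gt_eqF.
  by rewrite ler_piMr ?divr_ge0 ?ltW // ltr_pdivrMr // mul1r ltrDl.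
have [v [c c0 iv] hv] := rWr _ e20.
have [u0 hu0] := lint c0.
have [k [D [a [k0 a0 hq]]]] := kronecker lu ln0 lnc.
have [q [qD qa qev]] := hq u0.
have zm : zero_mean (fun g => ip (act g W') W').
  move=> d e d0 e0.
  have [v'|s [ps ss h]] := ergodic_perp (x := W') cH (multiples_subgroup d) _ e0.
    by move=> iv'; apply: perp; exact: fixed_by_rational d0 iv'.
  have [s' ps' hs'] := weights_in_multiples ps ss; exists s'; split=> //.
  move: h; rewrite hs'; congr (_ < _); apply: eq_wavg => g.
  by rewrite hs'.
(* The polynomial t |-> p(u0 + s(c t)): the powers of c t in the shift all have
   positive exponents, so its values are congruent to p(u0) modulo c. *)
pose qc := \poly_(i < D.+2) (q`_i * c ^+ i).
have acn0 : a * c ^+ D.+1 != 0.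
  have : c ^+ D.+1 != 0.
    elim: D.+1 => [|j IH]; first by rewrite expr0 oner_neq0.
    by rewrite exprS; apply/eqP => /dom [h|h]; [move: c0|move: IH]; rewrite h eqxx.
  by move=> cn0; apply/eqP => /dom [h|h]; [move: a0|move: cn0]; rewrite h eqxx.
have [S pS gS] := weyl dom char0 zm D acn0 (divr_gt0 eta0 (ltr0Sn R 3)).
have := gS qc (size_poly _ _); rewrite coef_poly ltnSn qa => /(_ erefl).
have qcE t : qc.[t] = sparse_eval l (u0 + kronecker_shift n k (c * t)).
  rewrite -qev (horner_coef_wide _ qD) horner_poly; apply: eq_bigr => i _.
  by rewrite exprMn mulrA.
rewrite ler_norml => /andP[hS _].
have qcc t : multiples c qc.[t].
  have [D0 DD DN] := multiples_subgroup c.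
  rewrite qcE -[sparse_eval _ _](subrK (sparse_eval l u0)); apply: DD => //.
  apply: sparse_eval_cong => i; rewrite !ffunE addrAC subrr add0r.
  have : (0 < k ^ i)%N by rewrite expn_gt0 k0.
  case: (k ^ i)%N => // j _; exists (t * (c * t) ^+ j).
  by rewrite exprS mulrA.
have [t ht] : exists t, m - eta < F qc.[t].
  apply: (wavg_gt pS); apply: lt_le_trans (_ : wavg S (fun t => m - eta / 2 + ip (act qc.[t] W') W') <= _).
    by rewrite wavgD (wavg_cst _ pS); lra.
  apply: wavg_le => // t; rewrite -FE eW act_add.
  rewrite ipDl !ipDr [ip (act _ W') Wr]act_adj perp; last exact: rational_vec_act.
  rewrite [ip (act _ Wr) W']ipC perp; last exact: rational_vec_act.
  rewrite addr0 add0r addrC lerD2l.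
  set g := qc.[t].
  have -> : ip (act g Wr) Wr = ip Wr Wr + ip (act g Wr - Wr) Wr by rewrite ipBl addrC subrK.
  have b : nm (act g Wr - Wr) <= 2 * e2.
    rewrite (le_trans (nm_tri (act g v) _ _)) //.
    rewrite -act_sub nm_act (le_trans (lerD (lexx _) (nm_tri v _ _))) //.
    by rewrite (iv g (qcc t)) add0r nmBC mulr2n mulrDl mul1r lerD // ltW.
  have := le_trans (cauchy_schwarz (act g Wr - Wr) Wr) (ler_wpM2r (nm_ge0 Wr) b).
  by rewrite ler_norml => /andP[+ _]; lra.
by exists (u0 + kronecker_shift n k (c * t)); rewrite -qcE.
Qed.

End Zeta.

(** * Bohr recurrence along intersective polynomials *)
Section CellAverage.
Variables (R : realType) (T : Type).

(** The probability that two independent points share one of N + 1 cells is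
least for equal probabilities. *)
Lemma wavg_cells (s : seq (R * T)) N (idx : T -> 'I_N.+1) : is_weight s ->
  N.+1%:R^-1 <= wavg s (fun h => wavg s (fun h' => (idx h == idx h')%:R)) :> R.
Proof.
move=> ps; pose P j := wavg s (fun h => (idx h == j)%:R : R).
have -> : wavg s (fun h => wavg s (fun h' => (idx h == idx h')%:R)) = \sum_j P j ^+ 2.
  transitivity (wavg s (fun h => wavg s (fun h' => \sum_j (idx h == j)%:R * (idx h' == j)%:R : R))).
    apply: eq_wavg => h; apply: eq_wavg => h'.
    rewrite (bigD1 (idx h)) //= eqxx mul1r big1 ?addr0 1?eq_sym // => j jh.
    by rewrite eq_sym (negbTE jh) mul0r.
  have EE_sum F : wavg s (fun h => \sum_(j < N.+1) F j h) = \sum_j wavg s (F j).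
    by rewrite /wavg exchange_big; apply: eq_bigr => p _; rewrite mulr_sumr.
  transitivity (wavg s (fun h => \sum_j (idx h == j)%:R * P j)).
    by apply: eq_wavg => h; rewrite EE_sum; apply: eq_bigr => j _; rewrite wavgZ.
  rewrite EE_sum; apply: eq_bigr => j _; rewrite expr2.
  by under eq_wavg do rewrite mulrC; rewrite wavgZ.
have P1 : \sum_j P j = 1.
  rewrite /P /wavg exchange_big -[RHS]ps.2; apply: eq_bigr => p _.
  rewrite -mulr_sumr (bigD1 (idx p.2)) //= eqxx big1 ?addr0 ?mulr1 // => j.
  by rewrite eq_sym => /negbTE ->.
have N0 : N.+1%:R != 0 :> R by rewrite pnatr_eq0.
have h : 0 <= \sum_j (P j - N.+1%:R^-1) ^+ 2.
  by apply: sumr_ge0 => j _; exact: sqr_ge0.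
rewrite -subr_ge0; apply: le_trans h _; rewrite le_eqVlt; apply/orP; left; apply/eqP.
transitivity (\sum_j (P j ^+ 2 + - (2 / N.+1%:R) * P j + N.+1%:R^-1 ^+ 2)).
  by apply: eq_bigr => j _; field.
rewrite !big_split /= -mulr_sumr P1 sumr_const card_ord.
by rewrite -[_ *+ N.+1]mulr_natr; field.
Qed.
End CellAverage.

Lemma geometric_gap (R : realType) (a b K : R) : 0 <= a -> a < b -> 0 < K ->
  exists k, K * a ^+ k < b ^+ k.
Proof.
move=> a0 ab K0; have b0 : 0 < b by exact: le_lt_trans ab.
have y1 : `|a / b| < 1 by rewrite ger0_norm ?divr_ge0 ?(ltW b0) // ltr_pdivrMr // mul1r.
have := cvg_expr y1 => /cvg_real_epsN /(_ K^-1).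
rewrite invr_gt0 => /(_ K0) [N /(_ N (leqnn _))].
rewrite /= subr0 ger0_norm ?exprn_ge0 ?divr_ge0 ?(ltW b0) //.
rewrite exprMn exprVn ltr_pdivrMr ?exprn_gt0 // => h; exists N.
by rewrite -(ltr_pM2l (_ : 0 < K^-1)) ?invr_gt0 // mulrA mulVf ?gt_eqF // mul1r.
Qed.

Section Zeta.
Variables (R : realType) (A : comNzRingType).
Hypothesis dom : forall a b : A, a * b = 0 -> a = 0 \/ b = 0.
Hypothesis char0 : forall n, n.+1%:R != 0 :> A.
Variable n : nat.
Local Notation pt := {ffun 'I_n -> A}.
Variables (l : seq (A * {ffun 'I_n -> nat})).
Hypothesis lu : uniq (map snd l).
Hypothesis ln0 : forall q, q \in l -> q.1 != 0.
Hypothesis lnc : exists2 q, q \in l & q.2 != [ffun=> 0%N].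
Hypothesis lint : forall c : A, c != 0 -> exists u : pt, multiples c (sparse_eval l u).

(** The function f = (1 + psi) / 2, with psi(g) = <U^g x, x> / ||x||^2,
equals 1 - ||U^g x - x||^2 / (4 ||x||^2).  It is at most 1 - th on the group
elements that move x by e or more, and at least 1 - th / 2 on differences of
two elements in the same cell of a partition into N + 1 cells of diameter less
than 2 e / 3.  Hence f^k has mean at least (1 - th / 2)^k / (N + 1), which
exceeds (1 - th)^k for large k. *)
Lemma bohr_recurrence (H : isorep R A) (x : H) (e : R) : compact_vec x -> 0 < e ->
  exists u : pt, nm (act (sparse_eval l u) x - x) < e.
Proof.
move=> cx e0; have [x0|xn0] := eqVneq (ip x x) 0.
  exists 0; apply: le_lt_trans e0; rewrite (le_trans (nmB _ _)) // nm_act.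
  by rewrite /nm x0 sqrtr0 addr0.
pose N0 := ip x x; have N00 : 0 < N0 by rewrite lt_def xn0 ip_ge0.
apply: contrapT => /forallNP no.
have big (u : pt) : e <= nm (act (sparse_eval l u) x - x) by rewrite leNgt; apply/negP; exact: no.
pose f g := 1 / 2 + (2 * N0)^-1 * ip (act g x) x.
have pf : posdef f.
  apply: posdefD; first by apply: posdef_cst; rewrite divr_ge0.
  apply: posdefM; last exact: rep_posdef.
  by apply: posdef_cst; rewrite invr_ge0 mulr_ge0 // ltW.
have fE g : f g = 1 - nm (act g x - x) ^+ 2 / (4 * N0).
  rewrite nm2 ipBl !ipBr act_iso (ipC x) /f -/N0; field; exact: lt0r_neq0.
have f0 g : 0 <= f g.
  have := cauchy_schwarz (act g x) x; rewrite nm_act -expr2 nm2 -/N0 ler_norml => /andP[h _].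
  have -> : f g = (N0 + ip (act g x) x) / (2 * N0) by rewrite /f; field; exact: lt0r_neq0.
  by rewrite divr_ge0 ?mulr_ge0 ?(ltW N00) //; lra.
pose th := e ^+ 2 / (4 * N0).
have th0 : 0 < th by rewrite divr_gt0 ?exprn_gt0 // mulr_gt0.
have f_far (u : pt) : f (sparse_eval l u) <= 1 - th.
  rewrite fE lerD2l lerN2 ler_wpM2r ?invr_ge0 ?mulr_ge0 ?(ltW N00) //.
  by rewrite ler_sqr ?nnegrE ?nm_ge0 ?(ltW e0).
have th1 : 0 <= 1 - th by rewrite (le_trans _ (f_far 0)).
have e3 : 0 < 2 * (e / 3) by rewrite mulr_gt0 // divr_gt0.
have [N [idx hidx]] := totally_bdd_color (0 : A) (orbit_dist_pseudo x) cx e3.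
have f_near h h' : idx h = idx h' -> 1 - th / 2 <= f (h - h').
  move=> /hidx; rewrite orbit_distE => hh; rewrite fE lerD2l lerN2.
  rewrite /th [leRHS]mulrAC ler_pM2r ?invr_gt0 ?mulr_gt0 //.
  have := nm_ge0 (act (h - h') x - x); move: hh; rewrite !expr2.
  move: (nm _) => y yy y0.
  have : y * y <= 2 * (e / 3) * (2 * (e / 3)) by rewrite ler_pM // ltW.
  have : 0 < e * e by rewrite mulr_gt0.
  by lra.
have [k hk] : exists k, N.+1%:R * (1 - th) ^+ k < (1 - th / 2) ^+ k.
  by apply: geometric_gap => //; lra.
pose m := (1 - th / 2) ^+ k / N.+1%:R.
have m0 : 0 < m by rewrite divr_gt0 // exprn_gt0 //; lra.
have hm : (1 - th) ^+ k < m by rewrite /m ltr_pdivlMr // mulrC.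
have [s ps||u hu] := @posdef_recurrence R A dom char0 n l lu ln0 lnc lint
   (fun g => f g ^+ k) m (m - (1 - th) ^+ k) (posdefX k pf) m0.
- rewrite /m mulrC.
  apply: (le_trans (ler_wpM2r _ (wavg_cells idx ps))).
    by rewrite exprn_ge0 //; lra.
  rewrite mulrC -wavgZ; apply: wavg_le => // h; rewrite -wavgZ; apply: wavg_le => // h'.
  have [ii|] := eqVneq (idx h) (idx h'); last by rewrite mulr0 exprn_ge0.
  rewrite mulr1 lerXn2r ?nnegrE ?f0 //; last exact: f_near.
  by lra.
- by rewrite subr_gt0.
move: hu; rewrite subKr ltNge lerXn2r ?nnegrE ?f0 //; exact: f_far.
Qed.
End Zeta.

(** * IP recurrence of polynomial maps *)
Section PolyFun.
Variables (G : zmodType).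

(** Polynomial maps of degree less than D, in the sense of iterated
differences. *)
Fixpoint polyfun (A : zmodType) D (q : G -> A) : Prop :=
  if D is D'.+1 then forall y, polyfun D' (fun x => q (x + y) - q x)
  else forall x, q x = 0.

Lemma polyfun_ext (A : zmodType) D (q q' : G -> A) : q =1 q' -> polyfun D q -> polyfun D q'.
Proof. by move=> /funext ->. Qed.

Lemma polyfunS (A : zmodType) D (q : G -> A) : polyfun D q -> polyfun D.+1 q.
Proof.
elim: D q => [|D IH] q h y; last exact: IH (h y).
by move=> x; rewrite !h subrr.
Qed.

Lemma polyfun_le (A : zmodType) D E (q : G -> A) : (D <= E)%N -> polyfun D q -> polyfun E q.
Proof.
move=> /subnK <-; elim: (E - D)%N => // k IH h.
by rewrite addSn; apply: polyfunS; exact: IH.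
Qed.

Lemma polyfun0 (A : zmodType) D : polyfun D (fun _ : G => 0 : A).
Proof. exact: (@polyfun_le _ 0). Qed.

Lemma polyfunD (A : zmodType) D (q q' : G -> A) : polyfun D q -> polyfun D q' ->
  polyfun D (fun x => q x + q' x).
Proof.
elim: D q q' => [|D IH] q q' h h'; first by move=> x; rewrite h h' addr0.
move=> y; apply: polyfun_ext (IH _ _ (h y) (h' y)) => x.
by rewrite opprD addrACA.
Qed.

Lemma polyfun_shift (A : zmodType) D (q : G -> A) a : polyfun D q ->
  polyfun D (fun x => q (x + a)).
Proof.
elim: D q => [|D IH] q h; first by move=> x; exact: h.
move=> y; apply: polyfun_ext (IH _ (h y)) => x.
by rewrite addrAC.
Qed.

Lemma polyfun_cst (A : zmodType) (c : A) : polyfun 1 (fun _ : G => c).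
Proof. by move=> y x /=; rewrite subrr. Qed.

Lemma polyfunM (A : comNzRingType) D E (f g : G -> A) : polyfun D f -> polyfun E g ->
  polyfun (D + E) (fun x => f x * g x).
Proof.
have [k] := ubnP (D + E); elim: k D E f g => // k IH [|D] E f g.
  by move=> _ hf _; apply: polyfun_ext (polyfun0 _ _) => x; rewrite hf mul0r.
case: E => [|E].
  by move=> _ _ hg; apply: polyfun_ext (polyfun0 _ _) => x; rewrite hg mulr0.
rewrite ltnS => le hf hg; rewrite addSn => y.
have h1 : polyfun (D + E.+1) (fun x => f (x + y) * (g (x + y) - g x)).
  by rewrite addnS -addSn; apply: IH (polyfun_shift y hf) (hg y); rewrite addSn -addnS.
have h2 : polyfun (D + E.+1) (fun x => (f (x + y) - f x) * g x).
  by apply: IH (hf y) hg; exact: le.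
apply: polyfun_ext (polyfunD h1 h2) => x; ring.
Qed.

(** The defect of additivity of q against y is q(x + y) - q(x) up to a
constant: this is the descent step of ip_recurrence. *)
Lemma polyfun_sub (A : zmodType) D (q : G -> A) y : polyfun D.+2 q ->
  polyfun D.+1 (fun x => q (x + y) - q x - q y).
Proof.
move=> h; have h1 : polyfun D.+1 (fun x => q (x + y) - q x) by exact: h.
have h2 : polyfun D.+1 (fun _ : G => - q y).
  by apply: (@polyfun_le _ 1) => //; exact: polyfun_cst.
exact: polyfunD h1 h2.
Qed.

End PolyFun.

Section IPRecurrence.
Variables (R : realType) (G A : zmodType) (x : nat -> G).
Variable rho : A -> R.
Hypothesis rho0 : rho 0 = 0.
Hypothesis rhoN : forall a, rho (- a) = rho a.
Hypothesis rhoD : forall a b, rho (a + b) <= rho a + rho b.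
Hypothesis rho_tb : totally_bdd setT (fun a b => rho (a - b)).

Definition finite_sum_in m k z := exists a : {fset nat},
  [/\ a != fset0, forall i, i \in a -> (m <= i < k)%N &
      z = \sum_(i <- enum_fset a) x i].

Lemma finite_sum_in1 m : finite_sum_in m m.+1 (x m).
Proof.
exists [fset m]%fset; split.
- by apply/fset0Pn; exists m; rewrite in_fset1.
- by move=> i; rewrite in_fset1 => /eqP ->; rewrite leqnn ltnSn.
by rewrite big_seq_fset1.
Qed.

Lemma finite_sum_in_le m k k' z : (k <= k')%N -> finite_sum_in m k z -> finite_sum_in m k' z.
Proof.
move=> kk [a [a0 ha ->]]; exists a; split=> // i /ha /andP[-> /=].
by move/leq_trans; apply.
Qed.

Lemma finite_sum_in_gt m k z : finite_sum_in m k z -> (m < k)%N.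
Proof.
move=> [a [/fset0Pn [i /[swap] h +] _]] => [] /h /andP[]; exact: leq_ltn_trans.
Qed.

Lemma finite_sum_inD m k k' z z' : finite_sum_in m k z -> finite_sum_in k k' z' -> finite_sum_in m k' (z + z').
Proof.
move=> f f'; have mk := finite_sum_in_gt f; have kk' := finite_sum_in_gt f'.
move: f f' => [a [a0 ha ->]] [b [b0 hb ->]].
exists (a `|` b)%fset; split.
- by move: a0 => /fset0Pn [i ia]; apply/fset0Pn; exists i; rewrite in_fsetU ia.
- move=> i; rewrite in_fsetU => /orP[/ha|/hb] /andP[h1 h2].
    by rewrite h1 (ltn_trans h2).
  by rewrite h2 (leq_trans (ltnW mk)).
rewrite -big_cat; apply: perm_big; apply: uniq_perm.
- rewrite cat_uniq !fset_uniq andbT /=; apply/hasPn => i /hb /andP[ki _].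
  by apply/negP => /ha /andP[_]; rewrite ltnNge ki.
- exact: fset_uniq.
by move=> i; rewrite mem_cat in_fsetU.
Qed.

(** Simultaneous recurrence for a finite family, by induction on the degree.
The induction hypothesis, applied to the defects of additivity of the maps
against all sums of consecutive earlier terms, yields b_0, b_1, ... among the
finite sums with
  Q(b_i + ... + b_(j-1)) close to Q(b_i) + ... + Q(b_(j-1))
for all i < j <= J.  The number J is fixed beforehand so that two partial sums
of the Q(b_h) lie close together by pigeonhole, for all members of the family
at once; the difference of these partial sums is close to the value of Q at a
sum of consecutive terms. *)
Lemma ip_recurrence D (K : finType) (Q : K -> G -> A) :
  (forall q, polyfun D.+1 (Q q)) -> (forall q, Q q 0 = 0) ->
  forall e m, 0 < e -> exists k z, finite_sum_in m k z /\ forall q, rho (Q q z) < e.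
Proof.
elim: D K Q => [|D IH] K Q pQ Q0 e m e0.
  exists m.+1, (x m); split; first exact: finite_sum_in1.
  move=> q; have -> : Q q (x m) = 0.
    by have := pQ q (x m) 0; rewrite add0r Q0 subr0.
  by rewrite rho0.
have pm : pseudo_dist (fun a b => rho (a - b)).
  split=> [a b|a b c]; first by rewrite -opprB rhoN.
  by rewrite (le_trans _ (rhoD _ _)) // subrKA.
have rho_ge0 a : 0 <= rho a.
  by have := rhoD a (- a); rewrite subrr rho0 rhoN; lra.
have build del : 0 < del -> forall J, exists (b : nat -> G) k, forall i j,
    (i < j)%N -> (j <= J)%N -> finite_sum_in m k (\sum_(i <= h < j) b h) /\
    forall q, rho (Q q (\sum_(i <= h < j) b h) - \sum_(i <= h < j) Q q (b h))
                <= (j - i)%:R * del.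
  move=> del0; elim=> [|J [b [k hb]]].
    by exists (fun=> 0), m => i j ij; rewrite leqn0 => /eqP j0; rewrite j0 in ij.
  (* The sums of consecutive terms ending with the last one built so far. *)
pose y (i : 'I_J) := \sum_(i <= h < J) b h.
  pose k1 := maxn m k.
  have [||k' [z [fz hz]]] := IH (K * 'I_J)%type
      (fun p u => Q p.1 (u + y p.2) - Q p.1 u - Q p.1 (y p.2)) _ _ del k1 del0.
  - by move=> [q i]; exact: polyfun_sub (pQ q).
  - by move=> [q i] /=; rewrite add0r Q0 subr0 subrr.
  pose b' h := if h == J then z else b h.
  have bb (E : zmodType) (f : G -> E) i j : (j <= J)%N ->
      \sum_(i <= h < j) f (b' h) = \sum_(i <= h < j) f (b h).
    move=> jJ; apply: eq_big_nat => h /andP[_ hj].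
    by rewrite /b' ltn_eqF // (leq_trans hj).
  have kk' := finite_sum_in_gt fz; have mk' : (k <= k')%N.
    by rewrite (leq_trans (leq_maxr m k)) // ltnW.
  have fz' : finite_sum_in m k' z.
    move: fz => [a [a0 ha ->]]; exists a; split=> // i /ha /andP[h ->].
    by rewrite andbT (leq_trans (leq_maxl m k)).
  exists b', k' => i j ij; rewrite leq_eqVlt => /orP[/eqP jJ|]; last first.
    rewrite ltnS => jJ; have [h1 h2] := hb _ _ ij jJ.
    rewrite (bb _ id) //; split; first exact: finite_sum_in_le h1.
    by move=> q; rewrite (bb _ (Q q)).
  have iJ : (i <= J)%N by rewrite -ltnS -jJ.
  have sj (E : zmodType) (f : G -> E) :
      \sum_(i <= h < j) f (b' h) = \sum_(i <= h < J) f (b h) + f z.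
    by rewrite jJ big_nat_recr //= bb // /b' eqxx.
  rewrite (sj _ id); move: iJ; rewrite leq_eqVlt => /orP[/eqP iJ|iJ].
    subst i; rewrite big_geq // add0r; split=> // q; rewrite (sj _ (Q q)) big_geq //.
    by rewrite add0r subrr rho0 mulr_ge0 // ltW.
  have [h1 h2] := hb _ _ iJ (leqnn J).
  split.
    apply: (finite_sum_inD h1); move: fz; rewrite /k1.
    by rewrite (maxn_idPr (ltnW (finite_sum_in_gt h1))).
  move=> q; rewrite (sj _ (Q q)).
  have := hz (q, Ordinal iJ); rewrite /= /y /=.
  set Y := \sum_(i <= h < J) b h => hz1.
  have -> : Q q (Y + z) - (\sum_(i <= h < J) Q q (b h) + Q q z) =
    (Q q (z + Y) - Q q z - Q q Y) + (Q q Y - \sum_(i <= h < J) Q q (b h)).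
    by rewrite subrKA [Y + z]addrC opprD [- _ - Q q z]addrC addrA.
  rewrite (le_trans (rhoD _ _)) // jJ subSn ?(ltnW iJ) // -natr1 mulrDl mul1r.
  by rewrite addrC lerD // ltW.
pose e2 := e / 2; have e20 : 0 < e2 by rewrite divr_gt0.
have [N [idx hidx]] := totally_bdd_color (0 : A) pm rho_tb e20.
pose J := #|{ffun K -> 'I_N.+1}|.
pose del := e / 2 / (J.+1)%:R.
have del0 : 0 < del by rewrite !divr_gt0.
have [b [k hb]] := build del del0 J.
pose S (q : K) j := \sum_(0 <= h < j) Q q (b h).
pose col (j : 'I_J.+1) : {ffun K -> 'I_N.+1} := [ffun q => idx (S q j)].
have [i [j [ij cij]]] : exists i j : 'I_J.+1, (i < j)%N /\ col i = col j.
  have /injectivePn [i [j ij cij]] : ~~ injectiveb col.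
    by apply/injectiveP => /leq_card; rewrite card_ord -/J ltnn.
  have [h|h|h] := ltngtP i j; first by exists i, j.
    by exists j, i.
  by move: ij; rewrite (val_inj h) eqxx.
have [f1 h1] := hb i j ij (ltn_ord j).
exists k, (\sum_(i <= h < j) b h); split=> // q.
set Y := \sum_(i <= h < j) b h in h1 *.
have h2 : rho (S q j - S q i) < e2.
  by apply: hidx; have /ffunP /(_ q) := cij; rewrite !ffunE.
have h3 : \sum_(i <= h < j) Q q (b h) = S q j - S q i.
  rewrite /S (@big_cat_nat _ _ _ i 0 j) ?(ltnW ij) //=.
  by rewrite [X in _ = X - _]addrC addrK.
have h4 : (j - i)%:R * del <= e2.
  rewrite /del -/e2 mulrCA ler_piMr ?(ltW e20) //.
  rewrite ler_pdivrMr // mul1r ler_nat (leq_trans (leq_subr _ _)) //.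
  exact: ltnW.
have -> : Q q Y = (Q q Y - \sum_(i <= h < j) Q q (b h)) + (S q j - S q i).
  by rewrite h3 subrK.
rewrite (le_lt_trans (rhoD _ _)) //.
by have := le_trans (h1 q) h4; move: h2; rewrite /e2; lra.
Qed.
End IPRecurrence.

(** * Finite quotients in rings of integers *)
Lemma rat_pair_gen (u v : rat) : exists s t a b : int,
  u = a%:~R * (s%:~R * u + t%:~R * v) /\ v = b%:~R * (s%:~R * u + t%:~R * v).
Proof.
pose p := numq u * denq v; pose q := numq v * denq u.
pose d : rat := (denq u)%:~R * (denq v)%:~R.
have du : (denq u)%:~R != 0 :> rat by rewrite intr_eq0 denq_neq0.
have dv : (denq v)%:~R != 0 :> rat by rewrite intr_eq0 denq_neq0.
have d0 : d != 0 by rewrite mulf_neq0.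
have ud : u = p%:~R / d.
  rewrite -[LHS]divq_num_den /p /d rmorphM /=. by field; rewrite du dv.
have vd : v = q%:~R / d.
  by rewrite -[LHS]divq_num_den /q /d rmorphM /=; field; rewrite du dv.
clearbody p q d; have [s [t st]] := Bezoutz p q.
have /dvdzP [a pa] := dvdz_gcdl p q; have /dvdzP [b qb] := dvdz_gcdr p q.
exists s, t, a, b.
have -> : s%:~R * u + t%:~R * v = (gcdz p q)%:~R / d.
  by rewrite -st rmorphD !rmorphM /= ud vd; field.
by split; rewrite ?{1}ud ?{1}vd mulrA -rmorphM /= -?pa -?qb.
Qed.

Section FiniteQuotient.
Variables (G : zmodType).

(** A maximal family of pairwise inequivalent elements. *)
Lemma finite_cover (P : set G) (E : G -> G -> Prop) K :
  (forall a b, E a b -> E b a) ->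
  (forall x : 'I_K.+1 -> G, (forall i, P (x i)) -> exists i j, i != j /\ E (x i) (x j)) ->
  exists r : seq G, (forall h, List.In h r -> P h) /\
    forall a, P a -> exists2 h, List.In h r & E a h.
Proof.
move=> Es pig; apply: contrapT => no.
have ext k : exists x : nat -> G, (forall i, (i < k)%N -> P (x i)) /\
    forall i j, (i < j)%N -> (j < k)%N -> ~ E (x j) (x i).
  elim: k => [|k [x [xP xE]]]; first by exists (fun=> 0).
  have [a Pa ha] : exists2 a, P a & forall i, (i < k)%N -> ~ E a (x i).
    apply: contrapT => na; apply: no; exists [seq x i | i <- iota 0 k]; split.
      by move=> h /List.in_map_iff [i [<- /List.in_seq [_ ik]]]; apply: xP; lia.
    move=> a Pa; apply: contrapT => nh; apply: na; exists a => // i ik Ei; apply: nh.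
    exists (x i) => //; apply/List.in_map_iff; exists i; split=> //.
    by apply: mem_In; rewrite mem_iota.
  exists (fun i => if i == k then a else x i); split=> [i|i j ij].
    by rewrite ltnS leq_eqVlt; case: eqP => //= _; exact: xP.
  rewrite ltnS leq_eqVlt => /orP[/eqP jk|jk].
    by rewrite jk eqxx ltn_eqF -?jk //; apply: ha; rewrite -jk.
  by rewrite !ltn_eqF ?(ltn_trans ij) //; exact: xE.
have [x [xP xE]] := ext K.+1.
have [|i [j [ij Eij]]] := pig (fun i => x i); first by move=> i; exact: xP.
have [h|h|h] := ltngtP i j.
- by apply: (xE i j) => //; exact: Es.
- exact: (xE j i).
by move: ij; rewrite (val_inj h) eqxx.
Qed.

Variable N : nat.
Hypothesis N0 : (0 < N)%N.

Section RankOne.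
Variables (lam : G -> rat) (P : set G).
Hypothesis lamB : forall a b, lam (a - b) = lam a - lam b.
Hypothesis zP : subgroup_set P.
Let P0 : P 0. Proof. by case: zP. Qed.
Let PD : forall a b, P a -> P b -> P (a + b). Proof. by case: zP. Qed.

Lemma lam0 : lam 0 = 0. Proof. by rewrite -(subrr 0) lamB subrr. Qed.
Lemma lamN a : lam (- a) = - lam a. Proof. by rewrite -sub0r lamB lam0 sub0r. Qed.
Lemma lamD a b : lam (a + b) = lam a + lam b.
Proof. by rewrite -[in LHS](opprK b) lamB lamN opprK. Qed.
Lemma lamMz a (z : int) : lam (a *~ z) = z%:~R * lam a.
Proof.
have Mn n : lam (a *+ n) = n%:R * lam a.
  elim: n => [|n IH]; first by rewrite mulr0n lam0 mul0r.
  by rewrite mulrS lamD IH -[in RHS]natr1 mulrDl mul1r addrC.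
case: z => n; first exact: Mn.
by rewrite NegzE !mulrNz lamN mulNr; congr (- _); exact: Mn.
Qed.

(** Finitely generated subgroups of the rationals are cyclic. *)
Lemma rank_one_gen k (x : 'I_k -> G) : (forall i, P (x i)) ->
  exists2 g, P g & forall i, exists z : int, lam (x i) = z%:~R * lam g.
Proof.
elim: k x => [|k IH] x Px; first by exists 0; [exact: P0|case].
have [|g Pg hg] := IH (fun i => x (fintype.lift ord0 i)); first by move=> i; exact: Px.
have [s [t [a [b [ha hb]]]]] := rat_pair_gen (lam (x ord0)) (lam g).
have e : lam (x ord0 *~ s + g *~ t) = s%:~R * lam (x ord0) + t%:~R * lam g.
  by rewrite lamD !lamMz.
exists (x ord0 *~ s + g *~ t); first by apply: PD; exact: subgroup_setMz.
move=> i; rewrite e; have [j ->|->] := unliftP ord0 i; last by exists a.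
have [z ->] := hg j; exists (z * b).
by rewrite {1}hb rmorphM /= mulrA.
Qed.

(** Among N + 1 elements of a subgroup of the rationals two are congruent
modulo N times the subgroup: all are integer multiples of one element g of the
subgroup, and two of the multipliers agree modulo N. *)
Lemma rank_one_cover : exists r : seq G, (forall h, List.In h r -> P h) /\
  forall a, P a -> exists2 h, List.In h r & exists2 b, P b & lam (a - h) = N%:R * lam b.
Proof.
apply: (@finite_cover P (fun a h => exists2 b, P b & lam (a - h) = N%:R * lam b) N).
  move=> a b [c Pc h]; exists (- c); first by case: zP => _ _; apply.
  by rewrite lamN mulrN -h -lamN opprB.
move=> x Px; have [g Pg /choice [z hz]] := rank_one_gen Px.
pose col (i : 'I_N.+1) : 'I_N := Ordinal (ltn_pmod `|(z i %% N)%Z|%N N0).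
have /injectivePn [i [j ij cij]] : ~~ injectiveb col.
  by apply/injectiveP => /leq_card; rewrite !card_ord ltnn.
exists i, j; split=> //.
have e : (z i = z j %[mod N])%Z.
  have nz k : exists2 a : nat, (z k %% N)%Z = a & (a < N)%N.
    have ge0 : (0 <= (z k %% N)%Z) by rewrite modz_ge0 //; lia.
    exists `|(z k %% N)%Z|%N; first by rewrite gez0_abs.
    by rewrite -ltz_nat gez0_abs // ltz_pmod //; lia.
  move: (congr1 val cij) => /=.
  have [a -> aN] := nz i; have [b -> bN] := nz j.
  by rewrite !absz_nat !modn_small // => ->.
move/eqP: e; rewrite eqz_mod_dvd => /dvdzP [q hq].
exists (g *~ q); first exact: subgroup_setMz.
rewrite lamB !hz lamMz -mulrBl -rmorphB /= hq rmorphM /=; ring.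
Qed.
End RankOne.

(** Descend through the subgroups of the elements whose first m - k
coordinates vanish: the quotient of consecutive ones embeds in the rationals,
where rank_one_cover applies. *)
Lemma coords_cover m (lam : 'I_m -> G -> rat) :
  (forall i a b, lam i (a - b) = lam i a - lam i b) ->
  (forall a, (forall i, lam i a = 0) -> a = 0) ->
  exists r : seq G, forall a, exists2 h, List.In h r & exists b, a - h = b *+ N.
Proof.
move=> lamB inj.
pose P k : set G := [set a | forall i : 'I_m, (i < k)%N -> lam i a = 0].
have zP k : subgroup_set (P k).
  split=> [i _|a b Pa Pb i ik|a Pa i ik]; first by rewrite -(subrr 0) lamB subrr.
    by rewrite (lamD (lamB i)) Pa // Pb // addr0.
  by rewrite (lamN (lamB i)) Pa // oppr0.
suff: forall k, (k <= m)%N -> exists r : seq G, forall a, P (m - k)%N a ->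
    exists2 h, List.In h r & exists2 b, P (m - k)%N b & a - h = b *+ N.
  move=> /(_ m (leqnn m)); rewrite subnn => -[r hr]; exists r => a.
  by have [//|h hh [b _ e]] := hr a; exists h => //; exists b.
elim=> [_|k IH km].
  exists [:: 0] => a Pa; exists 0; first by left.
  exists 0; first by case: (zP (m - 0)%N).
  by rewrite mul0rn subr0; apply: inj => i; apply: Pa; rewrite subn0.
have [r hr] := IH (ltnW km).
have jm : (m - k.+1 < m)%N by lia.
have [r1 [r1P hr1]] := rank_one_cover (lamB (Ordinal jm)) (zP (m - k.+1)%N).
exists (List.map (fun p => p.1 + p.2) (List.list_prod r1 r)) => a Pa.
have [h hh [b Pb hb]] := hr1 a Pa.
have Ph := r1P _ hh.
have Pa' : P (m - k)%N (a - h - b *+ N).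
  have e : (m - k = (m - k.+1).+1)%N by lia.
  have PbN : P (m - k.+1)%N (b *+ N) := subgroup_setMz N (zP _) Pb.
  move=> i; rewrite e ltnS leq_eqVlt => /orP[/eqP ij|ij].
    have -> : i = Ordinal jm by apply: val_inj.
    rewrite lamB hb (lamMz (lamB (Ordinal jm)) b N) subrr //.
  rewrite !lamB Pa // Ph // PbN // !subrr //.
have [h' hh' [b' Pb' e]] := hr _ Pa'.
exists (h + h').
  by apply/List.in_map_iff; exists (h, h'); split=> //; exact: List.in_prod.
exists (b + b').
  have [_ PD _] := zP (m - k.+1)%N; apply: PD => // i ik; apply: Pb'; lia.
by rewrite mulrnDl -e [RHS]addrC [a - h - _ - h']addrAC subrK opprD addrA.
Qed.
End FiniteQuotient.

Section NumberRing.
Variable (L : fieldExtType rat).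
Local Notation O := (ring_of_integers L).

Lemma valB (a b : O) : val (a - b) = val a - val b :> L. Proof. by []. Qed.
Lemma val_natr n : val (n%:R : O) = n%:R :> L. Proof. exact: rmorph_nat. Qed.
Lemma natr_ext (n : nat) : (n%:R : L) = (n%:R : rat)%:A.
Proof. by rewrite scaler_nat. Qed.

Lemma ring_dom (a b : O) : a * b = 0 -> a = 0 \/ b = 0.
Proof.
move=> h; have /eqP : (val a * val b : L) = 0 by rewrite -(rmorphM (val : O -> L)) h rmorph0.
by rewrite mulf_eq0 => /orP[|] /eqP e; [left|right]; apply: val_inj; rewrite e rmorph0.
Qed.

Lemma ring_char0 n : n.+1%:R != 0 :> O.
Proof.
apply/eqP => h; have /eqP : n.+1%:R = 0 :> L by rewrite -val_natr h rmorph0.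
by rewrite natr_ext scaler_eq0 oner_eq0 orbF pnatr_eq0.
Qed.

Lemma ring_intr_eq0 (z : int) : z%:~R = 0 :> O -> z = 0.
Proof.
case: z => [[|n]|n] // /eqP; last first.
  by rewrite NegzE mulrNz oppr_eq0 (negbTE (ring_char0 n)).
by rewrite (negbTE (ring_char0 n)).
Qed.

Local Notation ev p c := (map_poly (intr : int -> O) p).[c].

Lemma ring_root (c : O) : exists2 p : {poly int}, p \is monic & ev p c = 0.
Proof.
have /asboolP [p pm /rootP pc] := integer_valP c; exists p => //.
apply: val_inj; rewrite rmorph0 -pc -(horner_map (val : O -> L)) -map_poly_comp.
by congr (_.[_]); apply: eq_map_poly => z; exact: (rmorph_int (val : O -> L)).
Qed.

(** The constant term of an integer polynomial vanishing at c, once the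
factors X are removed, is a nonzero integer divisible by c. *)
Lemma ring_dvd_int (c : O) : c != 0 -> exists2 N : nat, (0 < N)%N & multiples c (N%:R).
Proof.
move=> c0; have [p pm] := ring_root c; have := monic_neq0 pm.
suff : forall p : {poly int}, p != 0 -> ev p c = 0 ->
    exists2 N : nat, (0 < N)%N & multiples c (N%:R) by move=> h p0 /(h _ p0).
elim/poly_ind => {pm} [|q k IH]; first by rewrite eqxx.
rewrite rmorphD rmorphM /= map_polyX map_polyC /= !hornerE => qk e.
have [k0|kn0] := eqVneq k 0.
  move: qk e; rewrite k0 !addr0 => qX e.
  apply: IH; first by apply: contraNneq qX => ->; rewrite mul0r.
  by case: (ring_dom e) => // c'; rewrite c' eqxx in c0.
exists `|k|%N; first by rewrite absz_gt0.
have kc : multiples c (k%:~R).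
  by exists (- ev q c); rewrite mulrN mulrC; apply/eqP; rewrite -addr_eq0 addrC e.
have [D0 DD DN] := multiples_subgroup c.
case: k kc {e qk kn0} => k //=.
by rewrite NegzE mulrNz => /DN; rewrite opprK.
Qed.

(** If 2 a = 1 and p(a) = 0 with p monic of degree n, then 2^n p(a) = 0 is
1 plus an even integer. *)
Lemma no_half (a : O) : 2%:R * a != 1.
Proof.
apply/eqP => a2; have [p pm pa] := ring_root a.
have sz : size (map_poly (intr : int -> O) p) = size p.
  apply: size_map_poly_id0; rewrite (monicP pm).
  by rewrite oner_neq0.
have : exists t : int, (1 + 2 * t)%:~R = 0 :> O.
  case sp : (size p) => [|n]; first by move/eqP: sp (monic_neq0 pm) => /=; rewrite size_poly_eq0 => ->.
  have : 2%:R ^+ n * ev p a = 0 by rewrite pa mulr0.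
  rewrite horner_coef sz sp mulr_sumr big_ord_recr /=.
  rewrite coef_map /= -[n in p`_n]/(n.+1.-1) -sp -lead_coefE (monicP pm) mul1r.
  rewrite -exprMn a2 expr1n addrC => e.
  exists (\sum_(i < n) p`_i * 2 ^+ (n - i.+1)); rewrite rmorphD /= -{}[RHS]e; congr (_ + _).
  rewrite rmorphM rmorph_sum /= mulr_sumr; apply: eq_bigr => i _.
  rewrite coef_map /= rmorphM rmorphXn /=.
  have -> : 2%:R ^+ n = 2%:R ^+ (n - i.+1) * 2%:R * 2%:R ^+ i :> O.
    by rewrite -exprSr -exprD; congr (_ ^+ _); have := ltn_ord i; lia.
  have -> : 2%:R ^+ (n - i.+1) * 2%:R * 2%:R ^+ i * ((p`_i)%:~R * a ^+ i) =
     2%:R ^+ (n - i.+1) * 2%:R * (p`_i)%:~R * (2%:R * a) ^+ i by rewrite exprMn; ring.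
  rewrite a2 expr1n mulr1; ring.
by move=> [t /ring_intr_eq0]; lia.
Qed.

Lemma ring_cover (c : O) : c != 0 ->
  exists r : seq O, forall g, exists2 h, List.In h r & multiples c (g - h).
Proof.
move=> /ring_dvd_int [N N0 [d hd]].
pose lam i (a : O) : rat := coord (vbasis {:L}) i (val a).
have [|a h|r hr] := @coords_cover O N N0 _ lam.
- by move=> i a b; rewrite /lam valB raddfB.
- apply: val_inj; rewrite rmorph0 (coord_vbasis (memvf (val a))) big1 // => i _.
  by rewrite -/(lam i a) h scale0r.
exists r => g; have [h hh [b e]] := hr g; exists h => //.
by exists (d * b); rewrite mulrA -hd e mulr_natl.
Qed.

Lemma countable_enum (T : Type) (C : countType) (f : T -> C) (t0 : T) : injective f ->
  exists e : nat -> T, forall t, exists k, e k = t.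
Proof.
move=> fi; have /choice [g hg] : forall k, exists t, forall t', choice.unpickle k = Some (f t') -> t = t'.
  move=> k; have [[t ht]|n] := pselect (exists t, choice.unpickle k = Some (f t)).
    by exists t => t'; rewrite ht => -[/fi].
  by exists t0 => t' h; case: n; exists t'.
by exists g => t; exists (choice.pickle (f t)); apply: hg; rewrite choice.pickleK.
Qed.

Lemma ring_point_enum n : exists e : nat -> {ffun 'I_n -> O}, forall t, exists k, e k = t.
Proof.
pose f (u : {ffun 'I_n -> O}) : {ffun 'I_n -> {ffun 'I_(\dim {:L}) -> rat}} :=
  [ffun i => [ffun j => coord (vbasis {:L}) j (val (u i))]].
apply: (@countable_enum _ _ f [ffun=> 0]) => u v /ffunP e.
apply/ffunP => i; have := e i; rewrite !ffunE => /ffunP ei.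
apply: val_inj; rewrite (coord_vbasis (memvf (val (u i)))).
rewrite [RHS](coord_vbasis (memvf (val (v i)))); apply: eq_bigr => j _.
by have := ei j; rewrite !ffunE => ->.
Qed.

End NumberRing.

(** * Folner sequences and sets of density zero *)
Lemma bernoulli_ineq (R : realType) (x : R) j : 0 <= x -> 1 + j%:R * x <= (1 + x) ^+ j.
Proof.
move=> x0; elim: j => [|j IH]; first by rewrite expr0 mul0r addr0.
rewrite exprS; apply: le_trans (ler_wpM2l (_ : 0 <= 1 + x) IH); last by lra.
rewrite -natr1; have : 0 <= j%:R * x * x by rewrite !mulr_ge0.
by rewrite !mulrDl !mulrDr; lra.
Qed.

(** Otherwise b K >= (1 + 1/m)^K for all K, against the polynomial bound. *)
Lemma poly_growth (R : realType) (N m : nat) (b : nat -> R) : (0 < m)%N ->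
  1 <= b 0%N -> (forall K, b K <= K.+1%:R ^+ N) ->
  exists K, b K.+1 <= (1 + m%:R^-1) * b K.
Proof.
move=> m0 b0 bK; apply: contrapT => /forallNP no.
have mp : 0 < m%:R :> R by rewrite ltr0n.
have y1 : 1 <= 1 + m%:R^-1 :> R by rewrite lerDl invr_ge0 ltW.
have g K : (1 + m%:R^-1) ^+ K <= b K.
  elim: K => [|K IH]; first by rewrite expr0.
  have /negP := no K; rewrite -ltNge => /ltW; apply: le_trans.
  by rewrite exprS ler_pM2l //; lra.
case: N bK => [|N] bK.
  have := le_trans (g 1%N) (bK 1%N); rewrite expr1 expr0.
  have : 0 < m%:R^-1 :> R by rewrite invr_gt0.
  by lra.
(* At K = 2 j (N + 1) it suffices that (1 + 1/m)^(2 j) > K + 1, and by Bernoulli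
   the left side is at least (1 + j/m)^2, where j > 2 (N + 1) m^2. *)
pose j := (2 * N.+1 * m * m).+1.
have := le_trans (g (2 * j * N.+1)%N) (bK (2 * j * N.+1)%N).
rewrite exprM ler_pXn2r // ?nnegrE ?ler0n //.
rewrite leNgt => /negP; apply.
rewrite [X in _ ^+ X]mulnC exprM; apply: (@lt_le_trans _ _ ((1 + j%:R * m%:R^-1) ^+ 2)).
  have jE : j%:R = 2 * N.+1%:R * m%:R * m%:R + 1 :> R by rewrite /j -natr1 !natrM.
  rewrite -natr1 !natrM sqrrD expr1n.
  have jm : 2 * j%:R * N.+1%:R < (j%:R * m%:R^-1) ^+ 2 :> R.
    rewrite exprMn exprVn ltr_pdivlMr ?exprn_gt0 //.
    have j0 : 0 < j%:R :> R by [].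
    have -> : 2 * j%:R * N.+1%:R * m%:R ^+ 2 = j%:R * (2 * N.+1%:R * m%:R * m%:R) :> R.
      by move: (j%:R : R) (N.+1%:R : R) (m%:R : R) => *; ring.
    by rewrite expr2 ltr_pM2l // jE ltrDl.
  have : 0 <= j%:R * m%:R^-1 :> R by rewrite mulr_ge0 // invr_ge0 ltW.
  by move: jm; rewrite mul1r mulr2n; lra.
have jm0 : 0 <= 1 + j%:R * m%:R^-1 :> R.
  by rewrite addr_ge0 // mulr_ge0 // invr_ge0 ltW.
have h : 1 + j%:R * m%:R^-1 <= (1 + m%:R^-1) ^+ j :> R.
  by apply: bernoulli_ineq; rewrite invr_ge0 ltW.
by apply: lerXn2r => //; rewrite nnegrE // (le_trans jm0).
Qed.

Lemma sum_cst_count (R : nmodType) (T : Type) (r : seq T) (P : pred T) (c : R) :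
  \sum_(i <- r | P i) c = c *+ count P r.
Proof. by rewrite big_const_seq iter_addr_0. Qed.

Section Folner.
Variables (R : realType) (G : zmodType).
Local Open Scope fset_scope.

Definition fset_shift (Phi : {fset G}) g : {fset G} := [fset (g + x)%R | x in Phi].

Lemma card_fset_shift Phi g : #|` fset_shift Phi g| = #|` Phi|.
Proof. by rewrite card_imfset //= => x y; exact: addrI. Qed.

Definition box (e : nat -> G) N K : {fset G} :=
  [fset x in [seq (\sum_i e (val i) *+ val ((n : {ffun 'I_N -> 'I_K.+1}) i))%R |
              n <- enum {: {ffun 'I_N -> 'I_K.+1}}]].

Lemma boxP e N K g : reflect (exists n : {ffun 'I_N -> 'I_K.+1},
  g = (\sum_i e (val i) *+ val (n i))%R) (g \in box e N K).
Proof.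
rewrite /box inE; apply: (iffP mapP) => [[n _ ->]|[n ->]]; first by exists n.
by exists n => //; rewrite mem_enum.
Qed.

Lemma box_card e N K : (#|` box e N K| <= K.+1 ^ N)%N.
Proof.
rewrite /box card_fseq (leq_trans (size_undup _)) // size_map -cardE.
by rewrite card_ffun !card_ord.
Qed.

Lemma box_sub e N K g : g \in box e N K -> g \in box e N K.+1.
Proof.
move=> /boxP[n ->]; apply/boxP; exists [ffun i => widen_ord (leqnSn _) (n i)].
by apply: eq_bigr => i _; rewrite ffunE.
Qed.

Lemma box_shift e N K (i : 'I_N) g : g \in box e N K -> (e i + g)%R \in box e N K.+1.
Proof.
move=> /boxP[n ->]; apply/boxP.
pose n' := [ffun j => if j == i then fintype.lift ord0 (n j) else widen_ord (leqnSn _) (n j)].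
exists n'.
rewrite (bigD1 i) //= [RHS](bigD1 i) //= addrA ffunE eqxx -mulrS; congr (_ + _)%R.
by apply: eq_bigr => j /negbTE ji; rewrite ffunE ji.
Qed.

Lemma box_neq0 e N K : box e N K != fset0.
Proof.
apply/fset0Pn; exists (\sum_(i < N) e (val i) *+ val (ord0 : 'I_K.+1))%R.
by apply/boxP; exists [ffun=> ord0]; apply: eq_bigr => i _; rewrite ffunE.
Qed.

(** Translation by e i maps a box into the next one, so the boxes are almost
invariant at a scale K where they do not grow much.  The elements e i may
satisfy relations: only the cardinality of the boxes is estimated. *)
Lemma box_folner e N m : (0 < m)%N -> exists2 Phi : {fset G}, Phi != fset0 &
  forall i, (i < N)%N ->
    (1 - m%:R^-1 <= #|` fset_shift Phi (e i) `&` Phi|%:R / #|` Phi|%:R :> R)%R.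
Proof.
move=> m0.
have [|K|K hK] := @poly_growth R N m (fun K => #|` box e N K|%:R)%R m0.
- by rewrite ler1n cardfs_gt0 box_neq0.
- by rewrite -natrX ler_nat box_card.
exists (box e N K) => [|i iN]; first exact: box_neq0.
set B := box e N K; set S := fset_shift B (e i).
have B0 : (0 < #|` B|%:R :> R)%R by rewrite ltr0n cardfs_gt0 box_neq0.
have U : (#|` S `|` B| <= #|` box e N K.+1|)%N.
  apply: fsubset_leq_card; apply/fsubsetP => g; rewrite in_fsetU => /orP[|/box_sub //].
  by move=> /imfsetP[h /= hB ->]; exact: (box_shift (Ordinal iN) hB).
have c : (#|` S| + #|` B| = #|` S `|` B| + #|` S `&` B|)%N by rewrite cardfsUI.
rewrite ler_pdivlMr //.
have h1 : (#|` B|%:R + #|` B|%:R <= #|` box e N K.+1|%:R + #|` S `&` B|%:R :> R)%R.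
  rewrite -!natrD ler_nat -{1}(card_fset_shift B (e i)) c leq_add2r //.
by move: hK h1; rewrite -/B !mulrDl !mul1r mulNr; lra.
Qed.

Lemma folner_exists (e : nat -> G) : (forall g, exists k, e k = g) ->
  exists Phi : nat -> {fset G}, folner R Phi.
Proof.
move=> es.
have /choice [Phi hPhi] (N : nat) : exists Phi : {fset G}, Phi != fset0 /\
  forall i, (i < N)%N ->
    (1 - N.+1%:R^-1 <= #|` fset_shift Phi (e i) `&` Phi|%:R / #|` Phi|%:R :> R)%R.
  by have [P P0 hP] := @box_folner e N N.+1 (ltn0Sn N); exists P.
exists Phi; split=> [N|g]; first exact: (hPhi N).1.
have [k <-] := es g.
apply/cvg_real_epsN => d d0; have [N1 h1] := harmonic_lt d0.
exists (maxn N1 k.+1) => N; rewrite geq_max => /andP[N1N kN].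
have [P0 hP] := hPhi N; have := hP k kN; have := h1 N N1N.
rewrite -/(fset_shift (Phi N) (e k)).
have le1 : (#|` fset_shift (Phi N) (e k) `&` Phi N|%:R / #|` Phi N|%:R <= 1 :> R)%R.
  have p : (0 < #|` Phi N|%:R :> R)%R by rewrite ltr0n cardfs_gt0.
  by rewrite ler_pdivrMr // mul1r ler_nat fsubset_leq_card // fsubsetIr.
rewrite distrC ger0_norm ?subr_ge0 //.
by move: le1; set r := (_ / _)%R; set y := (_^-1)%R; lra.
Qed.

Definition fset_avg (Phi : {fset G}) (F : G -> R) : R :=
  ((\sum_(u <- Phi) F u) / #|` Phi|%:R)%R.

Local Open Scope ring_scope.

Lemma fset_avg_shift (Phi : {fset G}) (F : G -> R) g C : Phi != fset0 ->
  (forall u, 0 <= F u <= C) ->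
  fset_avg Phi F <= fset_avg Phi (fun u => F (g + u)) +
    C * (1 - #|` (fset_shift Phi g `&` Phi)%fset|%:R / #|` Phi|%:R).
Proof.
move=> P0 FC.
have p : (0 < #|` Phi|%:R :> R) by rewrite ltr0n cardfs_gt0.
have e : \sum_(u <- Phi) F (g + u) = \sum_(v <- fset_shift Phi g) F v.
  by rewrite big_imfset //= => x y _ _; exact: addrI.
rewrite /fset_avg e -[X in C * (X - _)](divff (lt0r_neq0 p)) -mulrBl mulrA -mulrDl.
rewrite ler_pM2r ?invr_gt0 //.
set Psi := fset_shift Phi g.
have fp (P Q : {fset G}) : perm_eq [seq u <- P | u \in Q] (Q `&` P)%fset.
  apply: uniq_perm; rewrite ?filter_uniq ?fset_uniq // => u.
  by rewrite mem_filter in_fsetI.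
rewrite (bigID (mem Psi)) /=; apply: lerD.
  rewrite -big_filter (perm_big _ (fp Phi Psi)) /= fsetIC.
  rewrite -(perm_big _ (fp Psi Phi)) big_filter [leRHS](bigID (mem Phi)) /= lerDl.
  by apply: sumr_ge0 => u _; have /andP[] := FC u.
have -> : #|` Phi|%:R - #|` (Psi `&` Phi)%fset|%:R =
    (count [predC (mem Psi)] Phi)%:R :> R.
  rewrite -(perm_size (fp Phi Psi)) size_filter -(count_predC (mem Psi) Phi) natrD.
  by rewrite addrC addKr.
rewrite mulr_natr -sum_cst_count.
apply: ler_sum => u _; by have /andP[] := FC u.
Qed.

Lemma fset_avg_le (Phi : {fset G}) (F : G -> R) a : Phi != fset0 -> (forall u, F u <= a) ->
  fset_avg Phi F <= a.
Proof.
move=> P0 Fa; have p : (0 < #|` Phi|%:R :> R) by rewrite ltr0n cardfs_gt0.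
rewrite /fset_avg ler_pdivrMr // mulr_natr -[in leRHS](count_predT Phi) -sum_cst_count.
exact: ler_sum.
Qed.

Lemma fset_avg_wavg (Phi : {fset G}) (T : Type) (S : seq (R * T)) (F : T -> G -> R) :
  wavg S (fun t => fset_avg Phi (F t)) = fset_avg Phi (fun u => wavg S (fun t => F t u)).
Proof.
rewrite /wavg /fset_avg exchange_big mulr_suml; apply: eq_bigr => q _.
by rewrite mulrA mulr_sumr.
Qed.

(** By fset_avg_shift the average of F over Phi N exceeds that of a translate
of F at most by C times the proportion of Phi N that the translation moves out
of Phi N, which tends to 0; only finitely many translates occur in S. *)
Lemma folner_avg (Phi : nat -> {fset G}) (F : G -> R) C (T : Type) (S : seq (R * T))
    (s : T -> G) eta : folner R Phi -> (forall u, 0 <= F u <= C) -> is_weight S ->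
  (forall u, wavg S (fun t => F (s t + u)) <= eta) ->
  forall d, 0 < d -> exists N0, forall N, (N0 <= N)%N -> fset_avg (Phi N) F <= eta + d.
Proof.
move=> [P0 fP] FC pS hS d d0.
have C0 : 0 <= C by have /andP[] := FC 0; exact: le_trans.
have C1 : 0 < C + 1 by lra.
pose ratio N t : R := #|` (fset_shift (Phi N) (s t) `&` Phi N)%fset|%:R / #|` Phi N|%:R.
have [N0 hN0] : exists N0, forall N, (N0 <= N)%N -> wavg S (fun t => C * (1 - ratio N t)) <= d.
  have d1 : 0 < d / (C + 1) by rewrite divr_gt0.
  have [N0 h] : exists N0, forall N, (N0 <= N)%N -> forall p, List.In p S ->
      1 - ratio N p.2 <= d / (C + 1).
    elim: S {pS hS} => [|p S [N1 h1]]; first by exists 0%N.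
    have /cvg_real_epsN /(_ _ d1) [N2 h2] := fP (s p.2).
    exists (maxn N1 N2) => N; rewrite geq_max => /andP[n1 n2] q [<-|]; last exact: h1.
    have := h2 N n2; rewrite distrC => /ltW; apply: le_trans; exact: ler_norm.
  exists N0 => N /h hN; rewrite wavgZ.
  have : wavg S (fun t => 1 - ratio N t) <= d / (C + 1).
    rewrite -[leRHS](wavg_cst _ pS); have := pS.1.
    elim: S hN {pS hS h} => [|p S IH] hN; first by rewrite /wavg !big_nil.
    move=> /andP[p0 S0]; rewrite /wavg !big_cons; apply: lerD.
      by apply: ler_wpM2l => //; apply: (hN); left.
    by apply: IH => // q hq; apply: (hN); right.
  move=> /(ler_wpM2l C0) h'; rewrite (le_trans h') // mulrCA ler_piMr ?(ltW d0) //.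
  by rewrite ler_pdivrMr // mul1r lerDl.
exists N0 => N /hN0 hN.
have h1 : fset_avg (Phi N) F <= wavg S (fun t => fset_avg (Phi N) (fun u => F (s t + u)) + C * (1 - ratio N t)).
  by rewrite -[leLHS](wavg_cst _ pS); apply: wavg_le => // t; exact: fset_avg_shift.
rewrite (le_trans h1) // wavgD; apply: lerD => //.
by rewrite fset_avg_wavg; apply: fset_avg_le.
Qed.

Lemma markov_avg (Phi : {fset G}) (F : G -> R) (S : set G) d : Phi != fset0 -> 0 < d ->
  (forall u, 0 <= F u) -> (forall u, S u -> d <= F u) ->
  #|` [fset x in Phi | `[< S x >]]%fset|%:R / #|` Phi|%:R <= fset_avg Phi F / d.
Proof.
move=> P0 d0 F0 SF; have p : (0 < #|` Phi|%:R :> R) by rewrite ltr0n cardfs_gt0.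
rewrite /fset_avg mulrAC ler_pM2r ?invr_gt0 // ler_pdivlMr //.
have pe : perm_eq [seq u <- Phi | `[< S u >]] [fset x in Phi | `[< S x >]]%fset.
  apply: uniq_perm; rewrite ?filter_uniq ?fset_uniq // => u.
  by rewrite mem_filter !inE andbC.
rewrite -(perm_size pe) size_filter mulrC mulr_natr -sum_cst_count.
rewrite big_mkcond; apply: ler_sum => u _.
by case: asboolP => // /SF.
Qed.

(** Markov's inequality bounds the density of Z by the averages of F divided
by d, and folner_avg makes these small along every Folner sequence.  A Folner
sequence has to be exhibited, as otherwise the supremum defining the density
would be that of the empty set. *)
Lemma zero_density (e : nat -> G) (F : G -> R) (Z : set G) C d : (forall g, exists k, e k = g) ->
  (forall u, 0 <= F u <= C) -> 0 < d ->
  (forall eta, 0 < eta -> exists (T : Type) (S : seq (R * T)) (s : T -> G),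
     is_weight S /\ forall u, wavg S (fun t => F (s t + u)) <= eta) ->
  (forall u, Z u -> d <= F u) -> upper_banach_density R Z = 0%E.
Proof.
move=> es FC d0 hF ZF.
have along Phi : folner R Phi -> upper_density_along R Phi Z = 0%E.
  move=> fP; rewrite /upper_density_along.
  set a := fun N => _.
  suff : a @ \oo --> (0%:E)%E.
    by move=> /cvg_limn_einf_sup [_ ->].
  apply: cvg_EFin.
    by apply: nearW.
  apply/cvg_real_epsN => eps eps0.
  pose eta := eps * d / 3; have eta0 : 0 < eta by rewrite divr_gt0 // mulr_gt0.
  have [T [S [s [pS hS]]]] := hF eta eta0.
  have [N0 hN0] := folner_avg fP FC pS hS eta0.
  exists N0 => N /hN0 h; rewrite /a /= subr0 ger0_norm ?divr_ge0 //.
  apply: (le_lt_trans (markov_avg (fP.1 N) d0 _ ZF)); first by move=> u; have /andP[] := FC u.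
  rewrite ltr_pdivrMr // (le_lt_trans h) // /eta; have : 0 < eps * d by rewrite mulr_gt0.
  lra.
have [Phi fP] := folner_exists es.
rewrite /upper_banach_density; apply/eqP; rewrite eq_le; apply/andP; split.
  by apply: ge_ereal_sup => _ [Psi fPsi <-]; rewrite along.
by apply: ereal_sup_ubound; exists Phi => //; exact: along.
Qed.
End Folner.

(** * Correlations are positive definite *)
Section BoundedFunctions.
Variables (R : realType) (dX : measure_display) (X : measurableType dX).
Variable mu : probability X R.
Implicit Types f g : X -> R.

(** Bounded measurable functions: closed under products and integrable, which
makes all integrals below linear without further conditions. *)
Definition bmeas f := measurable_fun [set: X] f /\ exists M, forall x, `|f x| <= M.

Lemma bmeas_cst a : bmeas (fun=> a).
Proof. by split; [exact: measurable_cst|exists `|a|]. Qed.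
Lemma bmeasD f g : bmeas f -> bmeas g -> bmeas (fun x => f x + g x).
Proof.
move=> [mf [M hM]] [mg [N hN]]; split; first exact: measurable_funD.
by exists (M + N) => x; rewrite (le_trans (ler_normD _ _)) // lerD.
Qed.
Lemma bmeasM f g : bmeas f -> bmeas g -> bmeas (fun x => f x * g x).
Proof.
move=> [mf [M hM]] [mg [N hN]]; split; first exact: measurable_funM.
by exists (M * N) => x; rewrite normrM ler_pM.
Qed.
Lemma bmeas_indic A : measurable A -> bmeas (fun x => \1_A x).
Proof.
move=> mA; split; first exact: measurable_indic.
by exists 1 => x; rewrite indicE; case: (_ \in _); rewrite ?normr1 ?normr0.
Qed.
Lemma bmeas_sum (I : Type) (r : seq I) (F : I -> X -> R) : (forall i, bmeas (F i)) ->
  bmeas (fun x => \sum_(i <- r) F i x).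
Proof.
move=> h; elim: r => [|i r IH].
  by rewrite (_ : (fun _ => _) = fun=> 0); [exact: bmeas_cst|apply/funext => x; rewrite big_nil].
rewrite (_ : (fun _ => _) = fun x => F i x + \sum_(i <- r) F i x); first exact: bmeasD.
by apply/funext => x; rewrite big_cons.
Qed.
Lemma bmeas_integrable f : bmeas f -> mu.-integrable [set: X] (EFin \o f).
Proof.
move=> [mf [M hM]]; apply: measurable_bounded_integrable => //.
  exact: le_lt_trans (probability_le1 mu measurableT) (ltry 1).
by exists M; split; rewrite ?num_real // => y My x _ /=; rewrite (le_trans (hM x)) // ltW.
Qed.

Definition mu_mean f : R := Rintegral mu [set: X] f.
Lemma mu_meanD f g : bmeas f -> bmeas g -> mu_mean (fun x => f x + g x) = mu_mean f + mu_mean g.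
Proof. by move=> /bmeas_integrable hf /bmeas_integrable hg; exact: RintegralD. Qed.
Lemma mu_meanZ a f : bmeas f -> mu_mean (fun x => a * f x) = a * mu_mean f.
Proof. by move=> /bmeas_integrable hf; exact: RintegralZl. Qed.
Lemma mu_mean_cst a : mu_mean (fun=> a) = a.
Proof. rewrite /mu_mean Rintegral_cst //. by rewrite [X in fine X](probability_setT mu) /= mulr1. Qed.
Lemma mu_mean_indic A : measurable A -> mu_mean (fun x => \1_A x) = fine (mu A).
Proof. by move=> mA; rewrite /mu_mean /Rintegral integral_indic // setIT. Qed.
Lemma mu_mean_sum (I : Type) (r : seq I) (F : I -> X -> R) : (forall i, bmeas (F i)) ->
  mu_mean (fun x => \sum_(i <- r) F i x) = \sum_(i <- r) mu_mean (F i).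
Proof.
move=> h; elim: r => [|i r IH].
  rewrite big_nil -[RHS](mu_mean_cst 0); congr mu_mean.
  by apply/funext => x; rewrite big_nil.
rewrite big_cons -IH -mu_meanD //; last exact: bmeas_sum.
by congr mu_mean; apply/funext => x; rewrite big_cons.
Qed.

Lemma indic_cov A B a : measurable A -> measurable B ->
  fine (mu A) = a -> fine (mu B) = a ->
  mu_mean (fun x => (\1_A x - a) * (\1_B x - a)) = fine (mu (A `&` B)) - a ^+ 2.
Proof.
move=> mA mB ea eb.
have -> : (fun x => (\1_A x - a) * (\1_B x - a)) =
   (fun x => \1_(A `&` B) x + ((- a) * \1_A x + ((- a) * \1_B x + a ^+ 2))).
  apply/funext => x; rewrite indicI /=; ring.
have bA := bmeas_indic mA; have bB := bmeas_indic mB.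
have b1 : bmeas (fun x => - a * \1_A x) by exact: bmeasM (bmeas_cst _) bA.
have b2 : bmeas (fun x => - a * \1_B x) by exact: bmeasM (bmeas_cst _) bB.
have b3 := bmeasD b2 (bmeas_cst (a ^+ 2)).
rewrite mu_meanD //; last 2 first.
- by apply: bmeas_indic; exact: measurableI.
- exact: bmeasD.
rewrite mu_meanD // mu_meanD //; last exact: bmeas_cst.
rewrite (mu_meanZ _ bA) (mu_meanZ _ bB) mu_mean_cst !mu_mean_indic ?ea ?eb //; first by ring.
exact: measurableI.
Qed.
End BoundedFunctions.

Section MeasurePD.
Variables (R : realType) (G : zmodType) (dX : measure_display) (X : measurableType dX).
Variables (mu : probability X R) (T : G -> X -> X) (B : set X).
Hypothesis hT : measure_preserving_action mu T.
Hypothesis mB : measurable B.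

Lemma act_imageE g : T g @` B = T (- g) @^-1` B.
Proof.
have [T0 TD _ _] := hT; apply/seteqP; split=> [_ [x Bx <-]|x Bx] /=.
  by rewrite -TD addNr T0.
by exists (T (- g) x) => //; rewrite -TD subrr T0.
Qed.

Lemma measurable_act g A : measurable A -> measurable (T g @^-1` A).
Proof.
by move=> mA; have [_ _ mT _] := hT; rewrite -[_ @^-1` _]setTI; exact: mT.
Qed.

(** The double sum of the values at x i - x j is the integral of the square
of the combination of the functions 1_{T^(x i) B} - mu(B). *)
Lemma correlation_posdef : posdef (fun g => fine (mu (B `&` T g @` B)) - fine (mu B) ^+ 2).
Proof.
have [T0 TD mT muT] := hT.
have mBg g : measurable (T g @` B) by rewrite act_imageE; exact: measurable_act.
have muBg g : mu (T g @` B) = mu B by rewrite act_imageE muT.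
have pre g h : T g @^-1` (T h @` B) = T (h - g) @` B.
  rewrite !act_imageE opprB; apply/seteqP; split=> x /=; by rewrite -TD addrC.
have two g h : mu (T g @` B `&` T h @` B) = mu (B `&` T (g - h) @` B).
  rewrite -(muT h); last exact: measurableI.
  by rewrite preimage_setI !pre subrr setIC [T 0 @` B]act_imageE oppr0 (_ : T 0 @^-1` B = B) //;
    apply/seteqP; split=> x /=; rewrite T0.
have even g : mu (B `&` T (- g) @` B) = mu (B `&` T g @` B).
  have B0 : B = T 0 @` B.
    by rewrite act_imageE oppr0; apply/seteqP; split=> x /=; rewrite T0.
  by have := two 0 g; rewrite -B0 sub0r => ->.
split=> [g|n c x]; first by rewrite even.
set a := fine (mu B).
pose f i y := \1_(T (x i) @` B) y - a : R.
have bf i : bmeas (f i) by apply: bmeasD; [exact: bmeas_indic|exact: bmeas_cst].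
have <- : mu_mean mu (fun y => (\sum_i c i * f i y) ^+ 2) =
   \sum_i \sum_j c i * c j * (fine (mu (B `&` T (x i - x j) @` B)) - a ^+ 2).
  transitivity (mu_mean mu (fun y => \sum_i \sum_j c i * c j * (f i y * f j y))).
    congr mu_mean; apply/funext => y; rewrite expr2 mulr_suml; apply: eq_bigr => i _.
    by rewrite mulr_sumr; apply: eq_bigr => j _; ring.
  have bff i j : bmeas (fun y => c i * c j * (f i y * f j y)).
    by apply: bmeasM; [exact: bmeas_cst|exact: bmeasM].
  rewrite mu_mean_sum => [|i]; last exact: bmeas_sum.
  apply: eq_bigr => i _; rewrite mu_mean_sum //; apply: eq_bigr => j _.
  rewrite mu_meanZ; last exact: bmeasM.
  by rewrite /f indic_cov ?muBg // two.
by apply: Rintegral_ge0 => y _; exact: sqr_ge0.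
Qed.
End MeasurePD.

(** * Returns of positive definite functions *)
Lemma In_mem (T : eqType) (x : T) (s : seq T) : List.In x s -> x \in s.
Proof. by elim: s => //= y s IH [->|/IH h]; rewrite inE ?eqxx // h orbT. Qed.

Section MulPred.
Variables (A : comNzRingType) (c : A).
Definition multiples_pred : {pred A} := fun x => `[< multiples c x >].
Lemma multiples_pred_zmod : zmod_closed multiples_pred.
Proof.
have [D0 DD DN] := multiples_subgroup c.
split; first exact/asboolP.
by move=> x y /asboolP hx /asboolP hy; apply/asboolP; apply: DD => //; exact: DN.
Qed.
HB.instance Definition _ := GRing.isZmodClosed.Build A multiples_pred multiples_pred_zmod.

Lemma multiples_finite_index (r : seq A) :
  (forall g, exists2 h, List.In h r & multiples c (g - h)) -> finite_index [set` multiples_pred].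
Proof.
move=> hr; pose cos g := [set g + h | h in [set` multiples_pred]].
apply: (@sub_finite_set _ _ [set cos g | g in [set` r]]); last exact: finite_image.
move=> _ [g _ <-]; have [h /In_mem hin [b hb]] := hr g; exists h => //.
have eg : g = h + c * b by rewrite -hb addrC subrK.
have [D0 DD DN] := multiples_subgroup c.
apply/seteqP; split=> _ [k /= /asboolP kc <-].
  exists (k - c * b); last by rewrite eg -addrA [c * b + _]addrC subrK.
  by apply/asboolP/DD => //; apply: DN; exists b.
exists (c * b + k); last by rewrite eg addrA.
by apply/asboolP/DD => //; exists b.
Qed.
End MulPred.

Lemma intersective_multiples (A : comNzRingType) n (p : mpoly.mpoly n A) (c : A) (r : seq A) :
  intersective p -> (forall g, exists2 h, List.In h r & multiples c (g - h)) ->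
  exists u : {ffun 'I_n -> A}, multiples c (mpoly.meval u p).
Proof.
move=> ip /multiples_finite_index fi.
have [u hu] := ip (multiples_pred c : zmodClosed A) fi.
by exists u; apply/asboolP.
Qed.

(** Coordinates and constants are polynomial maps, and polynomial maps are
closed under products and sums. *)
Lemma sparse_eval_polyfun (A : comNzRingType) n (l : seq (A * {ffun 'I_n -> nat})) (z : {ffun 'I_n -> A}) :
  exists D, polyfun D (fun u : {ffun 'I_n -> A} => sparse_eval l (z + u)).
Proof.
have coordP i : polyfun 2 (fun u : {ffun 'I_n -> A} => (z + u) i).
  by move=> y y' x /=; rewrite !ffunE; ring.
have expP i m : exists D, polyfun D (fun u : {ffun 'I_n -> A} => (z + u) i ^+ m).
  elim: m => [|m [D IH]]; first by exists 1%N; exact: polyfun_cst.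
  exists (2 + D)%N; apply: polyfun_ext (polyfunM (coordP i) IH) => u.
  by rewrite exprS.
have prodP (m : {ffun 'I_n -> nat}) (r : seq 'I_n) : exists D,
    polyfun D (fun u : {ffun 'I_n -> A} => \prod_(i <- r) (z + u) i ^+ m i).
  elim: r => [|i r [D IH]].
    by exists 1%N; apply: polyfun_ext (@polyfun_cst {ffun 'I_n -> A} A 1) => u; rewrite big_nil.
  have [D' h] := expP i (m i).
  exists (D' + D)%N; apply: polyfun_ext (polyfunM h IH) => u.
  by rewrite big_cons.
elim: l => [|q l [D IH]].
  by exists 0%N => u; rewrite /sparse_eval big_nil.
have [D' h] := prodP q.2 (index_enum 'I_n).
have h2 := polyfunM (@polyfun_cst {ffun 'I_n -> A} A q.1) h.
exists (maxn (1 + D') D); apply: polyfun_ext (polyfunD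
  (polyfun_le (leq_maxl _ _) h2) (polyfun_le (leq_maxr _ _) IH)) => u.
by rewrite /sparse_eval big_cons.
Qed.

Section Core.
Variables (R : realType) (A : comNzRingType) (n : nat).
Hypothesis dom : forall a b : A, a * b = 0 -> a = 0 \/ b = 0.
Hypothesis char0 : forall n, n.+1%:R != 0 :> A.
Hypothesis nohalf : forall a : A, 2%:R * a != 1.
Hypothesis cover : forall c : A, c != 0 ->
  exists r : seq A, forall g, exists2 h, List.In h r & multiples c (g - h).
Local Notation pt := {ffun 'I_n -> A}.
Variable enumpt : nat -> pt.
Hypothesis enumptP : forall u, exists k, enumpt k = u.

Variable l : seq (A * {ffun 'I_n -> nat}).
Hypothesis lu : uniq (map snd l).
Hypothesis ln0 : forall q, q \in l -> q.1 != 0.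
Hypothesis lint : forall c : A, c != 0 -> exists u : pt, multiples c (sparse_eval l u).

Variable phi : A -> R.
Hypothesis pphi : posdef phi.

Lemma AIP_star_plusT : AIP_star_plus R [set: pt].
Proof.
exists 0, setT; split; last by apply/seteqP; split=> // x _; exists x; rewrite ?add0r.
exists setT, set0; split; last by rewrite setD0.
  move=> I [x hx]; exists (x 0%N); split=> //; apply: hx; exists [fset 0%N]%fset.
    by apply/fset0Pn; exists 0%N; rewrite in_fset1.
  by rewrite big_seq_fset1.
apply: (@zero_density R pt enumpt (fun=> 0) set0 1 1 enumptP) => //.
  by move=> _; rewrite lexx ler01.
move=> eta eta0; exists unit, (wdirac R tt), (fun=> 0); split; first exact: wdirac_weight.
by move=> u; rewrite wavg_dirac ltW.
Qed.

(** The decomposition f = c + w of the representing vector.  When all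
exponents of p vanish, p is a constant lying in every nonzero ideal, so it is
zero because 2 is not invertible, and all points return. *)
Lemma large_returns eps : 0 < eps ->
  AIP_star_plus R [set u : pt | - eps < phi (sparse_eval l u)].
Proof.
move=> eps0.
have [[q ql qn]|cst] := pselect (exists2 q, q \in l & q.2 != [ffun=> 0%N]); last first.
  have l0 (u : pt) : sparse_eval l u = sparse_eval l (0 : pt).
    rewrite /sparse_eval !big_seq; apply: eq_bigr => q ql; congr (_ * _).
    have [->|qn] := eqVneq q.2 [ffun=> 0%N]; last by case: cst; exists q.
    by apply: eq_bigr => i _; rewrite [[ffun=> 0%N] i]ffunE !expr0.
  have z : sparse_eval l (0 : pt) = 0.
    apply/eqP; apply: contraT => n0.
    have [|u [b]] := lint (c := sparse_eval l (0 : pt) * 2%:R).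
      by apply/eqP => /dom [/eqP|/eqP]; [exact/negP|exact/negP/(char0 1)].
    rewrite l0 -mulrA -[X in X = _ -> _]mulr1 => /eqP; rewrite -subr_eq0 -mulrBr.
    move=> /eqP /dom [/eqP h|/eqP]; first by rewrite h in n0.
    by rewrite subr_eq0 eq_sym (negbTE (nohalf b)).
  have -> : [set u : pt | - eps < phi (sparse_eval l u)] = setT.
    apply/seteqP; split=> // u _ /=; rewrite l0 z.
    have [H [f [_ <-]]] := posdef_rep pphi.
    by rewrite act0 (lt_le_trans _ (ip_ge0 _)) // oppr_lt0.
  exact: AIP_star_plusT.
have lnc : exists2 q, q \in l & q.2 != [ffun=> 0%N] by exists q.
have [H [f [cH hf]]] := posdef_rep pphi.
have [c cc perp] := projection cH f (compact_vec_subspace H) (@compact_vec_closed _ _ H).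
have [w ew perpw] : exists2 w, f = w + c & forall m, compact_vec m -> ip w m = 0.
  by exists (f - c); rewrite ?subrK.
have cact g : compact_vec (act g c).
  apply: totally_bdd_le cc => h h'; rewrite !orbit_distE.
  have -> : act (h - h') (act g c) = act g (act (h - h') c) by rewrite -!actD addrC.
  by rewrite -act_sub nm_act.
pose del := Num.min 1 (eps / 8).
have del0 : 0 < del by rewrite lt_min ltr01 divr_gt0.
have [del1 del2] : del <= 1 /\ del <= eps / 8 by rewrite !ge_min !lexx orbT.
have [z hz] := bohr_recurrence dom char0 lu ln0 lnc lint cc del0.
pose Q (u : pt) := sparse_eval l (z + u) - sparse_eval l z.
pose rho g := nm (act g c - c).
have rhoD a b : rho (a + b) <= rho a + rho b.
  rewrite /rho [a + b]addrC actD (le_trans (nm_tri (act b c) _ _)) //.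
  by rewrite -act_sub nm_act.
have rhoN a : rho (- a) = rho a.
  by rewrite /rho -(nm_act a) act_sub actNK nmBC.
have rho0 : rho 0 = 0 by rewrite /rho act0 subrr nm0.
have rho_tb : totally_bdd setT (fun a b => rho (a - b)).
  by apply: totally_bdd_le cc => a b; rewrite orbit_distE.
have IPs : IP_star [set u : pt | rho (Q u) < del].
  move=> I [x hx]; have [D hD] := sparse_eval_polyfun l z.
  have pQ (q0 : unit) : polyfun D.+1 Q.
    apply: polyfunD; first exact: polyfunS.
    exact: polyfun_le (ltn0Sn D) (polyfun_cst _).
  have Q0 (q0 : unit) : Q 0 = 0 by rewrite /Q addr0 subrr.
  have [k [y [[a [a0 _ ya]] hy]]] :=
    ip_recurrence x rho0 rhoN rhoD rho_tb pQ Q0 0%N del0.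
  exists y; split; first exact: (hy tt).
  by apply: hx; exists a.
pose kap g := ip (act g w) w.
have zm : zero_mean (fun g => kap g ^+ 2).
  move=> d e d0 e0; have [r hr] := cover d0.
  have [s [ps ss h]] := weak_mixing cH perpw (multiples_subgroup d) (ex_intro _ r hr) e0.
  have [s' ps' hs'] := weights_in_multiples ps ss; exists s'; split=> //.
  move: h; rewrite hs'; congr (_ < _); apply: eq_wavg => g.
  by rewrite hs'.
have [H2 [w2 [_ hw2]]] := posdef_rep (posdefX 2 (rep_posdef w)).
have zm2 : zero_mean (fun g => ip (act g w2) w2).
  move=> d e d0 e0; have [s [ps h]] := zm d e d0 e0; exists s; split=> //.
  by move: h; congr (_ < _); apply: eq_wavg => g; apply: eq_wavg => g'; rewrite hw2.
pose F (u : pt) := kap (sparse_eval l (z + u)) ^+ 2.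
pose S := [set u : pt | - eps < phi (sparse_eval l u)].
pose S' := [set u : pt | S (z + u)].
pose Z := [set u : pt | rho (Q u) < del] `\` S'.
have ZF u : Z u -> (eps / 2) ^+ 2 <= F u.
  move=> [/= hu nS]; rewrite leNgt; apply/negP => hF; apply: nS; rewrite /S' /S /=.
  set g := sparse_eval l (z + u).
  have hk : - (eps / 2) < kap g.
    have e2 : 0 < eps / 2 by rewrite divr_gt0.
    by rewrite ltNge; apply/negP => hk; move: hF; rewrite /F -/g !expr2; nra.
  have hr : rho g < 2 * del.
    have -> : g = Q u + sparse_eval l z by rewrite /Q subrK.
    have := rhoD (Q u) (sparse_eval l z); move: hu hz; rewrite -/(rho _); lra.
  have -> : phi g = ip (act g c) c + kap g.
    rewrite -hf ew act_add ipDl !ipDr [ip (act g w) c]act_adj perpw //.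
    by rewrite [ip (act g c) w]ipC perpw // addr0 add0r addrC.
  have : rho g ^+ 2 = ip c c + ip c c - 2 * ip (act g c) c.
    by rewrite /rho nm2 ipBl !ipBr act_iso (ipC c); ring.
  have r0 : 0 <= rho g by exact: nm_ge0.
  have cc0 := ip_ge0 c.
  rewrite expr2 => e1.
  have : rho g * rho g <= 2 * del * (2 * del) by rewrite ler_pM // ltW.
  have : del * del <= del * 1 by rewrite ler_wpM2l // ltW.
  move: e1 hk del2; rewrite !mulrA; set P := rho g * rho g; move: (ip (act g c) c) => ii.
  by lra.
have dZ : upper_banach_density R Z = 0%E.
  apply: (@zero_density R pt enumpt F Z (ip w w ^+ 2) ((eps / 2) ^+ 2) enumptP _ _ _ ZF).
  - move=> u; rewrite sqr_ge0 /= /F -[kap _ ^+ 2]real_normK ?num_real //.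
    have b := kap_bound w (sparse_eval l (z + u)); by rewrite ler_sqr ?nnegrE ?ip_ge0.
  - by rewrite exprn_gt0 // divr_gt0.
  move=> eta eta0; have [k [D [a [_ a0 hq]]]] := kronecker lu ln0 lnc.
  have [W pW gW] := weyl dom char0 zm2 D a0 eta0.
  exists A, W, (kronecker_shift n k); split=> // u.
  have [p0 [pD pa pe]] := hq (z + u).
  have := gW p0 pD pa; apply: le_trans; apply: le_trans (ler_norm _).
  rewrite le_eqVlt; apply/orP; left; apply/eqP; apply: eq_wavg => t.
  rewrite hw2 pe /F /kap; congr (ip (act (sparse_eval l _) _) _ ^+ _).
  by rewrite -addrA [u + _]addrC.
exists z, S'; split; last first.
  apply/seteqP; split=> [u hu|_ [u hu <-]] //; exists (u - z); last by rewrite addrC subrK.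
  by rewrite /S' /= addrC subrK.
(* The returns are all kept: the IP* set is enlarged by them, and only the
   non-returning points of the original one are removed. *)
exists (S' `|` [set u : pt | rho (Q u) < del]), Z; split=> //.
  by move=> I /IPs [y [hy yI]]; exists y; split=> //; right.
apply/seteqP; split=> u.
  by move=> hu; split; [left|case].
by move=> [[//|hu] nZ]; apply: contrapT => nS; apply: nZ.
Qed.
End Core.

(** * The theorem *)
Theorem theorem1p17 (R : realType) (L : fieldExtType rat) (n : nat)
    (p : mpoly.mpoly n (ring_of_integers L)) (hp : intersective p)
    (dX : measure_display) (X : measurableType dX) (mu : probability X R)
    (T : ring_of_integers L -> X -> X)
    (hT : measure_preserving_action mu T)
    (B : set X) (hB : measurable B) (eps : R) (heps : 0 < eps) :
  AIP_star_plus R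
    [set u : {ffun 'I_n -> ring_of_integers L} |
      (mu B ^+ 2 - eps%:E < mu (B `&` T (mpoly.meval u p) @` B))%E].
Proof.
have [l [lu ln0 pl]] := mpoly_data p.
have [e eP] := ring_point_enum L n.
have lint (c : ring_of_integers L) : c != 0 ->
    exists u : {ffun 'I_n -> ring_of_integers L}, multiples c (sparse_eval l u).
  move=> /ring_cover [r hr]; have [u hu] := intersective_multiples hp hr.
  by exists u; rewrite /sparse_eval -pl.
have := large_returns (@ring_dom L) (@ring_char0 L) (@no_half L) (@ring_cover L)
  eP lu ln0 lint (correlation_posdef hT hB) heps.
congr (AIP_star_plus R _); apply/seteqP; split=> u /=; rewrite -[sparse_eval l u]pl;
  set C := B `&` _; have mC : measurable C by
    (apply: measurableI => //; rewrite (act_imageE _ hT); exact: measurable_act hT _ _ hB).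
all: rewrite -[mu B]fineK ?fin_num_measure // -[mu C]fineK ?fin_num_measure //.
all: by rewrite /= -EFinM -EFinD lte_fin expr2; lra.
Qed.
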